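(* Let $S=(S(t))_{t\ge 0}$ be the family given by $S(t)u:=\inf_{n\in\mathbb N_0} I^n(t)u$ (pointwise infimum) for $t\ge 0$ and $u\in \mathrm{C}_{\mathrm b}$. Then $S$ is a strongly continuous convex transition semigroup on $\mathrm{C}_{\mathrm b}$. Let $A$ denote the generator of $S$, and let $B$ denote the generator of the reference semigroup $T$. Then $D(B)\cap \mathrm{C}_{\mathrm b}^1\subset D(A)$ with $$(Au)(x)=(Bu)(x)+\varphi^*\big(\|u'(x)\|\big)\quad\text{for all }u\in D(B)\cap \mathrm{C}_{\mathrm b}^1\text{ and }x\in X.$$
   Context: Setting. $(X,\|\cdot\|)$ is a separable Banach space with Borel $\sigma$-algebra $\mathcal B(X)$. $K\colon X\to X$ is a fixed linear operator such that $\{Kx\colon \|x\|\le r\}$ is compact for all $r\ge 0$, $\{Kx\colon x\in X\}$ is dense in $X$, and $\|Kx\|\le\|x\|$ for all $x\in X$. Function spaces. $\mathrm{Lip}$ is the space of all $u\colon X\to\mathbb R$ with $|u(x_1)-u(x_2)|\le L\|K(x_1-x_2)\|$ for all $x_1,x_2\in X$ and some $L\ge 0$; the smallest such $L$ is $\|u\|_{\mathrm{Lip}}$. $\mathrm{Lip}_{\mathrm b}$ is the set of $u\in\mathrm{Lip}$ with $\|u\|_\infty:=\sup_{x\in X}|u(x)|<\infty$. For bounded continuous functions $u_n\colon X\to\mathbb R$ and $u\colon X\to\mathbb R$, write $u_n\to u$ if $\sup_n\|u_n\|_\infty<\infty$ and $\lim_{n\to\infty}\sup_{\|x\|\le r}|u(x)-u_n(x)|=0$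 for all $r\ge 0$; convergence of families indexed by $h\downarrow 0$ is understood analogously (sup norms bounded for small $h$, and uniform convergence on balls). Convergence $S(t)u_n\to S(t)u$ uniformly in $t\in[0,s]$ means $\sup_n\sup_{t\in[0,s]}\|S(t)u_n\|_\infty<\infty$ and $\lim_{n\to\infty}\sup_{t\in[0,s]}\sup_{\|x\|\le r}|(S(t)u_n)(x)-(S(t)u)(x)|=0$ for all $r\ge0$. $\mathrm{C}_{\mathrm b}$ is the space of all $u\colon X\to\mathbb R$ for which there is a sequence $(u_n)\subset\mathrm{Lip}_{\mathrm b}$ with $u_n\to u$. $\mathrm{C}_{\mathrm b}^1$ is the space of all $u\in\mathrm{Lip}_{\mathrm b}$ with Fréchet derivative $u'\colon X\to X'$ such that $x\mapsto\|u'(x)\|$ belongs to $\mathrm{C}_{\mathrm b}$, where the dual $X'$ carries the operator norm. Wasserstein distance. Fix $p\in(1,\infty)$. $\mathcal P_p(X)$ is the set of Borel probability measures on $X$ with finite $p$-th moment, and $\mathcal W_p(\mu,\nu)=\big(\inf_{\pi\in\mathrm{Cpl}(\mu,\nu)}\int_{X\times X}\|y-z\|^p\,\pi(dy,dz)\big)^{1/p}$, where $\mathrm{Cpl}(\mu,\nu)$ is the set of couplings of $\mu$ and $\nu$. $\delta_0$ is the Dirac measure at $0$. Reference model. $(\mu_t)_{t\ge0}\subset\mathcal P_p(X)$ and $\psi_t\colon X\to X$, $t\ge 0$, are continuous maps such that for all $s,t\ge0$, $u\in\mathrm{C}_{\mathrm b}$, $x\in X$, $$\int_X u(\psi_{t+s}(x)+y)\,\mu_{t+s}(dy)=\int_X\int_X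 u\big(\psi_s(\psi_t(x)+y_t)+y_s\big)\,\mu_s(dy_s)\,\mu_t(dy_t).$$ Standing assumptions: (A1) there is a constant $c\ge0$ with $\|\psi_t(x_1)-\psi_t(x_2)\|\le e^{ct}\|x_1-x_2\|$ for all $t\ge0$, $x_1,x_2\in X$ (this $c$ is fixed); (A2) $K\psi_t(x)=\psi_t(Kx)$ for all $t\ge0$, $x\in X$, $\psi_0(x)=x$ for all $x\in X$, and $\lim_{h\downarrow0}\sup_{\|x\|\le r}\|\psi_h(Kx)-Kx\|=0$ for all $r\ge0$; (A3) $\lim_{h\downarrow0}\int_X\|y\|^p\,\mu_h(dy)=0$. The reference semigroup is $(T(t)u)(x)=\int_X u(\psi_t(x)+y)\,\mu_t(dy)$ for $t\ge 0$, $u\in\mathrm{C}_{\mathrm b}$, $x\in X$; it is itself a strongly continuous convex transition semigroup in the sense below. Penalisation. $\varphi\colon[0,\infty)\to[0,\infty]$ is convex and lower semicontinuous, $\varphi(0)=0$, $\varphi(v)\ne0$ for some $v>0$, and $v\mapsto\varphi(v^{1/p})$ is convex. Its conjugate is $\varphi^*(w)=\sup_{v\ge0}(vw-\varphi(v))$, $w\ge0$. Set $\varphi_t(v)=t\varphi(e^{-ct}v/t)$ for $t>0$, $v\ge 0$, and $\varphi_0(v)=\infty$ for $v>0$, $\varphi_0(0)=0$. Operators. $(I(t)u)(x)=\sup_{\nu\in\mathcal P_p(X)}\big(\int_X u(\psi_t(x)+z)\,\nu(dz)-\varphi_t(\mathcal W_p(\mu_t,\nu))\big)$ for $t\ge 0$,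 $u\in\mathrm{C}_{\mathrm b}$, $x\in X$. For $n\in\mathbb N_0$, $t\ge0$: $I^n(t)u:=I(2^{-n})^kI(t-k2^{-n})u$, where $k\in\mathbb N_0$ is the largest integer with $k2^{-n}\le t$. Strongly continuous convex transition semigroup (on $\mathrm{C}_{\mathrm b}$): a family $S=(S(t))_{t\ge0}$ such that (i) for all $t\ge0$, $S(t)\colon\mathrm{C}_{\mathrm b}\to\mathrm{C}_{\mathrm b}$ is convex and monotone (with respect to the pointwise order), $S(t)m=m$ for every constant $m\in\mathbb R$, and $\|S(t)u\|_{\mathrm{Lip}}\le e^{ct}\|u\|_{\mathrm{Lip}}$ (in particular $S(t)u\in \mathrm{Lip}_{\mathrm b}$) for all $u\in\mathrm{Lip}_{\mathrm b}$; (ii) $S(t)S(s)=S(t+s)$ for all $s,t\ge0$; (iii) $S(t)u_n\to S(t)u$ uniformly in $t\in[0,s]$ as $n\to\infty$ for all $s\ge0$, $(u_n)\subset\mathrm{C}_{\mathrm b}$ and $u\in\mathrm{C}_{\mathrm b}$ with $u_n\to u$; (iv) $S(t)u\to u$ as $t\downarrow0$ for all $u\in\mathrm{C}_{\mathrm b}$. Generator of such a semigroup $S$: $D(A)$ is the set of $u\in\mathrm{C}_{\mathrm b}$ for which $\frac{S(h)u-u}{h}\to g$ as $h\downarrow0$ for some $g\in\mathrm{C}_{\mathrm b}$, and $Au:=g$. $B$ with domain $D(B)$ is the generator of $T$ in the same sense. *)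

(* Defs.v *)
From HB Require Import structures.
From mathcomp Require Export all_boot all_order all_algebra.
From mathcomp Require Export all_classical all_reals all_analysis.

Set Implicit Arguments.
Unset Strict Implicit.
Unset Printing Implicit Defensive.
Export Order.TTheory GRing.Theory Num.Theory.
Export numFieldNormedType.Exports.
Local Open Scope classical_set_scope.
Local Open Scope ring_scope.

Notation borel X := (g_sigma_algebraType (@open X)).

Definition separable (X : topologicalType) : Prop :=
  exists2 D : set X, countable D & dense D.

Definition nball (R : realType) (X : normedModType R) (r : R) : set X :=
  [set x | `|x| <= r].

(** * Function spaces *)

Definition unorm (R : realType) (X : Type) (A : set X) (u : X -> R) : \bar R :=
  ereal_sup [set (`|u x|)%:E | x in A].

Definition seq_conv (R : realType) (X : normedModType R)
    (u_ : nat -> X -> R) (u : X -> R) : Prop :=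
  (ereal_sup (range (fun n => unorm setT (u_ n))) < +oo)%E /\
  forall r : R, 0 <= r ->
    unorm (nball r) (u \- u_ n) @[n --> \oo] --> (0 : \bar R).

Definition right0_conv (R : realType) (X : normedModType R)
    (u_ : R -> X -> R) (u : X -> R) : Prop :=
  (exists M : R, \forall h \near 0^'+, (unorm setT (u_ h) <= M%:E)%E) /\
  forall r : R, 0 <= r ->
    unorm (nball r) (u \- u_ h) @[h --> 0^'+] --> (0 : \bar R).

Definition is_Lip_bound (R : realType) (X : normedModType R) (K : X -> X)
    (u : X -> R) (L : R) : Prop :=
  0 <= L /\ forall x1 x2, `|u x1 - u x2| <= L * `|K (x1 - x2)|.

Definition Lip (R : realType) (X : normedModType R) (K : X -> X) :
    set (X -> R) :=
  [set u | exists L, is_Lip_bound K u L].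

(* For [u] in [Lip K] the infimum is attained, so this is the smallest bound. *)
Definition Lip_norm (R : realType) (X : normedModType R) (K : X -> X)
    (u : X -> R) : R :=
  inf [set L | is_Lip_bound K u L].

Definition Lipb (R : realType) (X : normedModType R) (K : X -> X) :
    set (X -> R) :=
  [set u | Lip K u /\ (unorm setT u < +oo)%E].

Definition Cb (R : realType) (X : normedModType R) (K : X -> X) :
    set (X -> R) :=
  [set u | exists u_ : nat -> X -> R,
             (forall n, Lipb K (u_ n)) /\ seq_conv u_ u].

Definition opnorm (R : realType) (X : normedModType R) (l : X -> R) : R :=
  sup [set `|l v| | v in nball 1].

(* [R^o] is [R] as a normed module over itself; [differentiable] is Frechet
   differentiability and ['d u x] is the (continuous linear) derivative. *)
Definition deriv_norm (R : realType) (X : normedModType R) (u : X -> R)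
    (x : X) : R :=
  opnorm ('d (u : X -> R^o) x : X -> R).

Definition Cb1 (R : realType) (X : normedModType R) (K : X -> X) :
    set (X -> R) :=
  [set u | [/\ Lipb K u,
               forall x, differentiable (u : X -> R^o) x &
               Cb K (deriv_norm u)]].

(** * Wasserstein distance *)

Definition Pp (R : realType) (X : normedModType R) (p : R) :
    set (probability (borel X) R) :=
  [set nu : probability (borel X) R | (\int[nu]_y ((`|y : X| `^ p)%R%:E) < +oo)%E].

Definition coupling (R : realType) (X : normedModType R)
    (mu nu : probability (borel X) R) :
    set (probability (borel X * borel X)%type R) :=
  [set pi : probability (borel X * borel X)%type R |
   forall A : set (borel X), measurable A ->
     pi (fst @^-1` A) = mu A /\ pi (snd @^-1` A) = nu A].

(* The infimum is finite for [mu] and [nu] in [Pp p], so [fine] is harmless. *)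
Definition wasserstein (R : realType) (X : normedModType R) (p : R)
    (mu nu : probability (borel X) R) : R :=
  fine (ereal_inf
    [set (\int[pi]_z ((`|(z.1 : X) - (z.2 : X)| `^ p)%R%:E))%E
      | pi in coupling mu nu]) `^ p^-1.

(** * Penalisation *)

(* A function [[0, +oo[ -> [0, +oo]] is represented by [f : R -> \bar R], whose
   values on negative arguments are never used. *)
Definition convex_nneg (R : realType) (f : R -> \bar R) : Prop :=
  forall v w l : R, 0 <= v -> 0 <= w -> 0 <= l -> l <= 1 ->
    (f (l * v + (1 - l) * w)%R <= l%:E * f v + (1 - l)%:E * f w)%E.

Definition conjugate (R : realType) (phi : R -> \bar R) (w : R) : \bar R :=
  ereal_sup [set ((v * w)%:E - phi v)%E | v in [set v : R | 0 <= v]].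

Definition phi_time (R : realType) (c : R) (phi : R -> \bar R) (t v : R) :
    \bar R :=
  if t == 0 then (if v == 0 then 0%E else +oo%E)
  else (t%:E * phi (expR (- (c * t)) * v / t)%R)%E.

Definition penalisation (R : realType) (p : R) (phi : R -> \bar R) : Prop :=
  [/\ forall v, 0 <= v -> (0 <= phi v)%E,
      convex_nneg phi /\
        lower_semicontinuous (phi : subspace `[0, +oo[ -> \bar R),
      phi 0 = 0%E,
      exists2 v, 0 < v & phi v != 0%E &
      convex_nneg (fun v => phi (v `^ p^-1))].

(** * Operators *)

Definition ref_op (R : realType) (X : normedModType R)
    (mu : R -> probability (borel X) R) (psi : R -> X -> X)
    (t : R) (u : X -> R) : X -> R :=
  fun x => \int[mu t]_y u (psi t x + (y : X)).

(* For [u] in [Cb K] the supremum is finite: it is bounded by the sup norm of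
   [u], and [nu = mu t] contributes a finite value. *)
Definition I_op (R : realType) (X : normedModType R) (p c : R)
    (phi : R -> \bar R) (mu : R -> probability (borel X) R)
    (psi : R -> X -> X) (t : R) (u : X -> R) : X -> R :=
  fun x => fine (ereal_sup
    [set ((\int[nu]_z u (psi t x + (z : X)))%R%:E
          - phi_time c phi t (wasserstein p (mu t) nu))%E
      | nu in Pp p]).

Definition I_iter (R : realType) (X : normedModType R) (p c : R)
    (phi : R -> \bar R) (mu : R -> probability (borel X) R)
    (psi : R -> X -> X) (n : nat) (t : R) (u : X -> R) : X -> R :=
  let h : R := 2 ^- n in
  let k := Num.truncn (t / h) in
  iter k (I_op p c phi mu psi h) (I_op p c phi mu psi (t - k%:R * h) u).

Definition S_op (R : realType) (X : normedModType R) (p c : R)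
    (phi : R -> \bar R) (mu : R -> probability (borel X) R)
    (psi : R -> X -> X) (t : R) (u : X -> R) : X -> R :=
  fun x => inf (range (fun n => I_iter p c phi mu psi n t u x)).

(** * Transition semigroups and generators *)

Definition seq_conv_unif (R : realType) (X : normedModType R)
    (S : R -> (X -> R) -> X -> R) (s : R) (u_ : nat -> X -> R) (u : X -> R) :
    Prop :=
  (ereal_sup (range (fun n =>
     ereal_sup [set unorm setT (S t (u_ n)) | t in `[0%R, s]])) < +oo)%E /\
  forall r : R, 0 <= r ->
    ereal_sup [set unorm (nball r) (S t (u_ n) \- S t u) | t in `[0, s]]
      @[n --> \oo] --> (0 : \bar R).

Record convex_transition_semigroup (R : realType) (X : normedModType R)
    (K : X -> X) (c : R) (S : R -> (X -> R) -> X -> R) : Prop := {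
  cts_stable : forall t u, 0 <= t -> Cb K u -> Cb K (S t u);
  cts_convex : forall t u v (l : R), 0 <= t -> Cb K u -> Cb K v ->
    0 <= l -> l <= 1 -> forall x,
    S t (fun y => l * u y + (1 - l) * v y) x
      <= l * S t u x + (1 - l) * S t v x;
  cts_monotone : forall t u v, 0 <= t -> Cb K u -> Cb K v ->
    (forall x, u x <= v x) -> forall x, S t u x <= S t v x;
  cts_const : forall t (m : R), 0 <= t -> S t (cst m) = cst m;
  cts_Lip : forall t u, 0 <= t -> Lipb K u ->
    Lipb K (S t u) /\ Lip_norm K (S t u) <= expR (c * t) * Lip_norm K u;
  cts_semigroup : forall s t u, 0 <= s -> 0 <= t -> Cb K u ->
    S t (S s u) = S (t + s) u;
  cts_cont : forall (s : R) (u_ : nat -> X -> R) u, 0 <= s ->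
    (forall n, Cb K (u_ n)) -> Cb K u -> seq_conv u_ u ->
    seq_conv_unif S s u_ u;
  cts_strong_cont : forall u, Cb K u -> right0_conv (fun t => S t u) u
}.

Definition is_generator_at (R : realType) (X : normedModType R) (K : X -> X)
    (S : R -> (X -> R) -> X -> R) (u : X -> R) : set (X -> R) :=
  [set g | Cb K g /\ right0_conv (fun h x => (S h u x - u x) / h) g].

Definition gen_dom (R : realType) (X : normedModType R) (K : X -> X)
    (S : R -> (X -> R) -> X -> R) : set (X -> R) :=
  [set u | Cb K u /\ is_generator_at K S u !=set0].

(* Limits in the sense of [right0_conv] are unique, so on [gen_dom K S] the
   choice made by [get] is the only possible one. *)
Definition gen (R : realType) (X : normedModType R) (K : X -> X)
    (S : R -> (X -> R) -> X -> R) (u : X -> R) : X -> R :=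
  get (is_generator_at K S u).

(* Main.v *)
From HB Require Import structures.
Require Import Defs.
From mathcomp Require Import ring lra measurable_realfun.

(** Couplings do not glue well here: [K] may have a kernel, so that a law is not
    determined by the integrals of functions in [Cb]. The proof therefore never
    composes measures. It works with a dual description of the one-step operator
    [I t]. Every affine minorant [k * v^p - D] of the penalty gives the bound
    [I t u <= t * D + T t (Q u)], where [Q] is the sup-convolution with a price
    proportional to [|z|^p] that depends on [k] and [t] ([I_weak]), and this is
    sharp for a suitable minorant ([I_strong]). The second half rests on the
    convexity of the set of pairs (transport cost, gain), on a separation argument
    in dimension one ([fenchel_duality]) and on a measurable selection of
    displacements.

    The sup-convolutions compose with each other and pass through [T] up to the
    factor by which the flow stretches distances ([sup_conv_semigroup]). With the
    dual formula this gives [I t (I s u) <= I (t + s) u] ([I_superadditive]), so the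
    iterations decrease as the grid is refined.

    All continuity comes from one source. An operator that is convex, monotone,
    preserves constants and Lipschitz bounds and lies between [T t] and [I t]
    (record [admissible]) is equicontinuous for bounded convergence on balls, with
    constants that depend on [t] only through an upper bound ([adm_tight]), and
    close to the identity for small [t] ([adm_near_id]). These operators are closed
    under composition and decreasing limits, so the estimates hold for the
    iterations and for [S]. The semigroup property is exact on dyadic times for the
    iterations. It passes to [S] because the convergence is uniform on balls, by
    Dini's theorem and the compactness of [K], and to all times by continuity from
    the right.

    For the generator, let [w] be the norm of the derivative of [u]. The increment
    of [u] over a displacement of length [s] is at most about [w s], by the mean
    value theorem, and about [w s] is achieved ([slope_lower]). In [I_weak] and
    [I_strong] this turns the first-order term of [I h u - T h u] into the supremum
    of [v * w - phi v] over speeds [v], that is into the conjugate of [phi] at [w].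
    Since [S h <= I h], the upper bound for [S] is immediate. For the lower bound,
    the iteration is a telescope of increments [P (I d u) - P u] with [P]
    admissible, and convexity of [P] bounds each of them from below by
    [d * (P u - P (u - (I d u - u) / d))], which is close to [d] times the candidate
    for the generator. *)

Set Implicit Arguments.
Unset Strict Implicit.
Unset Printing Implicit Defensive.
Local Open Scope classical_set_scope.
Local Open Scope ring_scope.

(** * Convergence on balls and the function spaces *)

Lemma cvge0_leP {R : realType} {T : Type} (F : set_system T) {FF : Filter F}
    (f : T -> \bar R) : (forall t, (0 <= f t)%E) ->
  (f @ F --> 0%E) <-> (forall e : R, 0 < e -> \forall t \near F, (f t <= e%:E)%E).
Proof.
move=> f0; split=> [/fine_cvgP[ffin /cvgrPdist_le f0e] e e0|fe].
  near=> t.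
  have fint : f t \is a fin_num by near: t.
  have : `|0 - fine (f t)| <= e by near: t; exact: f0e.
  by rewrite sub0r normrN ger0_norm ?fine_ge0// -lee_fin fineK.
have ffin : \forall t \near F, f t \is a fin_num.
  near=> t; rewrite ge0_fin_numE//; apply: le_lt_trans (ltry 1).
  by near: t; exact: fe.
apply/fine_cvgP; split=> //; apply/cvgrPdist_le => e e0; near=> t.
have fint : f t \is a fin_num by near: t.
rewrite sub0r normrN ger0_norm ?fine_ge0// -lee_fin fineK//.
by near: t; exact: fe.
Unshelve. all: by end_near. Qed.

Section FunctionSpaces.
Context {R : realType} {X : normedModType R} (K : {linear X -> X}).
Implicit Types (u v : X -> R) (r e M L : R).

Lemma nball0 r : 0 <= r -> nball r (0 : X).
Proof. by rewrite /nball /= normr0. Qed.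

Lemma unorm_leP (A : set X) u M : (unorm A u <= M%:E)%E <->
  forall x, A x -> `|u x| <= M.
Proof.
split=> [uM x Ax|uM].
  rewrite -lee_fin; apply: le_trans uM.
  by apply: ereal_sup_ubound; exists x.
by apply: ge_ereal_sup => _ [x Ax <-]; rewrite lee_fin uM.
Qed.

Lemma unorm_ltyP (A : set X) u : (unorm A u < +oo)%E <->
  exists M, forall x, A x -> `|u x| <= M.
Proof.
split=> [|[M /unorm_leP uM]]; last exact: le_lt_trans uM (ltry _).
case E : (unorm A u) => [s| |] // _.
- by exists s; apply/unorm_leP; rewrite E.
- by exists 0; apply/unorm_leP; rewrite E leNye.
Qed.

Lemma unorm_nball_ge0 r u : 0 <= r -> (0 <= unorm (nball r) u)%E.
Proof.
move=> r0; apply: (@le_trans _ _ (`|u 0|)%:E); first by rewrite lee_fin.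
by apply: ereal_sup_ubound; exists 0 => //; exact: nball0.
Qed.

Lemma LipbP u : Lipb K u <->
  exists L M, is_Lip_bound K u L /\ forall x, `|u x| <= M.
Proof.
split=> [[[L uL] /unorm_ltyP[M uM]]|[L [M [uL uM]]]].
  by exists L, M; split=> // x; exact: uM.
by split; [exists L|apply/unorm_ltyP; exists M].
Qed.

Lemma seq_convP (u_ : nat -> X -> R) u : seq_conv u_ u <->
  (exists M, forall n x, `|u_ n x| <= M) /\
  (forall r e, 0 < e -> \forall n \near \oo,
    forall x, `|x| <= r -> `|u x - u_ n x| <= e).
Proof.
split=> [[uoo uc]|[[M uM] uc]].
  split.
    case E : (ereal_sup _) uoo => [s| |] // _.
    - exists s => n x; have : (unorm setT (u_ n) <= s%:E)%E.
        by rewrite -E; apply: ereal_sup_ubound; exists n.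
      by move/unorm_leP; exact.
    - exists 0 => n x; have : (unorm setT (u_ n) <= 0%:E)%E.
        apply: le_trans (leNye _); rewrite -E.
        by apply: ereal_sup_ubound; exists n.
      by move/unorm_leP; exact.
  move=> r e e0; have r0 : 0 <= Num.max r 0 by rewrite le_max lexx orbT.
  have /cvge0_leP := uc _ r0.
  move=> /(_ (fun n => unorm_nball_ge0 _ r0) _ e0) ue; near=> n => x xr.
  have /unorm_leP : (unorm (nball (Num.max r 0)%R) (u \- u_ n)%R <= e%:E)%E.
    by near: n.
  by move=> /(_ x) uux; apply: uux; rewrite /nball /= le_max xr.
split.
  apply: le_lt_trans (ltry M); apply: ge_ereal_sup => _ [n _ <-].
  exact/unorm_leP.
move=> r r0; apply/cvge0_leP => [n|e e0]; first exact: unorm_nball_ge0.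
apply: filterS (uc r _ e0) => n un; apply/unorm_leP => x xr; exact: un.
Unshelve. all: by end_near. Qed.

Lemma right0_convP (u_ : R -> X -> R) u : right0_conv u_ u <->
  (exists M, \forall h \near 0^'+, forall x, `|u_ h x| <= M) /\
  (forall r e, 0 < e -> \forall h \near 0^'+,
    forall x, `|x| <= r -> `|u x - u_ h x| <= e).
Proof.
split=> [[[M uM] uc]|[[M uM] uc]].
  split.
    by exists M; apply: filterS uM => h /unorm_leP uM x; exact: uM.
  move=> r e e0; have r0 : 0 <= Num.max r 0 by rewrite le_max lexx orbT.
  have /cvge0_leP := uc _ r0.
  move=> /(_ (fun n => unorm_nball_ge0 _ r0) _ e0).
  apply: filterS => h /unorm_leP + x xr.
  by move=> /(_ x) uux; apply: uux; rewrite /nball /= le_max xr.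
split; first by exists M; apply: filterS uM => h uM; apply/unorm_leP => x _.
move=> r r0; apply/cvge0_leP => [n|e e0]; first exact: unorm_nball_ge0.
by apply: filterS (uc r _ e0) => h uh; apply/unorm_leP => x xr; exact: uh.
Qed.

Lemma seq_conv_unif_intro (S : R -> (X -> R) -> X -> R) (s : R)
    (u_ : nat -> X -> R) u : 0 <= s ->
  (exists M, forall n t x, 0 <= t <= s -> `|S t (u_ n) x| <= M) ->
  (forall r e, 0 < e -> \forall n \near \oo,
    forall t x, 0 <= t <= s -> `|x| <= r -> `|S t (u_ n) x - S t u x| <= e) ->
  seq_conv_unif S s u_ u.
Proof.
move=> s0 [M uM] uc; split.
  apply: le_lt_trans (ltry M); apply: ge_ereal_sup => _ [n _ <-].
  apply: ge_ereal_sup => _ [t + <-]; rewrite /= in_itv/= => ts.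
  by apply/unorm_leP => x _; exact: uM.
move=> r r0; apply/cvge0_leP => [n|e e0].
  apply: (@le_trans _ _ (unorm (nball r) (S 0 (u_ n) \- S 0 u))).
    exact: unorm_nball_ge0.
  by apply: ereal_sup_ubound; exists 0 => //=; rewrite in_itv/= lexx.
apply: filterS (uc r _ e0) => n un; apply: ge_ereal_sup => _ [t + <-].
rewrite /= in_itv/= => ts.
by apply/unorm_leP => x xr; exact: un.
Qed.

Lemma is_Lip_bound_norm u L : (forall x : X, `|K x| <= `|x|) ->
  is_Lip_bound K u L -> forall x y, `|u x - u y| <= L * `|x - y|.
Proof.
move=> K1 [L0 uL] x y; apply: le_trans (uL x y) _.
by rewrite ler_wpM2l.
Qed.

Lemma Lipb_Cb u : Lipb K u -> Cb K u.
Proof.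
move=> uL; exists (fun=> u); split=> //; apply/seq_convP.
have /LipbP[_ [M [_ uM]]] := uL; split; first by exists M.
by move=> r e e0; near=> n => x _; rewrite subrr normr0 ltW.
Unshelve. all: by end_near. Qed.

Lemma Cb_cst M : Cb K (cst M).
Proof.
apply/Lipb_Cb/LipbP; exists 0, `|M|; split=> //; split=> // x y.
by rewrite subrr normr0 mul0r.
Qed.

(** Sequences are gone: one approximation for each ball and each error is enough,
    since a diagonal choice over balls of radius [n] gives a sequence back. *)
Lemma CbP u : Cb K u <-> exists M, forall r e, 0 < e ->
  exists v, [/\ Lipb K v, forall x, `|v x| <= M &
    forall x, `|x| <= r -> `|u x - v x| <= e].
Proof.
split=> [[u_ [uL /seq_convP[[M uM] uc]]]|[M uM]].
  exists M => r e e0.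
  have [N _ uN] := uc r e e0.
  by exists (u_ N); split=> //; apply: uN => /=.
have /choice[v_ v_P] : forall n : nat, exists v, [/\ Lipb K v,
    forall x, `|v x| <= M & forall x, `|x| <= n%:R -> `|u x - v x| <= n.+1%:R^-1].
  by move=> n; apply: uM.
exists v_; split; first by move=> n; case: (v_P n).
apply/seq_convP; split; first by exists M => n; case: (v_P n).
move=> r e e0; near=> n => x xr.
have [_ _ vn] := v_P n; apply: le_trans (vn x _) _.
  apply: le_trans xr _; near: n; exact: nbhs_infty_ger.
rewrite ltW//; near: n; exact: near_infty_natSinv_lt (PosNum e0).
Unshelve. all: by end_near. Qed.

Lemma Cb_bounded u : Cb K u -> exists2 M, 0 <= M & forall x, `|u x| <= M.
Proof.
move=> /CbP[M uM]; exists M => [|x].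
  by have [v [_ vM _]] := uM 0 1 ltr01; apply: le_trans (normr_ge0 _) (vM 0).
apply/ler_addgt0Pr => e e0.
have [v [_ vM uv]] := uM `|x| e e0.
rewrite -(subrK (v x) (u x)) addrC (le_trans (ler_normD _ _))// lerD//.
exact: uv.
Qed.

Lemma Lipb_comp (f : R -> R) u (M L : R) : 0 <= L ->
  (forall a b, `|f a - f b| <= L * `|a - b|) -> (forall x, `|f (u x)| <= M) ->
  Lipb K u -> Lipb K (f \o u).
Proof.
move=> L0 fL fM /LipbP[L' [M' [[L'0 uL] uM]]]; apply/LipbP.
exists (L * L'), M; split=> //; split=> [|x y]; first exact: mulr_ge0.
by apply: le_trans (fL _ _) _; rewrite -mulrA ler_wpM2l.
Qed.

Definition clip M (a : R) := Num.max (- M) (Num.min M a).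

Lemma clip_Lip M a b : `|clip M a - clip M b| <= 1 * `|a - b|.
Proof.
rewrite mul1r /clip /Num.max /Num.min.
have := ler_norm (a - b); have := ler_norm (b - a); rewrite (distrC b a) => ? ?.
by rewrite ler_norml; do ! case: ifP; move=> ? ? ? ?; apply/andP; split; lra.
Qed.

Lemma clip_bound M a : 0 <= M -> `|clip M a| <= M.
Proof.
move=> M0; rewrite /clip /Num.max /Num.min.
by rewrite ler_norml; do ! case: ifP; move=> ? ?; apply/andP; split; lra.
Qed.

Lemma clip_id M a : `|a| <= M -> clip M a = a.
Proof.
rewrite ler_norml => /andP[aM Ma]; rewrite /clip /Num.max /Num.min.
by do ! case: ifP; move=> ? ?; lra.
Qed.

(** [Cb] is closed under bounded, locally uniform approximation; clipping keeps
    a common bound on the approximating functions. *)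
Lemma Cb_approx u M : (forall r e, 0 < e -> exists v, [/\ Cb K v,
    forall x, `|v x| <= M & forall x, `|x| <= r -> `|u x - v x| <= e]) ->
  Cb K u.
Proof.
move=> uM; apply/CbP; exists M => r e e0.
have e20 : 0 < e / 2 by rewrite divr_gt0.
have [v [/CbP[M' vM'] vM uv]] := uM r _ e20.
have [w [wL wM vw]] := vM' r _ e20.
have M0 : 0 <= M := le_trans (normr_ge0 _) (vM 0).
exists (clip M \o w); split.
- apply: Lipb_comp wL => //; last by move=> x; exact: clip_bound.
  exact: clip_Lip.
- by move=> x; exact: clip_bound.
- move=> x xr; rewrite -(subrK (v x) (u x)) -addrA (le_trans (ler_normD _ _))//.
  rewrite [leRHS](splitr e) lerD// ?uv//= -{1}(@clip_id M (v x))//.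
  by apply: le_trans (clip_Lip _ _ _) _; rewrite mul1r vw.
Qed.

Lemma Cb_comp (f : R -> R) u L : 0 <= L ->
  (forall a b, `|f a - f b| <= L * `|a - b|) -> Cb K u -> Cb K (f \o u).
Proof.
move=> L0 fL /CbP[M uM]; apply/CbP; exists (`|f 0| + L * M) => r e e0.
have fle a : `|f a| <= `|f 0| + L * `|a|.
  rewrite -(subrK (f 0) (f a)) addrC (le_trans (ler_normD _ _))// lerD2l.
  by rewrite (le_trans (fL _ _)) ?subr0.
have L10 : 0 < L + 1 by rewrite ltr_wpDl.
have [v [vL vM uv]] := uM r (e / (L + 1)) (divr_gt0 e0 L10).
have fvM x : `|f (v x)| <= `|f 0| + L * M.
  by apply: le_trans (fle _) _; rewrite lerD2l ler_wpM2l.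
exists (f \o v); split=> //; first exact: (Lipb_comp L0 fL fvM).
move=> x xr; apply: le_trans (fL _ _) _.
apply: (@le_trans _ _ (L * (e / (L + 1)))); first by rewrite ler_wpM2l// uv.
rewrite mulrCA ger_pMr// ler_pdivrMr// mul1r; lra.
Qed.

Lemma Cb_lin (a b : R) u v : Cb K u -> Cb K v ->
  Cb K (fun x => a * u x + b * v x).
Proof.
move=> /CbP[M uM] /CbP[N vN]; apply/CbP.
exists (`|a| * M + `|b| * N) => r e e0.
pose d := e / (`|a| + `|b| + 1).
have ab0 : 0 < `|a| + `|b| + 1 by rewrite ltr_wpDl// addr_ge0.
have d0 : 0 < d by rewrite divr_gt0.
have [u' [/LipbP[L [? [[L0 uL] _]]] uM' uu]] := uM r d d0.
have [v' [/LipbP[L' [? [[L'0 vL] _]]] vM' vv]] := vN r d d0.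
have bd x : `|a * u' x + b * v' x| <= `|a| * M + `|b| * N.
  by rewrite (le_trans (ler_normD _ _))// !normrM lerD// ler_wpM2l.
exists (fun x => a * u' x + b * v' x); split=> //.
  apply/LipbP; exists (`|a| * L + `|b| * L'), (`|a| * M + `|b| * N).
  split=> //; split=> [|x y]; first by rewrite addr_ge0// mulr_ge0.
  rewrite opprD addrACA -!mulrBr (le_trans (ler_normD _ _))// !normrM mulrDl.
  by rewrite -!mulrA lerD// ler_wpM2l.
move=> x xr; rewrite opprD addrACA -!mulrBr (le_trans (ler_normD _ _))// !normrM.
apply: (@le_trans _ _ (`|a| * d + `|b| * d)).
  by rewrite lerD// ler_wpM2l// ?uu ?vv.
rewrite -mulrDl /d mulrCA ger_pMr// ler_pdivrMr// mul1r; lra.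
Qed.

Lemma CbD u v : Cb K u -> Cb K v -> Cb K (fun x => u x + v x).
Proof.
move=> uC vC; rewrite (_ : (fun=> _) = fun x => 1 * u x + 1 * v x).
  exact: Cb_lin.
by apply/funext => x; rewrite !mul1r.
Qed.

Lemma CbB u v : Cb K u -> Cb K v -> Cb K (fun x => u x - v x).
Proof.
move=> uC vC; rewrite (_ : (fun=> _) = fun x => 1 * u x + (-1) * v x).
  exact: Cb_lin.
by apply/funext => x; rewrite mul1r mulN1r.
Qed.

Lemma CbDr a u : Cb K u -> Cb K (fun x => a + u x).
Proof. by move=> uC; apply: CbD => //; exact: Cb_cst. Qed.

Context (K1 : forall x : X, `|K x| <= `|x|).

Lemma Cb_unif u r e : Cb K u -> 0 < e -> exists2 d, 0 < d &
  forall x y, `|x| <= r -> `|y| <= r -> `|x - y| <= d -> `|u x - u y| <= e.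
Proof.
move=> /CbP[M uM] e0; have e30 : 0 < e / 3 by rewrite divr_gt0.
have [v [/LipbP[L [_ [vL _]]] _ uv]] := uM r _ e30.
have L0 : 0 <= L by case: vL.
have L10 : 0 < L + 1 by rewrite ltr_wpDl.
exists (e / 3 / (L + 1)); first by rewrite divr_gt0.
move=> x y xr yr xy; rewrite (_ : u x - u y =
  (u x - v x) + (v x - v y) - (u y - v y)); last by ring.
rewrite (le_trans (ler_normB _ _))// (_ : e = e / 3 + e / 3 + e / 3); last by field.
rewrite lerD ?uv// (le_trans (ler_normD _ _))// lerD ?uv//.
apply: le_trans (is_Lip_bound_norm K1 vL x y) _.
apply: (@le_trans _ _ (L * (e / 3 / (L + 1)))); first by rewrite ler_wpM2l.
rewrite mulrCA ger_pMr// ler_pdivrMr// mul1r; lra.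
Qed.

Lemma Cb_continuous u : Cb K u -> continuous u.
Proof.
move=> uC x; apply/cvgrPdist_le => e e0.
have [d d0 ud] := Cb_unif (`|x| + 1) uC e0.
near=> y.
have xy : `|x - y| <= d by near: y; apply: cvgr_dist_le => //; exact: cvg_id.
have xy1 : `|x - y| <= 1 by near: y; apply: cvgr_dist_le => //; exact: cvg_id.
apply: ud => //; first by rewrite lerDl.
rewrite -(subKr x y) (le_trans (ler_normB _ _))// lerD2l.
by rewrite (_ : x - y = x - y).
Unshelve. all: by end_near. Qed.

End FunctionSpaces.


(** * Integration with respect to probability measures *)

Section Probability.
Context d (T : measurableType d) (R : realType) (P : probability T R).

Lemma bounded_integrable (f : T -> R) M : measurable_fun setT f ->
  (forall x, `|f x| <= M) -> P.-integrable setT (EFin \o f).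
Proof.
move=> mf fM; apply: measurable_bounded_integrable => //.
  exact: le_lt_trans (probability_le1 _ _) (ltry _).
by exists M; split=> [|N MN x _]; [exact: num_real|apply: le_trans (fM x) (ltW MN)].
Qed.

Lemma ge0_integrable (f : T -> R) : measurable_fun setT f ->
  (forall x, 0 <= f x) -> (\int[P]_x (f x)%:E < +oo)%E ->
  P.-integrable setT (EFin \o f).
Proof.
move=> mf f0 foo; apply/integrableP; split; first exact/measurable_EFinP.
rewrite (eq_integral (fun x => (f x)%:E))// => x _.
by rewrite /= ger0_norm.
Qed.

Lemma expect_cst (r : R) : \int[P]_x r = r.
Proof. by rewrite Rintegral_cst//= probability_setT mulr1. Qed.

Lemma expect_lin (a b : R) (f g : T -> R) :
  P.-integrable setT (EFin \o f) -> P.-integrable setT (EFin \o g) ->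
  \int[P]_x (a * f x + b * g x) = a * (\int[P]_x f x) + b * (\int[P]_x g x).
Proof.
move=> fi gi.
have Zi (r : R) h : P.-integrable setT (EFin \o h) ->
    P.-integrable setT (EFin \o (fun x => r * h x)).
  move=> hi; rewrite (_ : EFin \o _ = (fun x => r%:E * (EFin \o h) x)%E)//.
    exact: (integrableZl measurableT r hi).
by rewrite RintegralD ?RintegralZl//; exact: Zi.
Qed.

Lemma expect_integrable_lin (a b : R) (f g : T -> R) :
  P.-integrable setT (EFin \o f) -> P.-integrable setT (EFin \o g) ->
  P.-integrable setT (EFin \o (fun x => a * f x + b * g x)).
Proof.
move=> fi gi; rewrite (_ : EFin \o _ =
  (fun x => a%:E * (EFin \o f) x) \+ (fun x => b%:E * (EFin \o g) x))%E//.
exact: (integrableD measurableT (integrableZl measurableT a fi)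
  (integrableZl measurableT b gi)).
Qed.

Lemma pushforward_probability d' (T' : measurableType d') (f : T -> T') :
  measurable_fun setT f -> exists Q : probability T' R,
    forall A, Q A = P (f @^-1` A).
Proof.
move=> mf.
pose m := isMeasurableFun.Build _ _ _ _ _ mf.
pose f' : {mfun T >-> T'} := HB.pack f m.
by exists (distribution P f').
Qed.

End Probability.

Section Transfer.
Context d (T : measurableType d) (R : realType) (P : probability T R).
Context d' (T' : measurableType d') (Q : probability T' R) (f : T -> T').
Context (mf : measurable_fun setT f).
Context (fPQ : forall A, measurable A -> P (f @^-1` A) = Q A).

Lemma expect_transfer (g : T' -> R) M : measurable_fun setT g ->
  (forall x, `|g x| <= M) -> \int[Q]_y g y = \int[P]_x g (f x).
Proof.
move=> mg gM; rewrite /Rintegral; congr fine.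
rewrite (eq_measure_integral (pushforward P f)) => [|A mA _]; last by rewrite /= -(fPQ mA).
rewrite integral_pushforward//; first exact/measurable_EFinP.
rewrite preimage_setT.
exact: (@bounded_integrable _ _ _ P (g \o f) M (measurableT_comp mg mf)
  (fun x => gM (f x))).
Qed.

Lemma ge0_transfer (g : T' -> R) : measurable_fun setT g ->
  (forall x, 0 <= g x) -> (\int[Q]_y (g y)%:E = \int[P]_x (g (f x))%:E)%E.
Proof.
move=> mg g0.
rewrite (eq_measure_integral (pushforward P f)) => [|A mA _]; last by rewrite /= -(fPQ mA).
rewrite ge0_integral_pushforward//; first exact/measurable_EFinP.
by move=> y _; rewrite lee_fin.
Qed.

End Transfer.

Section Mixture.
Context d (T : measurableType d) (R : realType) (P Q : probability T R).

(** Mixtures make the set of pairs (cost, gain) in the duality argument convex,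
    also when the reference measure has atoms. *)
Lemma mixture (a : R) : 0 <= a <= 1 ->
  exists M : probability T R,
  [/\ forall A, measurable A -> M A = (a%:E * P A + (1 - a)%:E * Q A)%E,
  forall f : T -> \bar R, measurable_fun setT f -> (forall x, (0 <= f x)%E) ->
    (\int[M]_x f x = a%:E * \int[P]_x f x + (1 - a)%:E * \int[Q]_x f x)%E &
  forall (f : T -> R) N, measurable_fun setT f -> (forall x, `|f x| <= N) ->
    \int[M]_x f x = a * \int[P]_x f x + (1 - a) * \int[Q]_x f x].
Proof.
move=> /andP[a0 a1]; have b0 : 0 <= 1 - a by rewrite subr_ge0.
pose m : {measure set T -> \bar R} :=
  measure_add (mscale (NngNum a0) P) (mscale (NngNum b0) Q).
have mE A : m A = (a%:E * P A + (1 - a)%:E * Q A)%E.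
  exact: measure_addE.
have mT : m setT = 1%E.
  by rewrite mE !probability_setT !mule1 -EFinD addrC subrK.
pose M : probability T R := HB.pack (Measure.sort m)
  (Measure_isProbability.Build _ _ _ m mT).
have ME (f : T -> \bar R) : measurable_fun setT f -> (forall x, (0 <= f x)%E) ->
    (\int[M]_x f x = a%:E * \int[P]_x f x + (1 - a)%:E * \int[Q]_x f x)%E.
  move=> mf f0; rewrite (eq_measure_integral m)//.
  by rewrite ge0_integral_measure_add// !ge0_integral_mscale.
exists M; split=> [A _|//|f N mf fN]; first exact: mE.
have mfN : measurable_fun setT (fun x => f x + N) by exact: measurable_funD.
have fN0 x : 0 <= f x + N.
  by have := fN x; rewrite ler_norml => /andP[+ _]; rewrite -subr_ge0 opprK addrC.
have fN2 x : `|f x + N| <= N + N.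
  by rewrite (le_trans (ler_normD _ _))// lerD// ger0_norm// (le_trans _ (fN x)).
have shift (Q' : probability T R) : \int[Q']_x f x = \int[Q']_x (f x + N) - N.
  rewrite RintegralD ?expect_cst ?addrK//.
  - exact: bounded_integrable fN.
  - by apply: (@bounded_integrable _ _ _ _ (cst N) `|N|) => // x.
have fi (Q' : probability T R) : (\int[Q']_x (f x + N)%:E)%E \is a fin_num.
  by apply: integrable_fin_num => //; exact: bounded_integrable fN2.
rewrite !shift {1}/Rintegral ME//; last exact/measurable_EFinP.
rewrite fineD ?fin_numM// !fineM//= -/(Rintegral _ _ _) -/(Rintegral _ _ _).
by ring.
Qed.

End Mixture.

Section Separable.
Context {R : realType} {X : normedModType R}.

Lemma dense_sequence : separable X ->
  exists z : nat -> X, forall x (e : R), 0 < e -> exists n, `|x - z n| < e.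
Proof.
move=> [D /countable_injP[f fD] dD].
exists (fun n => xget 0 [set x | D x /\ f x = n]) => x e e0.
have [y [/= xy Dy]] := dD (ball x e) (ex_intro _ x (ballxx x e0)) (ball_open x e).
exists (f y); case: xgetP => [y' _ [Dy' fy]|/(_ y)]; last by case; split.
have -> : y' = y by apply: fD; rewrite ?inE.
by move: xy; rewrite -ball_normE.
Qed.

Lemma continuous_measurable (f : X -> R) : continuous f ->
  measurable_fun setT (f : borel X -> R).
Proof.
move=> fc; apply: (measurability _ (RGenOInfty.measurableE R)) => //.
move=> _ [_ [x ->] <-]; rewrite setTI; apply: sub_sigma_algebra.
by apply: open_comp => //= y _; exact: fc.
Qed.

Lemma continuous_measurable_endo (f : X -> X) : continuous f ->
  measurable_fun setT (f : borel X -> borel X).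
Proof.
move=> fc; apply: (@measurability _ _ (borel X) (borel X) setT f (@open X)) => //.
move=> _ [A oA <-]; rewrite setTI; apply: sub_sigma_algebra.
by apply: open_comp => //= y _; exact: fc.
Qed.

Lemma measurable_norm : measurable_fun setT (fun x : borel X => `|x : X|).
Proof. by apply: (@continuous_measurable (fun x => `|x|)) => x; exact: norm_continuous. Qed.

Lemma measurable_normX p : measurable_fun setT (fun x : borel X => `|x : X| `^ p).
Proof.
apply: (measurableT_comp (measurable_powR _)); exact: measurable_norm.
Qed.

(** Separability is what makes the distance measurable for the product of the
    Borel sigma-algebras. *)
Lemma measurable_dist : separable X ->
  measurable_fun setT (fun z : (borel X * borel X)%type => `|(z.1 : X) - (z.2 : X)|).
Proof.
move=> /dense_sequence[q qP].
pose h (n : nat) (z : (borel X * borel X)%type) : R :=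
  `|(z.1 : X) - q n| + `|(z.2 : X) - q n|.
have hl (z : (borel X * borel X)%type) : lbound (range (h ^~ z)) `|(z.1 : X) - (z.2 : X)|.
  by move=> _ [n _ <-]; rewrite /h (distrC (z.2 : X)); exact: ler_distD.
rewrite (_ : (fun z : (borel X * borel X)%type => _) = fun z => infs (h ^~ z) 0%N); last first.
  apply/funext => z; apply/eqP; rewrite eq_le; apply/andP; split.
    apply: lb_le_inf; first by exists (h 0%N z); exists 0%N.
    by move=> _ [n _ <-]; apply: hl; exists n.
  apply/ler_addgt0Pr => e e0.
  have [n zn] := qP z.1 (e / 2) (divr_gt0 e0 (ltr0Sn _ 1)).
  apply: (@le_trans _ _ (h n z)).
    by apply: ge_inf; [exists `|(z.1 : X) - (z.2 : X)| => _ [m _ <-]; apply: hl; exists m|exists n].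
  have := ler_distD (z.1 : X) (z.2 : X) (q n); rewrite (distrC (z.2 : X) z.1) /h.
  by move: zn; lra.
apply: measurable_fun_infs => [z _|n].
  by exists `|(z.1 : X) - (z.2 : X)|; exact: hl.
apply: measurable_funD.
- apply: (@measurableT_comp _ _ _ _ _ _ (fun x : borel X => `|(x : X) - q n|)) => //.
  apply: (@continuous_measurable (fun x => `|x - q n|)) => x.
  by apply: cvg_norm; apply: cvgB => //; exact: cvg_cst.
- apply: (@measurableT_comp _ _ _ _ _ _ (fun x : borel X => `|(x : X) - q n|)) => //.
  apply: (@continuous_measurable (fun x => `|x - q n|)) => x.
  by apply: cvg_norm; apply: cvgB => //; exact: cvg_cst.
Qed.

End Separable.


(** * The reference model *)

Lemma near0_rightP {R : realType} (Q : R -> Prop) :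
  (\forall h \near 0^'+, Q h) <->
  exists2 h0, 0 < h0 & forall h, 0 < h -> h <= h0 -> Q h.
Proof.
split=> [[e /= e0 Qe]|[h0 h00 Qh]].
  exists (e / 2) => [|h hh0 he]; first by rewrite divr_gt0.
  apply: Qe => //=; rewrite sub0r normrN gtr0_norm//.
  by rewrite (le_lt_trans he)// ltr_pdivrMr// ltr_pMr// ltr1n.
near=> h; apply: Qh; near: h; first exact: nbhs_right_gt.
exact: nbhs_right_le.
Unshelve. all: by end_near. Qed.

Lemma expR_small {R : realType} (c e : R) : 0 <= c -> 0 < e ->
  exists2 h0, 0 < h0 & forall h, h <= h0 -> expR (c * h) <= 1 + e.
Proof.
move=> c0 e0; have c10 : 0 < c + 1 by rewrite ltr_wpDl.
have le0 : 0 < ln (1 + e) by rewrite ln_gt0// ltrDl.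
exists (ln (1 + e) / (c + 1)) => [|h hh]; first by rewrite divr_gt0.
rewrite -[leRHS]lnK ?posrE ?addr_gt0// ler_expR.
apply: (@le_trans _ _ (c * (ln (1 + e) / (c + 1)))); first by rewrite ler_wpM2l.
by rewrite mulrCA ger_pMr// ler_pdivrMr// mul1r lerDl.
Qed.

Record model {R : realType} {X : normedModType R} (K : {linear X -> X})
    (p c : R) (mu : R -> probability (borel X) R) (psi : R -> X -> X)
    (phi : R -> \bar R) : Prop := Model {
  model_separable : separable X;
  model_compact : forall r : R, 0 <= r -> compact (K @` nball r);
  model_contr : forall x : X, `|K x| <= `|x|;
  model_p_gt1 : 1 < p;
  model_Pp : forall t, 0 <= t -> Pp p (mu t);
  model_ck : forall (s t : R) (u : X -> R) (x : X),
    0 <= s -> 0 <= t -> Cb K u ->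
    \int[mu (t + s)]_y u (psi (t + s) x + (y : X)) =
    \int[mu t]_yt (\int[mu s]_ys u (psi s (psi t x + (yt : X)) + (ys : X)));
  model_c_ge0 : 0 <= c;
  model_psi_lip : forall (t : R) (x1 x2 : X), 0 <= t ->
    `|psi t x1 - psi t x2| <= expR (c * t) * `|x1 - x2|;
  model_K_psi : forall (t : R) (x : X), 0 <= t -> K (psi t x) = psi t (K x);
  model_psi_cvg : forall r : R, 0 <= r ->
    ereal_sup [set (`|psi h (K x) - K x|)%:E | x in nball r]
      @[h --> 0^'+] --> (0 : \bar R);
  model_mu_cvg : (\int[mu h]_y ((`|y : X| `^ p)%R%:E))%E
      @[h --> 0^'+] --> (0 : \bar R);
  model_phi : penalisation p phi
}.

(** * Tight families of operators *)

Section Tightness.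
Context {R : realType} {X : normedModType R} (K : {linear X -> X}).
Implicit Types (u v w : X -> R) (G : set ((X -> R) -> X -> R)).

(** Equicontinuity of a family of operators for the convergence of bounded
    sequences uniformly on balls. The one-sided form with the additive [d]
    suits monotone operators and is stable under composition. *)
Definition tight G := forall M r e : R, 0 < e -> exists rho : R, forall P v w d,
  G P -> Cb K v -> Cb K w -> 0 <= d -> (forall x, `|v x| <= M) ->
  (forall x, `|w x| <= M) -> (forall x, `|x| <= rho -> v x <= w x + d) ->
  forall x, `|x| <= r -> P v x <= P w x + d + e.

Lemma tight_sub G G' : G `<=` G' -> tight G' -> tight G.
Proof.
move=> GG' tG M r e e0; have [rho rhoP] := tG M r e e0.
by exists rho => P v w d /GG'; exact: rhoP.
Qed.

Lemma tight_setU G G' : tight G -> tight G' -> tight (G `|` G').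
Proof.
move=> tG tG' M r e e0; have [rho rhoP] := tG M r e e0.
have [rho' rho'P] := tG' M r e e0.
exists (Num.max rho rho') => P v w d [GP|GP] vC wC d0 vM wM vw.
- by apply: (rhoP P v w d) => // y yr; apply: vw; rewrite le_max yr.
- by apply: (rho'P P v w d) => // y yr; apply: vw; rewrite le_max yr orbT.
Qed.

Lemma tight_dist G : tight G -> forall M r e, 0 < e -> exists rho,
  forall P v w d, G P -> Cb K v -> Cb K w -> 0 <= d -> (forall x, `|v x| <= M) ->
  (forall x, `|w x| <= M) -> (forall x, `|x| <= rho -> `|v x - w x| <= d) ->
  forall x, `|x| <= r -> `|P v x - P w x| <= d + e.
Proof.
move=> tG M r e e0; have [rho rhoP] := tG M r e e0.
exists rho => P v w d GP vC wC d0 vM wM vw x xr.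
have vw1 y : `|y| <= rho -> v y <= w y + d.
  by move=> /vw; rewrite ler_norml => /andP[_]; rewrite lerBlDl addrC.
have vw2 y : `|y| <= rho -> w y <= v y + d.
  by move=> /vw; rewrite ler_norml => /andP[+ _]; rewrite lerNl opprB lerBlDl addrC.
have := rhoP P v w d GP vC wC d0 vM wM vw1 x xr.
have := rhoP P w v d GP wC vC d0 wM vM vw2 x xr.
by rewrite ler_norml => ? ?; apply/andP; split; lra.
Qed.

Definition stable (P : (X -> R) -> X -> R) :=
  (forall u, Cb K u -> Cb K (P u)) /\
  (forall u M, Cb K u -> (forall x, `|u x| <= M) -> forall x, `|P u x| <= M).

(** The inner family is controlled on the ball that controls the outer one. *)
Lemma tight_comp G G' : tight G -> tight G' -> (forall P, G' P -> stable P) ->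
  tight [set P | exists P1 P2, [/\ G P1, G' P2 & P = P1 \o P2]].
Proof.
move=> tG tG' sG' M r e e0; have e20 : 0 < e / 2 by rewrite divr_gt0.
have [rho1 r1P] := tG M r _ e20; have [rho2 r2P] := tG' M rho1 _ e20.
exists rho2 => _ v w d [P1 [P2 [GP1 GP2 ->]]] vC wC d0 vM wM vw x xr.
have [P2C P2b] := sG' _ GP2.
have e2d : 0 <= d + e / 2 by rewrite addr_ge0// ltW.
have vw2 y : `|y| <= rho1 -> P2 v y <= P2 w y + (d + e / 2).
  by move=> yr; rewrite addrA; exact: (r2P P2 v w d).
have := r1P P1 _ _ _ GP1 (P2C _ vC) (P2C _ wC) e2d (P2b _ _ vC vM) (P2b _ _ wC wM)
  vw2 x xr.
by rewrite /=; lra.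
Qed.

(** Tightness carries the approximation of [u] by Lipschitz functions on a large
    ball over to [P u], and [Cb] is closed under such approximation. *)
Lemma tight_Cb (P : (X -> R) -> X -> R) : tight [set P] ->
  (forall u, Lipb K u -> Cb K (P u)) ->
  (forall u M, Cb K u -> (forall x, `|u x| <= M) -> forall x, `|P u x| <= M) ->
  forall u, Cb K u -> Cb K (P u).
Proof.
move=> tP PL Pb u uC; have /CbP[M uM] := uC.
have [M' M'0 uM'] := Cb_bounded uC.
apply: (@Cb_approx _ _ _ _ M) => r e e0.
have e20 : 0 < e / 2 by rewrite divr_gt0.
have [rho rhoP] := tight_dist tP (Num.max M M') r e20.
have [v [vL vM uv]] := uM rho _ e20.
exists (P v); split; [exact: PL|by apply: Pb => //; exact: Lipb_Cb|].
move=> x xr; rewrite [leRHS]splitr; apply: (rhoP P u v _) => //.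
- exact: Lipb_Cb.
- exact: ltW.
- by move=> y; rewrite le_max uM' orbT.
- by move=> y; rewrite le_max vM.
Qed.

End Tightness.

(** * The reference semigroup *)

Section Reference.
Context {R : realType} {X : normedModType R} {K : {linear X -> X}} {p c : R}
  {mu : R -> probability (borel X) R} {psi : R -> X -> X} {phi : R -> \bar R}.
Context (H : model K p c mu psi phi).
Implicit Types (u v w : X -> R) (t s r e M L : R) (x y : X).

Local Notation T := (ref_op mu psi).
Local Notation K1 := (model_contr H).

Let p0 : 0 < p. Proof. exact: lt_trans ltr01 (model_p_gt1 H). Qed.

Definition moment t := \int[mu t]_y (`|y : X| `^ p).

Lemma Pp_integrable (nu : probability (borel X) R) : Pp p nu ->
  nu.-integrable setT (EFin \o (fun y : borel X => `|y : X| `^ p)).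
Proof.
move=> nuP; apply: ge0_integrable => //; exact: measurable_normX.
Qed.

Lemma moment_integrable t : 0 <= t ->
  (mu t).-integrable setT (EFin \o (fun y : borel X => `|y : X| `^ p)).
Proof. by move=> t0; apply/Pp_integrable/(model_Pp H). Qed.

Lemma moment_small e : 0 < e ->
  exists2 h0, 0 < h0 & forall h, 0 < h -> h <= h0 -> moment h <= e.
Proof.
move=> e0; apply/near0_rightP.
have /cvge0_leP := model_mu_cvg H.
have ge0 t : (0 <= \int[mu t]_y (`|y : X| `^ p)%:E)%E.
  by apply: integral_ge0 => y _; rewrite lee_fin powR_ge0.
move=> /(_ ge0 _ e0) me; near=> h.
have h0 : 0 <= h by near: h; apply: nbhs_right_ge.
rewrite -lee_fin /moment /Rintegral fineK; first by near: h; exact: me.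
by have := integrable_fin_num measurableT (moment_integrable h0).
Unshelve. all: by end_near. Qed.

Lemma measurable_shift u (a : X) : Cb K u ->
  measurable_fun setT (fun y : borel X => u (a + (y : X))).
Proof.
move=> uC; apply: (@continuous_measurable _ _ (fun y => u (a + y))) => y.
apply: continuous_comp; last exact: (Cb_continuous K1 uC).
by apply: cvgD; [exact: cvg_cst|exact: cvg_id].
Qed.

Lemma shift_integrable (nu : probability (borel X) R) u (a : X) : Cb K u ->
  nu.-integrable setT (EFin \o (fun y : borel X => u (a + (y : X)))).
Proof.
move=> uC; have [M _ uM] := Cb_bounded uC.
apply: (@bounded_integrable _ _ _ _ _ M); first exact: measurable_shift.
by move=> y; exact: uM.
Qed.

(** Monotonicity, Lipschitz bounds, tightness and continuity at time zero are all
    instances: the two functions are compared up to an error that the [p]-th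
    moment controls. *)
Lemma ref_perturb v w (a k : R) t x x' : 0 <= t -> Cb K v -> Cb K w ->
  (forall y, v (psi t x + y) <= w (psi t x' + y) + (a + k * `|y| `^ p)) ->
  T t v x <= T t w x' + (a + k * moment t).
Proof.
move=> t0 vC wC vw.
have ai : (mu t).-integrable setT (EFin \o cst a).
  by apply: (@bounded_integrable _ _ _ _ _ `|a|) => //; exact: measurable_cst.
have mi := moment_integrable t0.
have aki : (mu t).-integrable setT
    (EFin \o (fun y : borel X => a + k * `|y : X| `^ p)).
  rewrite (_ : (fun y : borel X => _) = fun y => 1 * cst a y + k * `|y : X| `^ p).
    exact: expect_integrable_lin.
  by apply/funext => y; rewrite mul1r.
rewrite /ref_op /moment -[X in X + k * _](expect_cst (mu t)).
rewrite -RintegralZl// -RintegralD//; last first.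
  by have := expect_integrable_lin 0 k ai mi; apply: eq_integrable => // y _ /=;
    rewrite mul0r add0r.
rewrite -RintegralD//; last exact: shift_integrable.
apply: le_Rintegral => //; first exact: shift_integrable.
rewrite (_ : EFin \o _ = EFin \o (fun y : borel X =>
   1 * w (psi t x' + (y : X)) + 1 * (a + k * `|y : X| `^ p))).
  by apply: expect_integrable_lin => //; exact: shift_integrable.
by apply/funext => y /=; rewrite !mul1r.
Qed.

Lemma ref_cst t (m : R) x : T t (cst m) x = m.
Proof. exact: expect_cst. Qed.

Lemma ref_le t v w x : 0 <= t -> Cb K v -> Cb K w ->
  (forall y, v y <= w y) -> T t v x <= T t w x.
Proof.
move=> t0 vC wC vw; rewrite -[leRHS]addr0 -[X in _ + X](_ : 0 + 0 * moment t = 0).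
  by apply: ref_perturb => // y; rewrite mul0r !addr0.
by rewrite mul0r addr0.
Qed.

Lemma ref_lin t (a b : R) v w x : Cb K v -> Cb K w ->
  T t (fun y => a * v y + b * w y) x = a * T t v x + b * T t w x.
Proof. by move=> vC wC; rewrite /ref_op expect_lin//; exact: shift_integrable. Qed.

Lemma refD t v w x : Cb K v -> Cb K w ->
  T t (fun y => v y + w y) x = T t v x + T t w x.
Proof.
move=> vC wC; have := ref_lin t 1 1 x vC wC; rewrite !mul1r => <-.
by congr ref_op; apply/funext => y; rewrite !mul1r.
Qed.

Lemma refZ t (a : R) v x : Cb K v -> T t (fun y => a * v y) x = a * T t v x.
Proof.
move=> vC; have := ref_lin t a 0 x vC vC; rewrite mul0r addr0 => <-.
by congr ref_op; apply/funext => y; rewrite mul0r addr0.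
Qed.

Lemma refDr t (a : R) v x : Cb K v -> T t (fun y => a + v y) x = a + T t v x.
Proof. by move=> vC; rewrite refD ?ref_cst//; exact: Cb_cst. Qed.

Lemma ref_bound t u M : 0 <= t -> Cb K u -> (forall x, `|u x| <= M) ->
  forall x, `|T t u x| <= M.
Proof.
move=> t0 uC uM x; rewrite ler_norml; apply/andP; split.
- rewrite -[leLHS](ref_cst t _ x); apply: ref_le => //; first exact: Cb_cst.
  by move=> y; have := uM y; rewrite ler_norml => /andP[].
- rewrite -[leRHS](ref_cst t _ x); apply: ref_le => //; first exact: Cb_cst.
  by move=> y; have := uM y; rewrite ler_norml => /andP[].
Qed.

Lemma psi_growth t x : 0 <= t -> `|psi t x| <= `|psi t 0| + expR (c * t) * `|x|.
Proof.
move=> t0; rewrite -[psi t x](subrK (psi t 0)) addrC (le_trans (ler_normD _ _))//.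
by rewrite lerD2l -{2}(subr0 x) (model_psi_lip H).
Qed.

Lemma psi_K_lip t x y : 0 <= t ->
  `|K (psi t x - psi t y)| <= expR (c * t) * `|K (x - y)|.
Proof.
by move=> t0; rewrite !linearB !(model_K_psi H)//; exact: (model_psi_lip H).
Qed.

Lemma ref_Lip t u L : 0 <= t -> Cb K u -> is_Lip_bound K u L ->
  is_Lip_bound K (T t u) (expR (c * t) * L).
Proof.
move=> t0 uC [L0 uL]; split; first by rewrite mulr_ge0// expR_ge0.
suff T1 x y : T t u x <= T t u y + expR (c * t) * L * `|K (x - y)|.
  move=> x y; rewrite ler_norml; have := T1 x y; have := T1 y x.
  rewrite -[y - x]opprB linearN normrN => ? ?; apply/andP; split; lra.
have := @ref_perturb u u (expR (c * t) * L * `|K (x - y)|) 0 t x y t0 uC uC.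
rewrite mul0r addr0; apply => z; rewrite mul0r addr0.
rewrite -lerBlDl (le_trans (ler_norm _))// (le_trans (uL _ _))//.
rewrite (mulrC (expR _)) -mulrA ler_wpM2l// (_ : _ - _ = psi t x - psi t y).
  exact: psi_K_lip.
by rewrite opprD addrACA subrr addr0.
Qed.

Lemma ref_semigroup t s u x : 0 <= t -> 0 <= s -> Cb K u ->
  T (t + s) u x = T t (T s u) x.
Proof. by move=> t0 s0 uC; rewrite /ref_op (model_ck H). Qed.

(** Markov's inequality: little mass leaves a large ball as long as the moment
    and the drift of the origin stay bounded. *)
Lemma ref_tight_bounded (B s : R) : tight K
  [set P | exists t, [/\ 0 <= t, t <= s, `|psi t 0| <= B, moment t <= B & P = T t]].
Proof.
move=> M r e e0; pose M0 := `|M|; pose B0 := `|B|.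
pose k := 2 * M0 * B0 / e + 1.
have M00 : 0 <= M0 := normr_ge0 _; have B00 : 0 <= B0 := normr_ge0 _.
have k1 : 1 <= k by rewrite lerDr divr_ge0 ?mulr_ge0// ltW.
have k0 : 0 < k := lt_le_trans ltr01 k1.
have kp : 0 < k `^ p by rewrite powR_gt0.
exists (B + expR (c * s) * `|r| + k).
move=> _ v w d [t [t0 ts tB mB ->]] vC wC d0 vM wM vw x xr.
have Mge : M <= M0 := ler_norm _.
have : T t v x <= T t w x + (d + (2 * M0 / k `^ p) * moment t).
  apply: ref_perturb => // y.
  have [yk|ky] := leP `|y| k.
    apply: (@le_trans _ _ (w (psi t x + y) + d)); last first.
      by rewrite lerD2l lerDl mulr_ge0 ?powR_ge0// divr_ge0 ?mulr_ge0// ltW.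
    apply: vw; rewrite (le_trans (ler_normD _ _))// lerD//.
    rewrite (le_trans (psi_growth _ _))// lerD//.
    rewrite ler_pM ?expR_ge0//; last exact: le_trans (ler_norm _).
    by rewrite ler_expR ler_wpM2l// (model_c_ge0 H).
  have : 2 * M0 <= 2 * M0 / k `^ p * `|y| `^ p.
    rewrite mulrAC -mulrA ler_peMr ?mulr_ge0// ler_pdivlMr// mul1r.
    by rewrite ge0_ler_powR ?ltW// nnegrE ltW// (lt_trans k0).
  have := vM (psi t x + y); have := wM (psi t x + y).
  rewrite !ler_norml => /andP[? ?] /andP[? ?]; lra.
move=> /le_trans; apply; rewrite -!addrA !lerD2l.
rewrite mulrAC ler_pdivrMr//.
apply: (@le_trans _ _ (2 * M0 * B0)).
  by rewrite ler_wpM2l ?mulr_ge0// (le_trans mB)// ler_norm.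
apply: (@le_trans _ _ (e * k)); last by rewrite ler_pM2l// le1r_powR// ltW// (model_p_gt1 H).
rewrite (_ : e * k = 2 * M0 * B0 + e) ?lerDl ?(ltW e0)//.
by rewrite /k; field; exact: lt0r_neq0.
Qed.

Lemma ref_stable t : 0 <= t -> stable K (T t).
Proof.
move=> t0; split=> [u uC|u M uC]; last exact: ref_bound.
apply: tight_Cb uC => [|{}u uL|{}u M uC].
- apply: tight_sub (@ref_tight_bounded (Num.max `|psi t 0| (moment t)) t).
  by move=> _ ->; exists t; rewrite !le_max !lexx orbT.
- have /LipbP[L [M [uLL uM]]] := uL; apply/Lipb_Cb/LipbP.
  exists (expR (c * t) * L), M; split; first exact: ref_Lip (Lipb_Cb uL) uLL.
  exact: ref_bound (Lipb_Cb uL) uM.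
- exact: ref_bound.
Qed.

Lemma ref_Cb t u : 0 <= t -> Cb K u -> Cb K (T t u).
Proof. by move=> t0; have [TC _] := ref_stable t0; exact: TC. Qed.

Lemma psi_small r e : 0 < e -> exists2 h0, 0 < h0 &
  forall h, 0 < h -> h <= h0 -> forall x, `|x| <= r -> `|psi h (K x) - K x| <= e.
Proof.
move=> e0; apply/near0_rightP.
have r0 : 0 <= Num.max r 0 by rewrite le_max lexx orbT.
have /cvge0_leP := model_psi_cvg H r0.
have ge0 h : (0 <= ereal_sup [set (`|psi h (K x) - K x|)%:E |
    x in nball (Num.max r 0%R)])%E.
  apply: (@le_trans _ _ (`|psi h (K 0) - K 0|)%:E); first by rewrite lee_fin.
  by apply: ereal_sup_ubound; exists 0 => //; exact: nball0.
move=> /(_ ge0 _ e0); apply: filterS => h he x xr; rewrite -lee_fin.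
apply: le_trans he; apply: ereal_sup_ubound; exists x => //.
by rewrite /nball /= le_max xr.
Qed.

Lemma psi0_small e : 0 < e -> exists2 h0, 0 < h0 &
  forall h, 0 < h -> h <= h0 -> `|psi h 0| <= e.
Proof.
move=> e0; have [h0 h00 hP] := psi_small 0 e0.
exists h0 => // h hp hh; have := hP h hp hh 0.
by rewrite normr0 lexx linear0 subr0; apply.
Qed.

Lemma ref_tight_small : exists2 h0, 0 < h0 &
  tight K [set P | exists t, [/\ 0 <= t, t <= h0 & P = T t]].
Proof.
have [h1 h10 h1P] := moment_small ltr01; have [h2 h20 h2P] := psi0_small ltr01.
exists (Num.min h1 h2); first by rewrite lt_min h10.
have t0 := @ref_tight_bounded (Num.max `|psi 0 0| (moment 0)) 0.
apply: tight_sub (tight_setU t0 (@ref_tight_bounded 1 (Num.min h1 h2))).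
move=> _ [t [t0' tt ->]]; move: (t0'); rewrite le_eqVlt => /predU1P[<-|tp].
  by left; exists 0; rewrite !le_max !lexx orbT.
right; exists t; split=> //; move: tt; rewrite le_min => /andP[? ?].
- exact: h2P.
- exact: h1P.
Qed.

(** Moments and drift are controlled near time zero only; the semigroup property
    and the stability of tightness under composition give longer times. *)
Lemma ref_tight s : tight K [set P | exists t, [/\ 0 <= t, t <= s & P = T t]].
Proof.
have [h h0 th] := ref_tight_small.
have tn n : tight K [set P | exists t, [/\ 0 <= t, t <= n.+1%:R * h & P = T t]].
  elim: n => [|n IH]; first by rewrite mul1r.
  (* on [Cb] only: composites agree there with the semigroup *)
  move=> M r e e0; have [rho rP] := tight_comp th IH
    (fun P '(ex_intro t (And3 t0 _ e)) => eq_ind_r (stable K) (ref_stable t0) e)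
    M r e0.
  exists rho => _ v w d [t [t0 tn ->]] vC wC d0 vM wM vw x xr.
  have [th1|ht] := leP t h.
    rewrite -(addr0 t) !ref_semigroup//.
    apply: (rP (T t \o T 0) v w d) => //; exists (T t), (T 0); split=> //.
    - by exists t.
    - by exists 0; rewrite mulr_ge0// ltW.
  rewrite -(subrK h t) addrC !ref_semigroup ?subr_ge0 ?(ltW ht) ?(ltW h0)//.
  apply: (rP (T h \o T (t - h)) v w d) => //; exists (T h), (T (t - h)); split=> //.
  - by exists h; rewrite lexx ltW.
  - exists (t - h); rewrite subr_ge0 ltW// lerBlDr.
    by split=> //; rewrite -[X in _ + X]mul1r -mulrDl natr1.
apply: tight_sub (tn (Num.truncn (s / h))).
move=> _ [t [t0 ts ->]]; exists t; split=> //; apply: le_trans ts _.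
by rewrite -ler_pdivrMr// ltW// truncnS_gt.
Qed.

(** A form of Young's inequality, to pass from small [p]-th moments to small
    first absolute moments. *)
Lemma le_moment e (a : R) : 0 < e -> 0 <= a -> a <= e + e `^ (1 - p) * a `^ p.
Proof.
move=> e0 a0; have [ae|ea] := leP a e.
  by apply: le_trans ae _; rewrite lerDl mulr_ge0 ?powR_ge0.
apply: (@le_trans _ _ (e `^ (1 - p) * a `^ p)); last by rewrite lerDr ltW.
rewrite -(mulr_powRB1 a0 p0) mulrCA ler_peMr// -opprB powRN mulrC.
rewrite ler_pdivlMr ?powR_gt0// mul1r; apply: ge0_ler_powR.
- by rewrite subr_ge0 (ltW (model_p_gt1 H)).
- by rewrite nnegrE ltW.
- by rewrite nnegrE.
- exact: ltW.
Qed.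

(** For [u] Lipschitz with respect to [K], the drift enters through
    [psi h (K x) - K x], which is small uniformly on balls, and the noise through
    its first absolute moment. *)
Lemma ref_near_id_Lip u r e : Lipb K u -> 0 < e -> exists2 h0, 0 < h0 &
  forall h, 0 < h -> h <= h0 -> forall x, `|x| <= r -> T h u x <= u x + e.
Proof.
move=> uL e0; have uC := Lipb_Cb uL.
have /LipbP[L [M [[L0 uLL] _]]] := uL.
have L10 : 0 < L + 1 by rewrite ltr_wpDl.
pose d := e / 3 / (L + 1); have d0 : 0 < d by rewrite !divr_gt0.
have Ld : L * d <= e / 3.
  by rewrite /d mulrCA ger_pMr ?divr_gt0// ler_pdivrMr// mul1r lerDl.
pose k := L * d `^ (1 - p); have k0 : 0 <= k by rewrite mulr_ge0// powR_ge0.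
have [h1 h10 h1P] := moment_small (divr_gt0 (divr_gt0 e0 (ltr0Sn _ 2)) (ltr_wpDl k0 ltr01)).
have [h2 h20 h2P] := psi_small r d0.
exists (Num.min h1 h2) => [|h hp]; first by rewrite lt_min h10.
rewrite le_min => /andP[hh1 hh2] x xr.
have : T h u x <= T h (cst (u x)) x + ((L * d + L * d) + k * moment h).
  apply: ref_perturb; [exact: ltW|by []|exact: Cb_cst|move=> y].
  have := le_trans (ler_norm _) (uLL (psi h x + y) x).
  rewrite lerBlDl => /le_trans; apply; rewrite /cst lerD2l.
  rewrite addrAC linearD; apply: (@le_trans _ _ (L * (d + `|y|))).
    rewrite ler_wpM2l// (le_trans (ler_normD _ _))// lerD//; last exact: K1.
    by rewrite linearB (model_K_psi H x (ltW hp)); exact: h2P.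
  rewrite mulrDr -addrA lerD2l -mulrA -mulrDr ler_wpM2l//.
  exact: le_moment.
move=> /le_trans; apply; rewrite ref_cst lerD2l.
have : k * moment h <= e / 3.
  apply: (@le_trans _ _ (k * (e / 3 / (k + 1)))); first by rewrite ler_wpM2l// h1P.
  by rewrite mulrCA ger_pMr ?divr_gt0// ler_pdivrMr ?ltr_wpDl// mul1r lerDl.
by move: Ld; lra.
Qed.

Lemma ref_near_id_pos u r e : Cb K u -> 0 < e -> exists2 h0, 0 < h0 &
  forall h, 0 < h -> h <= h0 -> forall x, `|x| <= r -> `|T h u x - u x| <= e.
Proof.
move=> uC e0; have e40 : 0 < e / 4 by rewrite divr_gt0.
have /CbP[M uM] := uC; have [M' M'0 uM'] := Cb_bounded uC.
have [rho rhoP] := tight_dist (@ref_tight 1) (Num.max M M') r e40.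
have [v [vL vM uv]] := uM (Num.max r rho) _ e40.
have nvL : Lipb K (fun x => - v x).
  apply: (@Lipb_comp _ _ _ -%R v M 1) vL => // [a b|x].
    by rewrite mul1r -opprD normrN.
  by rewrite normrN.
have [h1 h10 h1P] := ref_near_id_Lip r vL e40.
have [h2 h20 h2P] := ref_near_id_Lip r nvL e40.
exists (Num.min 1 (Num.min h1 h2)) => [|h hp]; first by rewrite !lt_min ltr01 h10.
rewrite !le_min => /and3P[hl1 hh1 hh2] x xr.
have vC := Lipb_Cb vL.
have := rhoP (T h) u v (e / 4) _ uC vC (ltW e40) _ _ _ x xr.
have := h1P h hp hh1 x xr; have := h2P h hp hh2 x xr.
have -> : T h (fun x => - v x) x = - T h v x.
  rewrite -mulN1r -refZ//; congr ref_op; apply/funext => y; exact/esym/mulN1r.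
have := uv x; rewrite le_max xr => /(_ isT).
rewrite !ler_norml => /andP[? ?] ? ? /(_ _ _ _ _)/andP[].
- by exists h; rewrite ltW.
- by move=> y; rewrite le_max uM' orbT.
- by move=> y; rewrite le_max vM.
- by move=> y yr; apply: uv; rewrite le_max yr orbT.
- by move=> ? ?; apply/andP; split; lra.
Qed.

(** The law at time zero is only controlled through the limit at zero: let
    [t] tend to zero in [T 0 (T t u) = T t u]. *)
Lemma ref0 u : Cb K u -> T 0 u = u.
Proof.
move=> uC; apply/funext => x; apply/eqP; rewrite -subr_eq0 -normr_eq0 eq_le.
rewrite normr_ge0 andbT; apply/ler_addgt0Pr => e e0; rewrite add0r.
have e40 : 0 < e / 4 by rewrite divr_gt0.
have [M M0 uM] := Cb_bounded uC.
have [rho rhoP] := tight_dist (@ref_tight 0) M `|x| e40.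
have [h h0 hP] := ref_near_id_pos (Num.max rho `|x|) uC e40.
have TC : Cb K (T h u) by apply: ref_Cb => //; exact: ltW.
have a : `|T 0 u x - T h u x| <= e / 4 + e / 4.
  rewrite -{1}(add0r h) (ref_semigroup x (lexx 0) (ltW h0) uC).
  apply: (rhoP (T 0) u (T h u) (e / 4)) => //.
  - by exists 0.
  - exact: ltW.
  - exact: ref_bound (ltW h0) uC uM.
  - by move=> y yr; rewrite distrC hP// le_max yr.
have b : `|T h u x - u x| <= e / 4 by apply: hP => //; rewrite le_max lexx orbT.
rewrite -(subrK (T h u x) (T 0 u x)) -addrA (le_trans (ler_normD _ _))//.
by move: a b; lra.
Qed.

Lemma ref_near_id u r e : Cb K u -> 0 < e -> exists2 h0, 0 < h0 &
  forall h, 0 <= h -> h <= h0 -> forall x, `|x| <= r -> `|T h u x - u x| <= e.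
Proof.
move=> uC e0; have [h0 h00 hP] := ref_near_id_pos r uC e0.
exists h0 => // h; rewrite le_eqVlt => /predU1P[<- _ x xr|]; last exact: hP.
by rewrite ref0// subrr normr0 ltW.
Qed.

End Reference.


(** * Sup-convolutions *)

(** One optimal displacement at price [l |z|^p]: this is the dual, under the
    integral sign, of a penalty on the Wasserstein distance of order [p]. *)
Definition sup_conv {R : realType} {X : normedModType R} (p l : R)
    (u : X -> R) (x : X) : R :=
  sup [set u (x + z) - l * `|z| `^ p | z in setT].

Section SupConv.
Context {R : realType} {X : normedModType R} {K : {linear X -> X}} {p : R}.
Context (p0 : 0 < p) (K1 : forall x : X, `|K x| <= `|x|).
Implicit Types (u v w : X -> R) (l M r e : R) (x z : X).

Local Notation Q := (sup_conv p).

Lemma sup_conv_le l u x B :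
  (forall z, u (x + z) - l * `|z| `^ p <= B) -> Q l u x <= B.
Proof.
move=> uB; apply: ge_sup; first by exists (u (x + 0) - l * `|0 : X| `^ p), 0.
by move=> _ [z _ <-].
Qed.

Lemma sup_conv_ub l u M x z : 0 <= l -> (forall x, `|u x| <= M) ->
  u (x + z) - l * `|z| `^ p <= Q l u x.
Proof.
move=> l0 uM; apply: ub_le_sup; last by exists z.
exists M => _ [y _ <-]; rewrite lerBlDr (le_trans (ler_norm _))//.
by rewrite (le_trans (uM _))// lerDl mulr_ge0// powR_ge0.
Qed.

Lemma sup_conv_ge l u M x : 0 <= l -> (forall x, `|u x| <= M) -> u x <= Q l u x.
Proof.
move=> l0 uM; have := sup_conv_ub x 0 l0 uM.
by rewrite addr0 normr0 powR0 ?gt_eqF// mulr0 subr0.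
Qed.

Lemma sup_conv_bound l u M : 0 <= l -> (forall x, `|u x| <= M) ->
  forall x, `|Q l u x| <= M.
Proof.
move=> l0 uM x; rewrite ler_norml; apply/andP; split.
  apply: le_trans (sup_conv_ge x l0 uM).
  by have := uM x; rewrite ler_norml => /andP[].
apply: sup_conv_le => z; rewrite lerBlDr (le_trans (ler_norm _))//.
by rewrite (le_trans (uM _))// lerDl mulr_ge0// powR_ge0.
Qed.

Lemma sup_conv_Lip l u L M : 0 <= l -> (forall x, `|u x| <= M) ->
  is_Lip_bound K u L -> is_Lip_bound K (Q l u) L.
Proof.
move=> l0 uM [L0 uL]; split=> //.
suff Q1 x y : Q l u x <= Q l u y + L * `|K (x - y)|.
  move=> x y; rewrite ler_norml; have := Q1 x y; have := Q1 y x.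
  rewrite -[y - x]opprB linearN normrN => ? ?; apply/andP; split; lra.
apply: sup_conv_le => z.
have := sup_conv_ub y z l0 uM; have := le_trans (ler_norm _) (uL (x + z) (y + z)).
rewrite (_ : x + z - (y + z) = x - y); first by lra.
by rewrite opprD addrACA subrr addr0.
Qed.

Lemma powR_large (B : R) : 0 <= B -> exists2 rho : R, 0 < rho &
  forall y, rho <= y -> B <= y `^ p.
Proof.
move=> B0; exists ((B + 1) `^ p^-1); first by rewrite powR_gt0// ltr_wpDl.
move=> y By; apply: (@le_trans _ _ (B + 1)); first by rewrite lerDl.
have B1 : 0 <= B + 1 by rewrite addr_ge0.
rewrite -[leLHS]powRr1// -[X in _ `^ X <= _](mulVf (lt0r_neq0 p0)) powRrM.
apply: ge0_ler_powR => //; rewrite ?ltW ?nnegrE//; first exact: powR_ge0.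
by apply: le_trans By; exact: powR_ge0.
Qed.

(** On bounded functions the price restricts the supremum to a ball of fixed
    radius. *)
Lemma sup_conv_tight l : 0 < l -> tight K [set Q l].
Proof.
move=> l0 M r e e0.
have [rho rho0 rhoP] := @powR_large (2 * `|M| / l) (divr_ge0 (mulr_ge0 (ler0n _ 2) (normr_ge0 _)) (ltW l0)).
exists (r + rho) => _ v w d -> vC wC d0 vM wM vw x xr.
have MM := ler_norm M.
apply: sup_conv_le => z; have [zr|rz] := leP `|z| rho.
  have := vw (x + z) (le_trans (ler_normD _ _) (lerD xr zr)).
  by have := sup_conv_ub x z (ltW l0) wM; lra.
have : 2 * `|M| <= l * `|z| `^ p.
  by rewrite [leRHS]mulrC -ler_pdivrMr//; apply: rhoP; exact: ltW.
have := vM (x + z); have := sup_conv_bound (ltW l0) wM x.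
by rewrite !ler_norml => /andP[? ?] /andP[? ?]; lra.
Qed.

Lemma sup_conv_Lipb l u : 0 <= l -> Lipb K u -> Lipb K (Q l u).
Proof.
move=> l0 /LipbP[L [M [uL uM]]]; apply/LipbP; exists L, M.
by split; [exact: sup_conv_Lip uM uL|exact: sup_conv_bound].
Qed.

Lemma sup_conv_Cb l u : 0 < l -> Cb K u -> Cb K (Q l u).
Proof.
move=> l0; apply: tight_Cb; first exact: sup_conv_tight.
- by move=> v vL; apply: Lipb_Cb; apply: sup_conv_Lipb vL; exact: ltW.
- by move=> v M _; apply: sup_conv_bound; exact: ltW.
Qed.

Lemma sup_conv_mono l u v M x : 0 <= l -> (forall x, `|v x| <= M) ->
  (forall x, u x <= v x) -> Q l u x <= Q l v x.
Proof.
move=> l0 vM uv; apply: sup_conv_le => z.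
by have := sup_conv_ub x z l0 vM; have := uv (x + z); lra.
Qed.

Lemma sup_convDr l (a : R) u M x : 0 <= l -> (forall x, `|u x| <= M) ->
  Q l (fun x => a + u x) x <= a + Q l u x.
Proof.
by move=> l0 uM; apply: sup_conv_le => z; have := sup_conv_ub x z l0 uM; lra.
Qed.

Lemma sup_conv_near_id u r e : Cb K u -> 0 < e -> exists2 l0, 0 < l0 &
  forall l, l0 <= l -> forall x, `|x| <= r -> Q l u x <= u x + e.
Proof.
move=> uC e0; have [d d0 ud] := Cb_unif K1 (r + 1) uC e0.
have [M M0 uM] := Cb_bounded uC.
pose d' := Num.min d 1; have d'0 : 0 < d' by rewrite lt_min d0 ltr01.
have dp : 0 < d' `^ p by rewrite powR_gt0.
exists ((2 * M + 1) / d' `^ p); first by rewrite divr_gt0// ltr_wpDl// mulr_ge0.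
move=> l ll x xr; apply: sup_conv_le => z.
have l0 : 0 <= l.
  by apply: le_trans ll; rewrite divr_ge0 ?addr_ge0 ?mulr_ge0// ltW.
have [zd|dz] := leP `|z| d'.
  have := zd; rewrite le_min => /andP[zd1 z1].
  have : `|u (x + z) - u x| <= e.
    apply: ud; first exact: le_trans (ler_normD _ _) (lerD xr z1).
      by rewrite (le_trans xr)// lerDl.
    by rewrite addrC addKr.
  have : 0 <= l * `|z| `^ p by rewrite mulr_ge0// powR_ge0.
  by rewrite ler_norml => ? /andP[? ?]; lra.
have : 2 * M + 1 <= l * `|z| `^ p.
  rewrite ler_pdivrMr// in ll; apply: le_trans ll _; rewrite ler_wpM2l//.
  by apply: ge0_ler_powR; rewrite ?nnegrE// ltW// (lt_trans d'0).
by have := uM (x + z); have := uM x; rewrite !ler_norml => /andP[? ?] /andP[? ?]; lra.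
Qed.

Lemma sup_conv_comp a b l u M x : 0 <= a -> 0 <= b -> 0 <= l ->
  (forall x, `|u x| <= M) ->
  (forall z1 z2, l * `|z1 + z2| `^ p <= a * `|z1| `^ p + b * `|z2| `^ p) ->
  Q a (Q b u) x <= Q l u x.
Proof.
move=> a0 b0 l0 uM lab; apply: sup_conv_le => z1; rewrite lerBlDr.
apply: sup_conv_le => z2.
have := sup_conv_ub x (z1 + z2) l0 uM; have := lab z1 z2.
by rewrite -addrA; lra.
Qed.

End SupConv.

(** Jensen's inequality with weights [t / (t + s)] and [s / (t + s)]: covering a
    distance is cheapest at constant speed. *)
Lemma powR_add_convex {R : realType} (p t s a b : R) : 1 <= p -> 0 < t -> 0 < s ->
  0 <= a -> 0 <= b -> (t + s) `^ (1 - p) * (a + b) `^ p <=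
    t `^ (1 - p) * a `^ p + s `^ (1 - p) * b `^ p.
Proof.
move=> p1 t0 s0 a0 b0; have ts0 : 0 < t + s by rewrite addr_gt0.
have scale (t' a' : R) : 0 < t' -> 0 <= a' ->
    t' `^ (1 - p) * a' `^ p = t' * (a' / t') `^ p.
  move=> t'0 a'0; rewrite powRM ?invr_ge0 ?(ltW t'0)// powRB; last first.
    by rewrite (gt_eqF t'0) implybT.
  rewrite powRr1 ?ltW// -[in RHS]powR_inv1 ?ltW// -powRrM mulN1r powRN.
  by rewrite mulrAC mulrA.
rewrite !scale ?addr_ge0//.
have tsI : 0 <= t / (t + s) <= 1.
  apply/andP; split; first by apply: divr_ge0; apply: ltW.
  by rewrite ler_pdivrMr// mul1r lerDl; exact: ltW.
have := convex_powR p1 (Itv01 (andP tsI).1 (andP tsI).2).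
move=> /(_ (a / t) (b / s)); rewrite !inE /= !in_itv/= !andbT.
move=> /(_ (divr_ge0 a0 (ltW t0)) (divr_ge0 b0 (ltW s0))).
rewrite convRE [X in X `^ _ <= _]convRE /= /unstable.onem => h.
have := ler_wpM2l (ltW ts0) h; rewrite mulrDr.
have -> : 1 - t / (t + s) = s / (t + s) by field; exact: lt0r_neq0.
have -> : t / (t + s) * (a / t) + s / (t + s) * (b / s) = (a + b) / (t + s).
  by field; rewrite !lt0r_neq0.
have E (q A : R) : (t + s) * (q / (t + s) * A) = q * A.
  by rewrite mulrA (mulrCA (t + s)) divff ?mulr1// lt0r_neq0.
by rewrite !E.
Qed.

(** The weight that the affine minorant of slope [k] of the penalisation puts on
    displacements performed within time [t]. *)
Definition rate {R : realType} (p c k t : R) : R :=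
  k * expR (- (p * c * t)) * t `^ (1 - p).

Lemma rate_gt0 {R : realType} (p c k t : R) : 0 < k -> 0 < t -> 0 < rate p c k t.
Proof. by move=> k0 t0; rewrite !mulr_gt0 ?expR_gt0 ?powR_gt0. Qed.

Section RefSupConv.
Context {R : realType} {X : normedModType R} {K : {linear X -> X}} {p c : R}
  {mu : R -> probability (borel X) R} {psi : R -> X -> X} {phi : R -> \bar R}.
Context (H : model K p c mu psi phi).
Local Notation T := (ref_op mu psi).
Local Notation Q := (sup_conv p).
Implicit Types (u v w : X -> R) (l M r e t s : R) (x z : X).

Let p0 : 0 < p. Proof. exact: lt_trans ltr01 (model_p_gt1 H). Qed.

(** The flow stretches displacements by at most [expR (c * s)], so displacing
    before the reference step amounts to displacing after it at a lower price. *)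
Lemma sup_conv_ref l l' s u x : 0 < l' -> 0 <= s ->
  l' * expR (p * c * s) <= l -> Cb K u -> Q l (T s u) x <= T s (Q l' u) x.
Proof.
move=> l'0 s0 ll uC; have [M M0 uM] := Cb_bounded uC.
apply: sup_conv_le => z; rewrite lerBlDr.
have := @ref_perturb _ _ _ _ _ _ _ _ H u (Q l' u) (l * `|z| `^ p) 0 s (x + z) x s0 uC
  (sup_conv_Cb p0 l'0 uC).
rewrite mul0r addr0; apply=> y; rewrite mul0r addr0.
have := sup_conv_ub (psi s x + y) (psi s (x + z) - psi s x) (ltW l'0) uM (p := p).
rewrite (_ : psi s x + y + (psi s (x + z) - psi s x) = psi s (x + z) + y); last first.
  by rewrite addrC addrA subrK.
rewrite lerBlDr => /le_trans; apply; rewrite lerD2l.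
apply: le_trans (ler_wpM2r (powR_ge0 _ _) ll).
rewrite -[leRHS]mulrA ler_pM2l// (_ : p * c * s = (c * s) * p); last by ring.
rewrite expRM -powRM ?expR_ge0//.
have Zz : `|psi s (x + z) - psi s x| <= expR (c * s) * `|z|.
  by have := model_psi_lip H (x + z) x s0; rewrite addrAC subrr add0r.
apply: ge0_ler_powR => //; rewrite ?nnegrE; first exact: ltW.
- by [].
- by rewrite mulr_ge0// expR_ge0.
Qed.

(** The discount [expR (- (p * c * t))] in the price absorbs the stretching by the
    flow; what is left is the subadditivity in time of [t^(1-p) a^p]. *)
Lemma sup_conv_semigroup k t s u x : 0 < k -> 0 < t -> 0 < s -> Cb K u ->
  Q (rate p c k t) (T s (Q (rate p c k s) u)) x <= T s (Q (rate p c k (t + s)) u) x.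
Proof.
move=> k0 t0 s0 uC; have [M M0 uM] := Cb_bounded uC.
have rt := rate_gt0 p c k0 t0; have rs := rate_gt0 p c k0 s0.
have rts := rate_gt0 p c k0 (addr_gt0 t0 s0).
pose l' := rate p c k t * expR (- (p * c * s)).
have l'0 : 0 < l' by rewrite mulr_gt0// expR_gt0.
have QC := sup_conv_Cb p0 rs uC.
apply: le_trans (@sup_conv_ref _ l' _ _ _ l'0 (ltW s0) _ QC) _.
  by rewrite /l' -mulrA -expRD addNr expR0 mulr1.
apply: (ref_le H x (ltW s0)).
- exact: sup_conv_Cb l'0 QC.
- exact: sup_conv_Cb rts uC.
move=> y; apply: (sup_conv_comp _ (ltW l'0) (ltW rs) (ltW rts) uM) => z1 z2.
have c0 : 0 <= p * c * t by rewrite !mulr_ge0 ?(ltW p0) ?(model_c_ge0 H) ?ltW.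
pose E := k * expR (- (p * c * (t + s))).
have E0 : 0 <= E by rewrite mulr_ge0 ?expR_ge0 ?ltW.
have l'E : l' = E * t `^ (1 - p).
  rewrite /l' /rate /E mulrDr opprD expRD; ring.
have rE : E * s `^ (1 - p) <= rate p c k s.
  rewrite /E /rate ler_wpM2r ?powR_ge0// ler_pM2l// ler_expR mulrDr.
  by rewrite opprD gerDr oppr_le0.
apply: (@le_trans _ _ (l' * `|z1| `^ p + E * s `^ (1 - p) * `|z2| `^ p)); last first.
  by rewrite lerD2l ler_wpM2r ?powR_ge0.
rewrite l'E /rate -/E -3!(mulrA E) -mulrDr ler_wpM2l//.
apply: le_trans (powR_add_convex (ltW (model_p_gt1 H)) t0 s0 (normr_ge0 _) (normr_ge0 _)).
rewrite ler_wpM2l ?powR_ge0//; apply: ge0_ler_powR; rewrite ?nnegrE ?addr_ge0 ?(ltW p0)//.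
exact: ler_normD.
Qed.

End RefSupConv.


(** * Penalisation and one-dimensional Fenchel duality *)

(** In the variable [v^p], in which [phi] is still convex, these are its
    increasing affine minorants. *)
Definition minorant {R : realType} (p : R) (phi : R -> \bar R) (k D : R) : Prop :=
  0 < k /\ forall v, 0 <= v -> ((k * v `^ p - D)%:E <= phi v)%E.

Lemma powRVK {R : realType} (p v : R) : 0 < p -> 0 <= v -> (v `^ p) `^ p^-1 = v.
Proof. by move=> p0 v0; rewrite -powRrM mulfV ?powRr1// lt0r_neq0. Qed.

Lemma powRKV {R : realType} (p v : R) : 0 < p -> 0 <= v -> (v `^ p^-1) `^ p = v.
Proof. by move=> p0 v0; rewrite -powRrM mulVf ?powRr1// lt0r_neq0. Qed.

Section Penalisation.
Context {R : realType} {p : R} {phi : R -> \bar R}.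
Context (p1 : 1 < p) (P : penalisation p phi).
Implicit Types (v w r f g e k D : R).

Let p0 : 0 < p. Proof. exact: lt_trans ltr01 p1. Qed.

Lemma pen_ge0 v : 0 <= v -> (0 <= phi v)%E.
Proof. by case: P => + _ _ _ _; apply. Qed.

Lemma pen0 : phi 0 = 0%E.
Proof. by case: P. Qed.

Lemma pen_pow_convex v w l g g' : 0 <= v -> 0 <= w -> 0 <= l -> l <= 1 ->
  phi (v `^ p^-1) = g%:E -> phi (w `^ p^-1) = g'%:E ->
  (phi ((l * v + (1 - l) * w) `^ p^-1) <= (l * g + (1 - l) * g')%:E)%E.
Proof.
case: P => _ _ _ _ cv v0 w0 l0 l1 gE g'E.
by have := cv v w l v0 w0 l0 l1; rewrite gE g'E.
Qed.

Lemma pen_homo v w : 0 <= v -> v <= w -> (phi v <= phi w)%E.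
Proof.
move=> v0 vw; case: P => _ [cv _] _ _ _.
have [w0|w0] := eqVneq w 0.
  by have -> : v = w by apply/eqP; rewrite eq_le vw w0.
have wp : 0 < w by rewrite lt_neqAle eq_sym w0 (le_trans v0).
have l0 : 0 <= v / w by rewrite divr_ge0// ltW.
have l1 : v / w <= 1 by rewrite ler_pdivrMr// mul1r.
have := cv w 0 (v / w) (ltW wp) (lexx 0) l0 l1.
rewrite pen0 mulr0 addr0 mule0 adde0 divfK// => /le_trans; apply.
case E : (phi w) => [g| |].
- rewrite -EFinM lee_fin ler_piMl// -lee_fin -E; exact: pen_ge0 (ltW wp).
- by rewrite leey.
- by have := pen_ge0 (ltW wp); rewrite E.
Qed.

(** A convex function of [v^p] that vanishes at zero and is positive somewhere
    grows at least linearly in [v^p], up to a constant. *)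
Lemma minorant_exists : exists k D, minorant p phi k D.
Proof.
have [v0 v00 pv0] : exists2 v0, 0 < v0 & phi v0 != 0%E by case: P.
pose G r := phi (r `^ p^-1).
pose r0 := v0 `^ p; have r00 : 0 < r0 by rewrite powR_gt0.
have [a a0 aG] : exists2 a : R, 0 < a & (a%:E <= G r0)%E.
  rewrite /G powRVK ?(ltW v00)//.
  have : (0 < phi v0)%E by rewrite lt_neqAle eq_sym pv0 (pen_ge0 (ltW v00)).
  case: (phi v0) => [g| |] //; first by rewrite lte_fin; exists g.
  by exists 1 => //; rewrite leey.
exists (a / r0), a; split=> [|v v_ge0]; first by rewrite divr_gt0.
have vp0 : 0 <= v `^ p by exact: powR_ge0.
have -> : phi v = G (v `^ p) by rewrite /G powRVK.
have [vr|rv] := leP (v `^ p) r0.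
  apply: (@le_trans _ _ 0%E).
    by rewrite lee_fin subr_le0 mulrAC ler_pdivrMr// ler_pM2l.
  exact/pen_ge0/powR_ge0.
apply: (@le_trans _ _ (a / r0 * v `^ p)%:E); first by rewrite lee_fin gerBl ltW.
have vp : 0 < v `^ p := lt_trans r00 rv.
case EG : (G (v `^ p)) => [g| |]; last 2 first.
- by rewrite leey.
- by have := pen_ge0 (powR_ge0 (v `^ p) p^-1); rewrite [phi _]EG.
rewrite lee_fin; pose l := r0 / v `^ p.
have l0 : 0 <= l by rewrite divr_ge0// ltW.
have l1 : l <= 1 by rewrite ler_pdivrMr// mul1r ltW.
have G0 : phi (0 `^ p^-1) = 0%:E by rewrite powR0 ?pen0// invr_eq0 lt0r_neq0.
have := pen_pow_convex (ltW vp) (lexx 0) l0 l1 EG G0.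
rewrite !mulr0 !addr0 /l divfK ?(gt_eqF vp)// => /(le_trans aG).
rewrite lee_fin mulrAC ler_pdivlMr// => ag.
by rewrite mulrAC ler_pdivrMr// (mulrC g).
Qed.

Lemma minorant_D_ge0 k D : minorant p phi k D -> 0 <= D.
Proof.
by move=> [_ /(_ 0 (lexx 0))]; rewrite pen0 powR0 ?lt0r_neq0// mulr0 sub0r
  lee_fin oppr_le0.
Qed.

(** Smaller slopes need smaller corrections, so that [D] can be made to vanish
    with [k]. *)
Lemma minorant_small e : 0 < e -> exists2 k, 0 < k & minorant p phi k e.
Proof.
move=> e0; have [k [D kD]] := minorant_exists; have D0 := minorant_D_ge0 kD.
have [k0 kP] := kD; pose a := e / (D + e).
have De : 0 < D + e by rewrite ltr_wpDl.
have a0 : 0 < a by rewrite divr_gt0.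
have a1 : a <= 1 by rewrite ler_pdivrMr// mul1r lerDr.
exists (a * k); first by rewrite mulr_gt0.
split=> [|v v0]; first by rewrite mulr_gt0.
have aD : a * D <= e by rewrite /a mulrAC ler_pdivrMr// ler_pM2l// lerDl ltW.
apply: (@le_trans _ _ (Num.max 0 (k * v `^ p - D))%:E); last first.
  rewrite /Num.max; case: ifP => _; [exact: kP|exact: pen_ge0].
rewrite lee_fin le_max; have [h|h] := leP (k * v `^ p - D) 0.
  apply/orP; left; have := ler_wpM2l (ltW a0) h; rewrite mulr0 mulrBr mulrA.
  by lra.
apply/orP; right; have := ler_wpM2r (ltW h) a1; rewrite mul1r mulrBr mulrA.
by lra.
Qed.

(** [C] is the set of pairs (transport cost, gain) that can be realised, and [V]
    bounds the gain minus [phi] of the [p]-th root of the cost. *)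
Section Fenchel.
Context {C : R -> R -> Prop} {V B f0 : R}.
Context (C0 : C 0 f0)
  (C_cost : forall r f, C r f -> 0 <= r)
  (C_growth : forall r f, C r f -> f <= B * (1 + r))
  (C_convex : forall r f r' f' l, C r f -> C r' f' -> 0 <= l -> l <= 1 ->
    C (l * r + (1 - l) * r') (l * f + (1 - l) * f'))
  (C_value : forall r f, C r f -> (f%:E <= V%:E + phi (r `^ p^-1))%E)
  (C_cont : forall e, 0 < e -> exists2 d, 0 < d &
    forall r f, C r f -> r <= d -> f <= V + e).

Let G r := phi (r `^ p^-1).

Let G0 : G 0 = 0%:E.
Proof. by rewrite /G powR0 ?pen0// invr_eq0 lt0r_neq0. Qed.

Let C_valueR r f g : C r f -> G r = g%:E -> f <= V + g.
Proof. by move=> Crf Gr; have := C_value Crf; rewrite -/(G r) Gr -EFinD lee_fin. Qed.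

Let f0V : f0 <= V.
Proof. by have := C_valueR C0 G0; rewrite addr0. Qed.

Let C_valueR_le r f r' g : C r f -> r <= r' -> G r' = g%:E -> f <= V + g.
Proof.
move=> Crf rr Gr; have r0 := C_cost Crf; have r'0 := le_trans r0 rr.
have : (G r <= G r')%E.
  apply: pen_homo; first exact: powR_ge0.
  by apply: ge0_ler_powR; rewrite ?nnegrE// invr_ge0 ltW.
rewrite Gr; case Gr' : (G r) => [g'| |] //.
  by rewrite lee_fin; have := C_valueR Crf Gr'; lra.
by have := pen_ge0 (powR_ge0 r p^-1); rewrite -/(G r) Gr'.
Qed.

(** The line of slope [k] through [(r, f)] stays below the penalty shifted by
    [V + e]: a common supporting slope for the concave and the convex side. *)
Definition separates (e k : R) := forall r f r' g, C r f -> 0 <= r' ->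
  G r' = g%:E -> f - g <= V + e + k * (r - r').

(** Comparing a chord of the concave side with one of the convex side at the
    point where they cross. *)
Let chords r f r' g q h q' h' : C r f -> 0 <= r' -> G r' = g%:E -> r' < r ->
  C q h -> 0 <= q' -> G q' = h'%:E -> q < q' ->
  (f - g - V) * (q' - q) <= (V - h + h') * (r - r').
Proof.
move=> Crf r'0 Gr rr Cqh q'0 Gq qq.
have S0 : 0 < (r - r') + (q' - q) by rewrite addr_gt0 ?subr_gt0.
pose l := (q' - q) / ((r - r') + (q' - q)).
have l0 : 0 <= l by apply: divr_ge0; [rewrite subr_ge0|]; apply: ltW.
have l1 : l <= 1 by rewrite ler_pdivrMr// mul1r lerDr subr_ge0; exact: ltW.
have m1 : l * r + (1 - l) * q = l * r' + (1 - l) * q'.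
  by rewrite /l; field; exact: lt0r_neq0.
have := C_value (C_convex Crf Cqh l0 l1); rewrite m1.
have := pen_pow_convex r'0 q'0 l0 l1 Gr Gq.
case E : (phi _) => [g2| |]; last 2 first.
- by rewrite leye_eq.
- by have := pen_ge0 (powR_ge0 (l * r' + (1 - l) * q') p^-1); rewrite E.
rewrite -EFinD !lee_fin => a b.
have : l * f + (1 - l) * h <= V + (l * g + (1 - l) * h') by lra.
move=> /(ler_wpM2l (ltW S0)).
have -> : (r - r' + (q' - q)) * (l * f + (1 - l) * h) = (q' - q) * f + (r - r') * h.
  by rewrite /l; field; exact: lt0r_neq0.
have -> : (r - r' + (q' - q)) * (V + (l * g + (1 - l) * h')) =
    (r - r' + (q' - q)) * V + ((q' - q) * g + (r - r') * h').
  by rewrite /l; field; exact: lt0r_neq0.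
by lra.
Qed.

(** The slope is the supremum of those of the chords from the penalty, shifted by
    [V], up to [C]. *)
Let separates_finite e q0 g0 : 0 < e -> 0 < q0 -> G q0 = g0%:E ->
  exists2 k, 0 <= k & separates e k.
Proof.
move=> e0 q00 Gq0.
pose A := [set a | a = 0 \/ exists r f r' g, [/\ C r f, 0 <= r', G r' = g%:E,
  r' < r & a = (f - g - V) / (r - r')]].
have A0 : A 0 by left.
have AB a q h q' h' : A a -> C q h -> 0 <= q' -> G q' = h'%:E -> q < q' ->
    a <= (V - h + h') / (q' - q).
  move=> [->|[r [f [r' [g [Crf r'0 Gr rr ->]]]]]] Cqh q'0 Gq qq.
    rewrite divr_ge0// ?subr_ge0 ?(ltW qq)//.
    by have := C_valueR_le Cqh (ltW qq) Gq; lra.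
  rewrite ler_pdivrMr ?subr_gt0// mulrAC ler_pdivlMr ?subr_gt0//.
  exact: (chords Crf _ Gr).
have supA : has_sup A.
  split; first by exists 0.
  by exists ((V - f0 + g0) / (q0 - 0)) => a Aa; exact: (AB _ _ _ _ _ Aa C0 (ltW q00)).
exists (sup A) => [|r f r' g Crf r'0 Gr]; first exact: ub_le_sup supA.2 _ A0.
have [rr|rr|rr] := ltgtP r r'.
- have : sup A <= (V - f + g) / (r' - r).
    by apply: ge_sup; [exists 0|move=> a Aa; exact: (AB _ _ _ _ _ Aa Crf)].
  by rewrite ler_pdivlMr ?subr_gt0//; lra.
- have : (f - g - V) / (r - r') <= sup A.
    by apply: ub_le_sup; [exact: supA.2|right; exists r, f, r', g].
  by rewrite ler_pdivrMr ?subr_gt0//; lra.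
- by rewrite rr subrr mulr0; rewrite -rr in Gr; have := C_valueR Crf Gr; lra.
Qed.

(** When the penalty is infinite away from zero, the only constraint is at cost
    zero, where continuity and the linear growth of the gain provide a slope. *)
Let separates_exists e : 0 < e -> exists2 k, 0 <= k & separates e k.
Proof.
move=> e0; have [[q0 [g0 [q00 Gq0]]]|nG] := pselect (exists q0 g0, 0 < q0 /\ G q0 = g0%:E).
  exact: separates_finite Gq0.
have [d d0 dP] := C_cont e0.
have B0 : 0 <= `|B| := normr_ge0 _.
have f00 : 0 <= `|f0| := normr_ge0 _.
exists (`|B| + (`|B| + `|f0|) / d) => [|r f r' g Crf].
  by rewrite addr_ge0// divr_ge0 ?addr_ge0// ltW.
rewrite le_eqVlt => /predU1P[<-|r'0 Gr']; last first.
  by exfalso; apply: nG; exists r', g.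
rewrite G0 => -[<-]; rewrite !subr0.
have r0 := C_cost Crf.
have [rd|dr] := leP r d.
  rewrite (le_trans (dP r f Crf rd))// lerDl mulr_ge0// addr_ge0//.
  by rewrite divr_ge0 ?addr_ge0// ltW.
have : `|B| + `|f0| <= (`|B| + `|f0|) / d * r.
  by rewrite -mulrA ler_peMr ?addr_ge0// mulrC ler_pdivlMr// mul1r ltW.
have : B * (1 + r) <= `|B| * (1 + r) by rewrite ler_wpM2r ?ler_norm// addr_ge0.
have := C_growth Crf; have := ler_norm (- f0); rewrite normrN.
by have := f0V; lra.
Qed.

(** Strong duality in dimension one. A separating slope [k] makes the relaxed
    problem bounded, and the best constant [D] for it is an admissible one for
    [phi] by the same separation. A slope [0] is first raised a little. *)
Lemma fenchel_duality e : 0 < e -> exists k D, minorant p phi k D /\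
  forall r f, C r f -> D + f - k * r <= V + e.
Proof.
move=> e0; have e20 : 0 < e / 2 by rewrite divr_gt0.
have [k k0 sk] : exists2 k, 0 < k & separates e k.
  have [k] := separates_exists e20; rewrite le_eqVlt => /predU1P[<-|k0] sk.
    have [k' k'0 [_ k'P]] := minorant_small e20.
    exists k' => // r f r' g Crf r'0 Gr'.
    have := sk r f 0 0 Crf (lexx 0) G0; rewrite mul0r addr0 subr0.
    have := k'P _ (powR_ge0 r' p^-1); rewrite -/(G r') Gr' lee_fin powRKV//.
    have : 0 <= k' * r by rewrite mulr_ge0 ?(ltW k'0)// (C_cost Crf).
    by lra.
  by exists k => // r f r' g Crf r'0 Gr'; have := sk r f r' g Crf r'0 Gr'; lra.
pose A := [set a | exists r f, C r f /\ a = f - k * r].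
have A0 : A !=set0 by exists f0; exists 0, f0; rewrite mulr0 subr0.
have Aub : has_ubound A.
  exists (V + e) => _ [r [f [Crf ->]]].
  by have := sk r f 0 0 Crf (lexx 0) G0; lra.
exists k, (V + e - sup A); split; last first.
  move=> r f Crf; have : f - k * r <= sup A by apply: ub_le_sup => //; exists r, f.
  by lra.
split=> // v v0; case E : (phi v) => [g| |]; last 2 first.
- by rewrite leey.
- by have := pen_ge0 v0; rewrite E.
rewrite lee_fin; have : sup A <= V + e + g - k * v `^ p; last by lra.
apply: ge_sup => // _ [r [f [Crf ->]]].
have := sk r f (v `^ p) g Crf (powR_ge0 _ _); rewrite /G powRVK// => /(_ E).
by lra.
Qed.

End Fenchel.

End Penalisation.


(** * Duality for the one-step operator *)

Section Selection.
Context d (T : measurableType d).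

Lemma measurable_selection (A : nat -> set T) : (forall n, measurable (A n)) ->
  (forall y, exists n, A n y) -> exists i : T -> nat,
    (forall n, measurable (i @^-1` [set n])) /\ forall y, A (i y) y.
Proof.
move=> mA Ay.
have /choice[i iP] : forall y, exists n, A n y /\ forall m, (m < n)%N -> ~ A m y.
  move=> y; have ex : exists n, `[< A n y >].
    by have [n An] := Ay y; exists n; apply/asboolP.
  exists (ex_minn ex); case: ex_minnP => n /asboolP An nmin; split=> // m mn Am.
  have /asboolP/nmin : A m y by [].
  by rewrite leqNgt mn.
exists i; split=> [n|y]; last by case: (iP y).
have -> : i @^-1` [set n] = A n `\` \big[setU/set0]_(m < n) A m.
  apply/seteqP; split => y /=.
    move=> yn; have [Ay' nA] := iP y; split; first by rewrite -yn.
    by rewrite -bigcup_mkord => -[m /= mn Am]; apply: (nA m) => //; rewrite yn.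
  move=> [An nA]; have [Ai nAi] := iP y.
  have [ni|ni|//] := ltngtP (i y) n; exfalso.
    by apply: nA; rewrite -bigcup_mkord; exists (i y).
  exact: nAi ni An.
by apply: measurableD => //; apply: bigsetU_measurable.
Qed.

Lemma measurable_piecewise d' (T' : measurableType d') (f : nat -> T -> T')
    (i : T -> nat) : (forall n, measurable (i @^-1` [set n])) ->
  (forall n, measurable_fun setT (f n)) -> measurable_fun setT (fun y => f (i y) y).
Proof.
move=> mi mf _ B mB; rewrite setTI.
have -> : (fun y => f (i y) y) @^-1` B =
    \bigcup_n (i @^-1` [set n] `&` (f n @^-1` B)).
  apply/seteqP; split => y /=; first by move=> By; exists (i y).
  by move=> [n _ [/= -> ]].
apply: bigcup_measurable => n _; apply: measurableI => //.
by rewrite -[X in measurable X]setTI; exact: mf.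
Qed.

End Selection.

(** Approximating a displacement by a shorter one does not raise its price; to
    find such approximations, shrink [x] a little first. *)
Lemma dense_sequence_norm {R : realType} {X : normedModType R} : separable X ->
  exists z : nat -> X, forall x (e : R), 0 < e ->
    exists n, `|x - z n| <= e /\ `|z n| <= `|x|.
Proof.
move=> /dense_sequence[z zP].
exists (fun n => if n is n'.+1 then z n' else 0) => x e e0.
have [->|x0] := eqVneq x 0; first by exists 0%N; rewrite subrr normr0 ltW.
have nx : 0 < `|x| by rewrite normr_gt0.
pose a := Num.min 1 (e / 2 / `|x|).
have a0 : 0 < a by rewrite lt_min ltr01 !divr_gt0.
have a1 : a <= 1 by rewrite ge_min lexx.
have ax : a * `|x| <= e / 2 by rewrite -ler_pdivlMr// ge_min lexx orbT.
have [n zn] := zP ((1 - a) *: x) (a * `|x|) (mulr_gt0 a0 nx).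
exists n.+1; split.
  have := ler_distD ((1 - a) *: x) x (z n).
  have -> : x - (1 - a) *: x = a *: x by rewrite scalerBl scale1r subKr.
  rewrite normrZ.
  by rewrite (gtr0_norm a0); move: zn ax; lra.
have := ler_distD ((1 - a) *: x) 0 (z n); rewrite !sub0r !normrN normrZ.
by rewrite ger0_norm ?subr_ge0// mulrBl mul1r; move: zn; lra.
Qed.

Section Duality.
Context {R : realType} {X : normedModType R} {K : {linear X -> X}} {p c : R}
  {mu : R -> probability (borel X) R} {psi : R -> X -> X} {phi : R -> \bar R}.
Context (H : model K p c mu psi phi).
Local Notation T := (ref_op mu psi).
Local Notation Q := (sup_conv p).
Local Notation I := (I_op p c phi mu psi).
Local Notation W := (wasserstein p).
Local Notation prob := (probability (borel X) R).
Implicit Types (u v w : X -> R) (l M r e t s k D : R) (x z : X) (nu : prob)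
  (pi : probability (borel X * borel X)%type R).

Let p1 : 1 < p. Proof. exact: model_p_gt1 H. Qed.
Let p0 : 0 < p. Proof. exact: lt_trans ltr01 p1. Qed.
Let K1 := model_contr H.
Let P := model_phi H.

Definition cost pi := (\int[pi]_z ((`|(z.1 : X) - (z.2 : X)| `^ p)%R%:E))%E.

Lemma measurable_cost : measurable_fun setT
  (fun z : (borel X * borel X)%type => `|(z.1 : X) - (z.2 : X)| `^ p).
Proof.
exact: (measurableT_comp (measurable_powR _) (measurable_dist (model_separable H))).
Qed.

Lemma cost_ge0 pi : (0 <= cost pi)%E.
Proof. by apply: integral_ge0 => z _; rewrite lee_fin powR_ge0. Qed.

Lemma powRD_le (a b : R) : 0 <= a -> 0 <= b ->
  (a + b) `^ p <= 2 `^ p * (a `^ p + b `^ p).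
Proof.
move=> a0 b0; have m0 : 0 <= Num.max a b by rewrite le_max a0.
apply: (@le_trans _ _ ((2 * Num.max a b) `^ p)).
  apply: ge0_ler_powR; rewrite ?nnegrE ?addr_ge0 ?mulr_ge0 ?(ltW p0)//.
  have : a <= Num.max a b by rewrite le_max lexx.
  have : b <= Num.max a b by rewrite le_max lexx orbT.
  by lra.
rewrite powRM// ler_wpM2l ?powR_ge0//.
by rewrite /Num.max; case: ifP => _; rewrite ?lerDl ?lerDr powR_ge0.
Qed.

Lemma fst_measurable : measurable_fun setT (fst : (borel X * borel X)%type -> borel X).
Proof. exact: measurable_fst. Qed.

Lemma snd_measurable : measurable_fun setT (snd : (borel X * borel X)%type -> borel X).
Proof. exact: measurable_snd. Qed.

Lemma cost_product nu nu' : Pp p nu -> Pp p nu' ->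
  exists2 pi, coupling nu nu' pi & (cost pi < +oo)%E.
Proof.
move=> nuP nu'P; pose pi : probability (borel X * borel X)%type R := (nu \x nu')%E.
have cpl : coupling nu nu' pi.
  move=> A mA; split.
  - rewrite (_ : fst @^-1` A = A `*` setT); last first.
      by apply/seteqP; split=> -[a b] //= [].
    apply: etrans (product_measure1E _ _ mA measurableT) _.
    by rewrite [X in (_ * X)%E](_ : _ = 1%E) ?mule1//; exact: probability_setT.
  - rewrite (_ : snd @^-1` A = setT `*` A); last first.
      by apply/seteqP; split=> -[a b] //= [].
    apply: etrans (product_measure1E _ _ measurableT mA) _.
    by rewrite [X in (X * _)%E](_ : _ = 1%E) ?mul1e//; exact: probability_setT.
exists pi => //.
have mn := measurable_normX (X := X) p.
have m1 : measurable_fun setT (fun z : (borel X * borel X)%type => `|(z.1 : X)| `^ p).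
  exact: (measurableT_comp mn fst_measurable).
have m2 : measurable_fun setT (fun z : (borel X * borel X)%type => `|(z.2 : X)| `^ p).
  exact: (measurableT_comp mn snd_measurable).
have i1 : pi.-integrable setT (EFin \o
    (fun z : (borel X * borel X)%type => `|(z.1 : X)| `^ p)).
  apply: ge0_integrable => //.
  rewrite -(ge0_transfer fst_measurable (fun A mA => (cpl A mA).1) mn
    (fun z => powR_ge0 _ _)); exact: nuP.
have i2 : pi.-integrable setT (EFin \o
    (fun z : (borel X * borel X)%type => `|(z.2 : X)| `^ p)).
  apply: ge0_integrable => //.
  rewrite -(ge0_transfer snd_measurable (fun A mA => (cpl A mA).2) mn
    (fun z => powR_ge0 _ _)); exact: nu'P.
have /integrableP[_] := expect_integrable_lin (2 `^ p) (2 `^ p) i1 i2.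
apply: le_lt_trans; apply: ge0_le_integral => //.
- by apply/measurable_EFinP; exact: measurable_cost.
- by apply/measurable_EFinP; apply: measurableT_comp => //;
    apply: measurable_funD; exact: measurable_funM.
move=> z _ /=; rewrite lee_fin -mulrDr ger0_norm; last first.
  by rewrite mulr_ge0 ?addr_ge0 ?powR_ge0.
apply: le_trans (powRD_le (normr_ge0 _) (normr_ge0 _)).
apply: ge0_ler_powR; rewrite ?nnegrE ?addr_ge0 ?(ltW p0)//; exact: ler_normB.
Qed.

Lemma wasserstein_ge0 nu nu' : 0 <= W nu nu'.
Proof. exact: powR_ge0. Qed.

Lemma cost_inf_ge0 nu nu' : (0 <= ereal_inf [set cost pi | pi in coupling nu nu'])%E.
Proof. by apply: le_ereal_inf_tmp => _ [pi _ <-]; exact: cost_ge0. Qed.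

Lemma wassersteinE nu nu' : Pp p nu -> Pp p nu' ->
  ((W nu nu') `^ p)%:E = ereal_inf [set cost pi | pi in coupling nu nu'].
Proof.
move=> nuP nu'P; have ge0 := cost_inf_ge0 nu nu'.
have fin : ereal_inf [set cost pi | pi in coupling nu nu'] \is a fin_num.
  rewrite ge0_fin_numE//; have [pi cpl cpi] := cost_product nuP nu'P.
  by apply: le_lt_trans cpi; apply: ereal_inf_lbound; exists pi.
by rewrite /wasserstein powRKV ?fine_ge0// fineK.
Qed.

Lemma wasserstein_cost nu nu' pi (a : R) : Pp p nu -> Pp p nu' ->
  coupling nu nu' pi -> cost pi = a%:E -> (W nu nu') `^ p <= a.
Proof.
move=> nuP nu'P cpl ca; rewrite -lee_fin wassersteinE//.
by apply: ereal_inf_lbound; exists pi.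
Qed.

Lemma wasserstein_approx nu nu' e : Pp p nu -> Pp p nu' -> 0 < e ->
  exists pi a, [/\ coupling nu nu' pi, cost pi = a%:E & a <= (W nu nu') `^ p + e].
Proof.
move=> nuP nu'P e0; have E := wassersteinE nuP nu'P.
have [|_ [pi cpl <-]] := @lb_ereal_inf_adherent _ [set cost pi | pi in coupling nu nu'] e e0.
  by rewrite -E.
rewrite -E -EFinD => ce; exists pi, (fine (cost pi)).
have fin : cost pi \is a fin_num.
  by rewrite ge0_fin_numE ?cost_ge0//; apply: lt_trans ce (ltry _).
by split=> //; [rewrite fineK|rewrite -lee_fin fineK// ltW].
Qed.

Lemma diagonal_coupling nu : exists2 pi, coupling nu nu pi & cost pi = 0%E.
Proof.
have mid : measurable_fun setT (fun y : borel X => y) by exact: measurable_id.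
have [pi piE] := pushforward_probability nu (measurable_fun_pair mid mid).
exists pi; first by move=> A mA; rewrite !piE.
rewrite /cost (ge0_transfer (measurable_fun_pair mid mid) (fun A _ => esym (piE A)))//.
- by rewrite integral0_eq// => y _ /=; rewrite subrr normr0 powR0 ?lt0r_neq0.
- exact: measurable_cost.
Qed.

Lemma wasserstein_self nu : Pp p nu -> W nu nu = 0.
Proof.
move=> nuP; have [pi cpl cpi] := diagonal_coupling nu.
have := wasserstein_cost nuP nuP cpl cpi => Wp.
apply: (@powR_eq0_eq0 _ _ p); apply/eqP.
by rewrite eq_le Wp powR_ge0.
Qed.

Lemma phi_time_gt0 t (v : R) : 0 < t ->
  phi_time c phi t v = (t%:E * phi (expR (- (c * t)) * v / t)%R)%E.
Proof. by move=> t0; rewrite /phi_time gt_eqF. Qed.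

Lemma phi_time_ge0 t (v : R) : 0 <= t -> 0 <= v -> (0 <= phi_time c phi t v)%E.
Proof.
move=> t0 v0; rewrite /phi_time; case: ifPn => [_|tn]; first by case: ifP.
rewrite mule_ge0 ?lee_fin//; apply: (pen_ge0 P).
by rewrite divr_ge0 ?mulr_ge0 ?expR_ge0.
Qed.

Lemma phi_time0 t : 0 <= t -> phi_time c phi t 0 = 0%E.
Proof.
rewrite /phi_time; case: ifPn => [_ _|_ t0]; first by rewrite eqxx.
by rewrite mulr0 mul0r (pen0 P) mule0.
Qed.

(** This form exhibits the discounted speed, the argument of [phi] in
    [phi_time]. *)
Lemma rateE k t : 0 < t -> rate p c k t = t * k * (expR (- (c * t)) / t) `^ p.
Proof.
move=> t0; have t0' := ltW t0.
rewrite /rate powRM ?expR_ge0 ?invr_ge0// -expRM powRB; last first.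
  by rewrite (gt_eqF t0) implybT.
rewrite powRr1// -[t^-1]powR_inv1// -powRrM mulN1r powRN.
by rewrite (_ : - (c * t) * p = - (p * c * t)); ring.
Qed.

Lemma phi_time_minorant t k D (v : R) : 0 < t -> minorant p phi k D -> 0 <= v ->
  ((rate p c k t * v `^ p - t * D)%:E <= phi_time c phi t v)%E.
Proof.
move=> t0 [k0 kD] v0; rewrite phi_time_gt0//.
have -> : expR (- (c * t)) * v / t = expR (- (c * t)) / t * v by rewrite mulrAC.
have a0 : 0 <= expR (- (c * t)) / t by rewrite divr_ge0 ?expR_ge0// ltW.
have := kD _ (mulr_ge0 a0 v0).
move=> /(lee_wpmul2l (x := t%:E)); rewrite lee_fin (ltW t0) => /(_ isT) h.
apply: le_trans h; rewrite -EFinM lee_fin powRM// rateE//.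
by rewrite mulrBr; lra.
Qed.

Section Step.
Context {u : X -> R} {t : R} {x : X} (uC : Cb K u) (t0 : 0 <= t).

Definition gain nu := \int[nu]_z u (psi t x + (z : X)).

Lemma gain_bound nu M : (forall x, `|u x| <= M) -> `|gain nu| <= M.
Proof.
move=> uM; rewrite /gain ler_norml; apply/andP; split.
- rewrite -(expect_cst nu (- M)); apply: le_Rintegral => //.
  + by apply: (@bounded_integrable _ _ _ _ _ `|- M|) => //; exact: measurable_cst.
  + exact: (shift_integrable H).
  + by move=> z _; have := uM (psi t x + z); rewrite ler_norml => /andP[].
- rewrite -(expect_cst nu M); apply: le_Rintegral => //.
  + exact: (shift_integrable H).
  + by apply: (@bounded_integrable _ _ _ _ _ `|M|) => //; exact: measurable_cst.
  + by move=> z _; have := uM (psi t x + z); rewrite ler_norml => /andP[].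
Qed.

Let I_set := [set ((gain nu)%:E - phi_time c phi t (W (mu t) nu))%E | nu in Pp p].

Let I_fin : ereal_sup I_set \is a fin_num.
Proof.
have [M M0 uM] := Cb_bounded uC; apply/fin_numP; split.
- apply/eqP => E; have : (ereal_sup I_set >= (gain (mu t))%:E)%E; last by rewrite E.
  apply: ereal_sup_ubound; exists (mu t); first exact: model_Pp H _ t0.
  by rewrite wasserstein_self ?phi_time0 ?sube0//; exact: model_Pp H _ t0.
- apply/eqP => E; have : (ereal_sup I_set <= M%:E)%E; last by rewrite E.
  apply: ge_ereal_sup => _ [nu nuP <-].
  apply: (@le_trans _ _ (gain nu)%:E).
    rewrite -[leRHS]sube0; apply: leeB => //.
    exact: phi_time_ge0 t0 (wasserstein_ge0 _ _).
  by rewrite lee_fin (le_trans (ler_norm _))// gain_bound.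
Qed.

Lemma I_ub nu : Pp p nu ->
  ((gain nu)%:E <= (I t u x)%:E + phi_time c phi t (W (mu t) nu))%E.
Proof.
move=> nuP; rewrite /I_op (fineK I_fin).
have ph := phi_time_ge0 t0 (wasserstein_ge0 (mu t) nu).
case E : (phi_time c phi t (W (mu t) nu)) => [a| |].
- rewrite -leeBlDr//; apply: ereal_sup_ubound; exists nu => //.
  by rewrite E.
- by rewrite addey ?leey//; move: I_fin; rewrite fin_numE => /andP[].
- by rewrite E in ph.
Qed.

Lemma I_lub (B : R) : (forall nu, Pp p nu ->
    ((gain nu)%:E <= B%:E + phi_time c phi t (W (mu t) nu))%E) -> I t u x <= B.
Proof.
move=> uB; rewrite -lee_fin /I_op (fineK I_fin).
apply: ge_ereal_sup => _ [nu nuP <-]; have := uB nu nuP.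
have ph := phi_time_ge0 t0 (wasserstein_ge0 (mu t) nu).
case E : (phi_time c phi t (W (mu t) nu)) => [a| |].
- by rewrite leeBlDr.
- by rewrite /= leNye.
- by rewrite E in ph.
Qed.

Lemma I_ge_ref : T t u x <= I t u x.
Proof.
have muP := model_Pp H t0; have := I_ub muP.
by rewrite wasserstein_self// phi_time0// adde0 lee_fin.
Qed.

Let coupled nu pi (a : R) := [/\ Pp p nu, coupling (mu t) nu pi & cost pi = a%:E].

Lemma gain_coupling nu pi (a : R) l : 0 < l -> coupled nu pi a ->
  gain nu <= T t (Q l u) x + l * a.
Proof.
move=> l0 [nuP cpl ca]; have QC := sup_conv_Cb p0 l0 uC.
have [M M0 uM] := Cb_bounded uC.
have QM := sup_conv_bound p0 (ltW l0) uM.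
have mu2 := measurableT_comp (measurable_shift H (psi t x) uC) snd_measurable.
have mQ1 := measurableT_comp (measurable_shift H (psi t x) QC) fst_measurable.
rewrite /gain (expect_transfer snd_measurable (fun A mA => (cpl A mA).2)
  (measurable_shift H (psi t x) uC) (fun z => uM _)).
rewrite /ref_op (expect_transfer fst_measurable (fun A mA => (cpl A mA).1)
  (measurable_shift H (psi t x) QC) (fun z => QM _)).
have ci : pi.-integrable setT (EFin \o
    (fun z : (borel X * borel X)%type => `|(z.1 : X) - (z.2 : X)| `^ p)).
  apply: ge0_integrable; first exact: measurable_cost.
    by move=> z; exact: powR_ge0.
  by rewrite -/(cost pi) ca ltry.
have Qi : pi.-integrable setT (EFin \o
    (fun z : (borel X * borel X)%type => Q l u (psi t x + (z.1 : X)))).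
  have fb (z : (borel X * borel X)%type) : `|Q l u (psi t x + (z.1 : X))| <= M by [].
  exact: (bounded_integrable pi mQ1 fb).
have -> : a = \int[pi]_z (`|(z.1 : X) - (z.2 : X)| `^ p).
  by rewrite /Rintegral -/(cost pi) ca.
rewrite -[X in _ <= X + _]mul1r -expect_lin//; apply: le_Rintegral => //.
- have fb (z : (borel X * borel X)%type) : `|u (psi t x + (z.2 : X))| <= M by [].
  exact: (bounded_integrable pi mu2 fb).
- exact: expect_integrable_lin.
move=> z _; have := sup_conv_ub (psi t x + (z.1 : X)) ((z.2 : X) - z.1) (ltW l0) uM (p := p).
rewrite -addrA (addrC (z.1 : X)) subrK distrC; lra.
Qed.

Lemma gain_weak nu l : Pp p nu -> 0 < l ->
  gain nu <= T t (Q l u) x + l * W (mu t) nu `^ p.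
Proof.
move=> nuP l0; apply/ler_addgt0Pr => e e0.
have [pi [a [cpl ca aW]]] := wasserstein_approx (model_Pp H t0) nuP (divr_gt0 e0 l0).
apply: le_trans (gain_coupling l0 (And3 nuP cpl ca)) _.
rewrite -addrA lerD2l; have := ler_wpM2l (ltW l0) aW.
by rewrite mulrDr mulrCA divff ?mulr1// lt0r_neq0.
Qed.

(** Weak duality: a minorant of the penalty replaces it by a multiple of the
    transport cost, and the displacements may then be optimised pointwise. *)
Lemma I_weak k D : 0 < t -> minorant p phi k D ->
  I t u x <= t * D + T t (Q (rate p c k t) u) x.
Proof.
move=> tp kD; apply: I_lub => nu nuP.
have [k0 _] := kD; have := gain_weak nuP (rate_gt0 p c k0 tp).
have := phi_time_minorant tp kD (wasserstein_ge0 (mu t) nu).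
case: (phi_time _ _ _ _) => [a| |] //; last by rewrite addey ?leey.
by rewrite -EFinD !lee_fin; lra.
Qed.

(** The pointwise optimisation loses nothing: move each point by a nearly optimal
    displacement, chosen measurably in a countable dense set. *)
Lemma gain_selection l e : 0 < l -> 0 < e -> exists nu pi a, coupled nu pi a /\
  T t (Q l u) x - e <= gain nu - l * a.
Proof.
move=> l0 e0; have QC := sup_conv_Cb p0 l0 uC.
have [M M0 uM] := Cb_bounded uC.
have QM := sup_conv_bound p0 (ltW l0) uM.
have [z zP] := dense_sequence_norm (model_separable H).
pose A n := [set y : borel X | Q l u (psi t x + (y : X)) - e <=
  u (psi t x + (y : X) + z n) - l * `|z n| `^ p].
have uzC n : Cb K (fun y => u (y + z n)).
  have /CbP[N uN] := uC; apply/CbP; exists N => r e' e'0.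
  have [w [wL wN uw]] := uN (r + `|z n|) e' e'0.
  exists (fun y => w (y + z n)); split=> //.
    have /LipbP[L [N' [[L0 wL'] wN']]] := wL; apply/LipbP; exists L, N'.
    split=> //; split=> // a b; apply: le_trans (wL' _ _) _.
    by rewrite (_ : a + z n - (b + z n) = a - b)// opprD addrACA subrr addr0.
  by move=> y yr; apply: uw; rewrite (le_trans (ler_normD _ _))// lerD2r.
have mA n : measurable (A n).
  pose g (y : borel X) := u (psi t x + (y : X) + z n) - Q l u (psi t x + (y : X)).
  have mg : measurable_fun setT g.
    apply: measurable_funB; last exact: (measurable_shift H).
    exact: (measurable_shift H (psi t x) (uzC n)).
  rewrite (_ : A n = g @^-1` `[l * `|z n| `^ p - e, +oo[); last first.
    by apply/seteqP; split => y /=; rewrite /A /g /= in_itv/= andbT; lra.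
  by rewrite -[X in measurable X]setTI; apply: mg.
have Ay y : exists n, A n y.
  pose q := psi t x + (y : X).
  have [_ [d _ <-] dQ] : exists2 a, [set u (q + d) - l * `|d| `^ p | d in setT] a &
      Q l u q - e / 2 < a.
    apply: sup_adherent; first by rewrite divr_gt0.
    split; first by exists (u (q + 0) - l * `|0 : X| `^ p), 0.
    exists M => _ [d _ <-]; rewrite lerBlDr (le_trans (ler_norm _))//.
    by rewrite (le_trans (uM _))// lerDl mulr_ge0 ?powR_ge0// ltW.
  have e20 : 0 < e / 2 by rewrite divr_gt0.
  have [b b0 ub] := Cb_unif K1 (`|q| + `|d|) uC e20.
  have [n [dz zd]] := zP d b b0; exists n; rewrite /A /= -/q.
  have : l * `|z n| `^ p <= l * `|d| `^ p.
    by rewrite ler_pM2l//; apply: ge0_ler_powR => //; rewrite ?nnegrE// ltW.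
  have : `|u (q + d) - u (q + z n)| <= e / 2.
    apply: ub.
    - exact: ler_normD.
    - by rewrite (le_trans (ler_normD _ _))// lerD2l.
    - by rewrite opprD addrACA subrr add0r.
  by rewrite ler_norml => /andP[? ?]; move: dQ; lra.
have [i [mi Ai]] := measurable_selection mA Ay.
pose s (y : borel X) : borel X := (y : X) + z (i y).
have ms : measurable_fun setT s.
  apply: (measurable_piecewise (f := fun n (y : borel X) => ((y : X) + z n : borel X))) => // n.
  apply: (@continuous_measurable_endo _ _ (fun y => y + z n)) => y.
  by apply: cvgD; [exact: cvg_id|exact: cvg_cst].
have mid : measurable_fun setT (fun y : borel X => y) by exact: measurable_id.
have mpair := measurable_fun_pair mid ms.
have [nu nuE] := pushforward_probability (mu t) ms.
have [pi piE] := pushforward_probability (mu t) mpair.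
have mzi : measurable_fun setT (fun y : borel X => `|z (i y)| `^ p).
  exact: (measurable_piecewise (f := fun n _ => `|z n| `^ p)).
have zi_bound y : `|(`|z (i y)| `^ p)| <= (2 * M + e) / l.
  rewrite ger0_norm ?powR_ge0// ler_pdivlMr// mulrC.
  have := Ai y; rewrite /A /=; have := uM (psi t x + (y : X) + z (i y)).
  by have := QM (psi t x + (y : X)); rewrite !ler_norml => /andP[? ?] /andP[? ?]; lra.
have zi_int := @bounded_integrable _ _ _ (mu t) _ _ mzi zi_bound.
have mnu : Pp p nu.
  rewrite /Pp /= (ge0_transfer ms (fun A _ => esym (nuE A)) (measurable_normX p)
    (fun y => powR_ge0 _ _)).
  have /integrableP[_] := expect_integrable_lin (2 `^ p) (2 `^ p)
    (moment_integrable H t0) zi_int.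
  apply: le_lt_trans; apply: ge0_le_integral => //.
  - apply/measurable_EFinP; exact: (measurableT_comp (measurable_normX p) ms).
  - apply/measurable_EFinP; apply: measurableT_comp => //.
    by apply: measurable_funD; apply: measurable_funM => //; exact: measurable_normX.
  move=> y _ /=; rewrite lee_fin -mulrDr ger0_norm; last first.
    by rewrite mulr_ge0 ?addr_ge0 ?powR_ge0.
  apply: le_trans (powRD_le (normr_ge0 _) (normr_ge0 _)).
  apply: ge0_ler_powR; rewrite ?nnegrE ?addr_ge0 ?(ltW p0)//; exact: ler_normD.
have costE : cost pi = (\int[mu t]_y (`|z (i y)| `^ p)%:E)%E.
  rewrite /cost (ge0_transfer mpair (fun A _ => esym (piE A)) measurable_cost
    (fun y => powR_ge0 _ _)).
  by apply: eq_integral => y _ /=; rewrite /s opprD addNKr normrN.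
exists nu, pi, (\int[mu t]_y (`|z (i y)| `^ p)); split.
  split=> //.
    by move=> B mB; rewrite !piE nuE.
  by rewrite costE /Rintegral fineK//; exact: integrable_fin_num zi_int.
rewrite /gain (expect_transfer ms (fun A _ => esym (nuE A))
  (measurable_shift H (psi t x) uC) (fun z => uM _)).
rewrite /ref_op.
have us_int : (mu t).-integrable setT (EFin \o (fun y : borel X => u (psi t x + (s y : X)))).
  apply: (@bounded_integrable _ _ _ _ _ M) => //.
  exact: (measurableT_comp (measurable_shift H (psi t x) uC) ms).
have Qint := shift_integrable H (mu t) (psi t x) QC.
have one_int : (mu t).-integrable setT (EFin \o (fun _ : borel X => 1%R)).
  by apply: (@bounded_integrable _ _ _ _ _ `|1|) => //; exact: measurable_cst.
set IQ := Rintegral _ _ _; set Iu := Rintegral _ _ _; set Iz := Rintegral _ _ _.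
have -> : IQ - e = 1 * IQ + (- e) * \int[mu t]_y 1 by rewrite expect_cst; lra.
have -> : Iu - l * Iz = 1 * Iu + (- l) * Iz by lra.
rewrite /IQ /Iu /Iz -!expect_lin//; apply: le_Rintegral => //.
- exact: expect_integrable_lin.
- exact: expect_integrable_lin.
move=> y _; have := Ai y; rewrite /A /s /= addrA.
lra.
Qed.

(** Gain and transport cost are affine in the coupling, so the pairs that
    couplings realise form a convex set, and strong duality in dimension one
    applies to it. The relaxed problem it yields is the sup-convolution by the
    selection argument. *)
Lemma I_strong e : 0 < t -> 0 < e -> exists k D, minorant p phi k D /\
  t * D + T t (Q (rate p c k t) u) x <= I t u x + e.
Proof.
move=> tp e0; have [M M0 uM] := Cb_bounded uC.
have et0 : 0 < e / 2 / t by rewrite !divr_gt0.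
pose b := expR (- (c * t)) / t; have b0 : 0 < b by rewrite divr_gt0 ?expR_gt0.
have bp0 : 0 < b `^ p by rewrite powR_gt0.
pose C r f := exists nu pi a, [/\ coupled nu pi a, r = b `^ p * a & f = gain nu / t].
have coupled_ge0 nu pi a : coupled nu pi a -> 0 <= a.
  by move=> [_ _ ca]; rewrite -lee_fin -ca cost_ge0.
have C0 : C 0 (gain (mu t) / t).
  have [pi cpl cpi] := diagonal_coupling (mu t).
  exists (mu t), pi, 0; split=> //; last by rewrite mulr0.
  by split=> //; exact: model_Pp H _ t0.
have C_cost r f : C r f -> 0 <= r.
  by move=> [nu [pi [a [/coupled_ge0 a0 -> _]]]]; rewrite mulr_ge0// ltW.
have C_growth r f : C r f -> f <= M / t * (1 + r).
  move=> Crf; have r0 := C_cost _ _ Crf; move: Crf => [nu [pi [a [_ _ ->]]]].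
  rewrite mulrAC ler_pM2r ?invr_gt0//.
  rewrite (le_trans (ler_norm _))// (le_trans (gain_bound nu uM))//.
  by rewrite ler_peMr// lerDl.
have C_convex r f r' f' l : C r f -> C r' f' -> 0 <= l -> l <= 1 ->
    C (l * r + (1 - l) * r') (l * f + (1 - l) * f').
  move=> [nu [pi [a [[nuP cpl ca] -> ->]]]] [nu' [pi' [a' [[nuP' cpl' ca'] -> ->]]]] l0 l1.
  have l01 : 0 <= l <= 1 by rewrite l0.
  have [nu2 [nu2E nu2i nu2b]] := mixture nu nu' l01.
  have [pi2 [pi2E pi2i pi2b]] := mixture pi pi' l01.
  exists nu2, pi2, (l * a + (1 - l) * a'); split.
  - split.
    + rewrite /Pp /= nu2i; last 2 first.
      * by apply/measurable_EFinP; exact: measurable_normX.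
      * by move=> y; rewrite lee_fin powR_ge0.
      by rewrite lte_add_pinfty// lte_mul_pinfty ?lee_fin// subr_ge0.
    + move=> A mA.
      have m1 : measurable (fst @^-1` A : set (borel X * borel X)%type).
        by rewrite -[X in measurable X]setTI; exact: fst_measurable.
      have m2 : measurable (snd @^-1` A : set (borel X * borel X)%type).
        by rewrite -[X in measurable X]setTI; exact: snd_measurable.
      rewrite !pi2E// nu2E// (cpl A mA).1 (cpl' A mA).1 (cpl A mA).2 (cpl' A mA).2.
      split=> //; rewrite -(fineK (fin_num_measure (mu t) A mA)).
      by rewrite -!EFinM -EFinD -mulrDl addrC subrK mul1r.
    + rewrite /cost pi2i; last 2 first.
      * by apply/measurable_EFinP; exact: measurable_cost.
      * by move=> y; rewrite lee_fin powR_ge0.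
      by rewrite -!/(cost _) ca ca'.
  - by rewrite mulrDr !(mulrCA (b `^ p)).
  - by rewrite /gain (nu2b _ M (measurable_shift H _ uC) (fun z => uM _)) [RHS]mulrDl !mulrA.
have C_value r f : C r f -> (f%:E <= (I t u x / t)%:E + phi (r `^ p^-1))%E.
  move=> [nu [pi [a [cpd -> ->]]]]; have a0 := coupled_ge0 _ _ _ cpd.
  move: cpd => [nuP cpl ca]; have := I_ub nuP; rewrite phi_time_gt0//.
  have Wa : expR (- (c * t)) * W (mu t) nu / t <= (b `^ p * a) `^ p^-1.
    rewrite powRM ?powR_ge0// (powRVK p0) ?(ltW b0)// mulrAC ler_pM2l//.
    rewrite -(powRVK p0 (wasserstein_ge0 (mu t) nu)).
    apply: ge0_ler_powR; rewrite ?nnegrE ?powR_ge0// ?invr_ge0 ?(ltW p0)//.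
    exact: wasserstein_cost (model_Pp H t0) nuP cpl ca.
  have W0 : 0 <= expR (- (c * t)) * W (mu t) nu / t.
    by rewrite divr_ge0 ?mulr_ge0 ?expR_ge0 ?wasserstein_ge0.
  have := pen_homo P W0 Wa; have := pen_ge0 P W0.
  case: (phi (expR _ * _ / _)) => [g| |] // _; last first.
    by rewrite leye_eq => /eqP ->; rewrite addey ?leey.
  case: (phi (_ `^ p^-1)) => [g'| |] //; last by rewrite addey ?leey.
  move=> gg h; have {}gg : g <= g' by rewrite -lee_fin.
  have {}h : gain nu <= I t u x + t * g by rewrite -lee_fin.
  rewrite -EFinD lee_fin ler_pdivrMr// mulrDl divfK ?(gt_eqF tp)//.
  by apply: le_trans h _; rewrite lerD2l mulrC ler_pM2r.
have C_cont e' : 0 < e' -> exists2 d, 0 < d &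
    forall r f, C r f -> r <= d -> f <= I t u x / t + e'.
  move=> e'0; have et : 0 < e' * t / 3 by rewrite divr_gt0// mulr_gt0.
  have tT : tight K [set P | P = T t].
    by apply: tight_sub (ref_tight H t) => _ ->; exists t.
  have [rho rhoP] := tT M `|x| _ et.
  have [l1 l10 l1P] := sup_conv_near_id p0 K1 rho uC et.
  have QT : T t (Q l1 u) x <= T t u x + e' * t / 3 + e' * t / 3.
    apply: (rhoP (T t) (Q l1 u) u) => //.
    - exact: sup_conv_Cb.
    - exact: ltW.
    - by apply: sup_conv_bound => //; exact: ltW.
    - by move=> y yr; apply: l1P.
  (* a small transport cost can only pay for a gain close to the reference *)
  exists (b `^ p * (e' * t / 3 / l1)) => [|r f [nu [pi [a [cpd -> ->]]]]].
    by rewrite mulr_gt0// divr_gt0.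
  rewrite ler_pM2l// => al; rewrite ler_pdivrMr// mulrDl divfK ?(gt_eqF tp)//.
  have := gain_coupling l10 cpd; have := I_ge_ref.
  by rewrite ler_pdivlMr// mulrC in al; move: QT al; lra.
have [k [D [kD kP]]] := fenchel_duality p1 P C0 C_cost C_growth C_convex C_value
  C_cont et0.
exists k, D; split=> //; have [k0 _] := kD.
have e20 : 0 < e / 2 by rewrite divr_gt0.
have [nu [pi [a [cpd sel]]]] := gain_selection (rate_gt0 p c k0 tp) e20.
have := kP (b `^ p * a) (gain nu / t).
move=> /(_ (ex_intro _ nu (ex_intro _ pi (ex_intro _ a (And3 cpd erefl erefl))))).
move=> /(ler_wpM2l (ltW tp)).
have -> : t * (D + gain nu / t - k * (b `^ p * a)) =
    t * D + gain nu - rate p c k t * a.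
  by rewrite rateE// -/b; field; exact: lt0r_neq0.
have -> : t * (I t u x / t + e / 2 / t) = I t u x + e / 2.
  by field; exact: lt0r_neq0.
by move: sel; lra.
Qed.

End Step.

End Duality.


(** * Operators between the reference semigroup and the one-step operator *)

Section Admissible.
Context {R : realType} {X : normedModType R} {K : {linear X -> X}} {p c : R}
  {mu : R -> probability (borel X) R} {psi : R -> X -> X} {phi : R -> \bar R}.
Context (H : model K p c mu psi phi).
Local Notation T := (ref_op mu psi).
Local Notation Q := (sup_conv p).
Local Notation I := (I_op p c phi mu psi).
Implicit Types (u v w : X -> R) (l M L r e t s h : R) (x y z : X).

Let p1 : 1 < p. Proof. exact: model_p_gt1 H. Qed.
Let p0 : 0 < p. Proof. exact: lt_trans ltr01 p1. Qed.
Let c0 : 0 <= c. Proof. exact: model_c_ge0 H. Qed.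
Let K1 := model_contr H.

Lemma I_compare u v t x y (a : R) : Cb K u -> Cb K v -> 0 <= t ->
  (forall z, u (psi t x + z) <= v (psi t y + z) + a) -> I t u x <= I t v y + a.
Proof.
move=> uC vC t0 uv; apply: (I_lub H uC t0) => nu nuP.
have gg : gain (u := u) (t := t) (x := x) (psi := psi) nu <=
    gain (u := v) (t := t) (x := y) (psi := psi) nu + a.
  rewrite /gain -[X in _ + X](expect_cst nu) -[X in X + _]mul1r.
  rewrite -[X in _ + X]mul1r -expect_lin; last 2 first.
  - exact: (shift_integrable H).
  - by apply: (@bounded_integrable _ _ _ _ _ `|a|) => //; exact: measurable_cst.
  apply: le_Rintegral => //; first exact: (shift_integrable H).
    apply: expect_integrable_lin; first exact: (shift_integrable H).
    by apply: (@bounded_integrable _ _ _ _ _ `|a|) => //; exact: measurable_cst.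
  by move=> z _; have := uv z; lra.
have := I_ub H vC t0 nuP (x := y).
case: (phi_time _ _ _ _) => [b| |] //; last by rewrite addey ?leey.
by rewrite -!EFinD !lee_fin; lra.
Qed.

Lemma I0 u x : Cb K u -> I 0 u x = u x.
Proof.
move=> uC; apply/eqP; rewrite eq_le; apply/andP; split; last first.
  by rewrite -{1}(ref0 H uC); exact: (I_ge_ref H uC (lexx 0)).
apply/ler_addgt0Pr => e e0.
have [l l0 lP] := sup_conv_near_id p0 K1 `|x| uC e0.
apply: (I_lub H uC (lexx 0)) => nu nuP.
have QC := sup_conv_Cb p0 l0 uC.
have := gain_weak H uC (lexx 0) nuP l0 (x := x).
rewrite (ref0 H QC) /phi_time eqxx; case: ifPn => [/eqP ->|_]; last first.
  by rewrite addey ?leey.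
rewrite powR0 ?lt0r_neq0// mulr0 addr0 adde0 lee_fin => /le_trans; apply.
exact: lP.
Qed.

Lemma I_mono t u v x : 0 <= t -> Cb K u -> Cb K v -> (forall x, u x <= v x) ->
  I t u x <= I t v x.
Proof.
by move=> t0 uC vC uv; rewrite -[leRHS]addr0; apply: I_compare => // z;
  rewrite addr0.
Qed.

Lemma I_cst t (m : R) x : 0 <= t -> I t (cst m) x = m.
Proof.
move=> t0; have mC := Cb_cst K m; apply/eqP; rewrite eq_le; apply/andP; split.
  apply: (I_lub H mC t0) => nu nuP; rewrite /gain expect_cst leeDl//.
  by apply: (phi_time_ge0 H t0); exact: wasserstein_ge0.
by rewrite -{1}(ref_cst (mu := mu) (psi := psi) t m x); exact: (I_ge_ref H mC t0).
Qed.

Lemma I_convex t u v l x : 0 <= t -> Cb K u -> Cb K v -> 0 <= l -> l <= 1 ->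
  I t (fun y => l * u y + (1 - l) * v y) x <= l * I t u x + (1 - l) * I t v x.
Proof.
move=> t0 uC vC l0 l1; have wC := Cb_lin l (1 - l) uC vC.
apply: (I_lub H wC t0) => nu nuP.
rewrite /gain expect_lin; [|exact: (shift_integrable H)|exact: (shift_integrable H)].
have := I_ub H uC t0 nuP (x := x); have := I_ub H vC t0 nuP (x := x).
rewrite /gain; case: (phi_time _ _ _ _) => [b| |] //; last by rewrite addey ?leey.
rewrite -!EFinD !lee_fin => vb ub.
have := ler_wpM2l l0 ub; have l10 : 0 <= 1 - l by rewrite subr_ge0.
have := ler_wpM2l l10 vb; lra.
Qed.

Lemma I_Lip t u L : 0 <= t -> Cb K u -> is_Lip_bound K u L ->
  is_Lip_bound K (I t u) (expR (c * t) * L).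
Proof.
move=> t0 uC [L0 uL]; split; first by rewrite mulr_ge0// expR_ge0.
suff I1 x y : I t u x <= I t u y + expR (c * t) * L * `|K (x - y)|.
  move=> x y; rewrite ler_norml; have := I1 x y; have := I1 y x.
  rewrite -[y - x]opprB linearN normrN => ? ?; apply/andP; split; lra.
apply: I_compare => // z.
rewrite -lerBlDl (le_trans (ler_norm _))// (le_trans (uL _ _))//.
rewrite (mulrC (expR _)) -mulrA ler_wpM2l// (_ : _ - _ = psi t x - psi t y).
  exact: (psi_K_lip H).
by rewrite opprD addrACA subrr addr0.
Qed.

(** One choice of slope bounds the one-step operators for all times up to [s],
    zero included. *)
Lemma I_weak_uniform s : exists2 l, 0 < l & exists2 C, 0 <= C &
  forall t u x, 0 <= t -> t <= s -> Cb K u -> I t u x <= C + T t (Q l u) x.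
Proof.
have [k [D kD]] := minorant_exists p1 (model_phi H).
have D0 := minorant_D_ge0 p1 (model_phi H) kD; have [k0 _] := kD.
pose s' := Num.max s 1; have s'0 : 0 < s' by rewrite lt_max ltr01 orbT.
exists (rate p c k s'); first exact: rate_gt0.
exists (s' * D); first by rewrite mulr_ge0// ltW.
move=> t u x t0 ts uC; have ls := rate_gt0 p c k0 s'0.
have [M M0 uM] := Cb_bounded uC.
move: (t0); rewrite le_eqVlt => /predU1P[<-|tp].
  rewrite I0// (ref0 H (sup_conv_Cb p0 ls uC)).
  have := sup_conv_ge p0 x (ltW ls) uM; have := mulr_ge0 (ltW s'0) D0; lra.
have ts' : t <= s' by rewrite le_max ts.
have lt := rate_gt0 p c k0 tp.
apply: le_trans (I_weak H uC t0 tp kD) _.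
apply: lerD; first exact: ler_wpM2r.
apply: (ref_le H x t0); [exact: sup_conv_Cb|exact: sup_conv_Cb|move=> y].
apply: (sup_conv_le) => z; have := sup_conv_ub y z (ltW ls) uM (p := p).
apply: le_trans; rewrite lerD2l lerN2 ler_wpM2r ?powR_ge0//.
rewrite /rate; apply: ler_pM; rewrite ?powR_ge0 ?mulr_ge0 ?expR_ge0 ?(ltW k0)//.
  by rewrite ler_pM2l// ler_expR lerN2 ler_wpM2l// mulr_ge0// ltW.
rewrite -opprB !powRN lef_pV2 ?posrE ?powR_gt0//.
by apply: ge0_ler_powR; rewrite ?nnegrE ?subr_ge0// ltW.
Qed.

(** The one-step operators, their compositions and the limit semigroup all share
    these properties, and everything about continuity is derived from them. *)
Record admissible t (P : (X -> R) -> X -> R) : Prop := Admissible {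
  adm_convex : forall u v l x, Cb K u -> Cb K v -> 0 <= l -> l <= 1 ->
    P (fun y => l * u y + (1 - l) * v y) x <= l * P u x + (1 - l) * P v x;
  adm_mono : forall u v x, Cb K u -> Cb K v -> (forall x, u x <= v x) ->
    P u x <= P v x;
  adm_cst : forall (m : R) x, P (cst m) x = m;
  adm_Lip : forall u L, Cb K u -> is_Lip_bound K u L ->
    is_Lip_bound K (P u) (expR (c * t) * L);
  adm_ge : forall u x, Cb K u -> T t u x <= P u x;
  adm_le : forall u x, Cb K u -> P u x <= I t u x
}.

Lemma adm_I t : 0 <= t -> admissible t (I t).
Proof.
move=> t0; split=> //.
- by move=> u v l x uC vC l0 l1; exact: I_convex.
- by move=> u v x uC vC; exact: I_mono.
- by move=> m x; exact: I_cst.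
- by move=> u L; exact: I_Lip.
- by move=> u x uC; exact: (I_ge_ref H uC t0).
Qed.

Lemma adm_bound t P u M : admissible t P -> Cb K u -> (forall x, `|u x| <= M) ->
  forall x, `|P u x| <= M.
Proof.
move=> aP uC uM x; rewrite ler_norml; apply/andP; split.
- rewrite -(adm_cst aP (- M) x); apply: (adm_mono aP) => //; first exact: Cb_cst.
  by move=> y; have := uM y; rewrite ler_norml => /andP[].
- rewrite -(adm_cst aP M x); apply: (adm_mono aP) => //; first exact: Cb_cst.
  by move=> y; have := uM y; rewrite ler_norml => /andP[].
Qed.

(** Convexity reduces continuity to an upper bound: write [v] as
    [(1 - a) w + a f] with [f = w + (v - w) / a]; where [v <= w + d], [f] is at
    most [M + d / a], and the upper bound for [P f] comes from weak duality. *)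
Lemma adm_tight s : tight K [set P | exists t, [/\ 0 <= t, t <= s & admissible t P]].
Proof.
have [l l0 [C C0 IC]] := I_weak_uniform s.
move=> M r e e0; pose N := `|M|; have N0 : 0 <= N := normr_ge0 _.
pose C1 := C + 2 * N + 1; have C10 : 0 < C1 by rewrite ltr_wpDl// addr_ge0// mulr_ge0.
pose a := Num.min 1 (e / C1).
have a0 : 0 < a by rewrite lt_min ltr01 divr_gt0.
have a1 : a <= 1 by rewrite ge_min lexx.
have aC : a * C1 <= e by rewrite -ler_pdivlMr// ge_min lexx orbT.
pose B := N + 2 * N / a; have NB : N <= B by rewrite lerDl divr_ge0 ?mulr_ge0// ltW.
have [rho1 r1P] := ref_tight H s B r (divr_gt0 ltr01 (ltr0Sn _ 1)).
have [rho r2P] := @sup_conv_tight _ _ K p p0 l l0 B rho1 _ (divr_gt0 ltr01 (ltr0Sn _ 1)).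
exists rho => P v w d [t [t0 ts aP]] vC wC d0 vM wM vw x xr.
have vN y : `|v y| <= N by apply: le_trans (vM y) (ler_norm _).
have wN y : `|w y| <= N by apply: le_trans (wM y) (ler_norm _).
pose f y := (1 - a^-1) * w y + a^-1 * v y.
have fC : Cb K f by exact: Cb_lin.
have fE y : f y = w y + (v y - w y) / a by rewrite /f; ring.
have da : 0 <= d / a by rewrite divr_ge0// ltW.
have fB y : `|f y| <= B.
  rewrite fE (le_trans (ler_normD _ _))// lerD// normrM normfV (gtr0_norm a0).
  rewrite ler_pM2r ?invr_gt0// (le_trans (ler_normB _ _))//.
  by have := vN y; have := wN y; lra.
have cB (y : X) : `|cst N y| <= B by rewrite ger0_norm.
have QC := sup_conv_Cb p0 l0 fC; have cC := Cb_cst K N.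
have QB := sup_conv_bound p0 (ltW l0) fB.
have Qf y : `|y| <= rho1 -> Q l f y <= cst N y + (d / a + 1 / 2).
  move=> yr; apply: (le_trans (r2P _ f (cst N) (d / a) erefl fC cC da fB cB _ y yr)).
    move=> z zr; rewrite fE; apply: lerD; first exact: le_trans (ler_norm _) (wN z).
    by rewrite ler_pM2r ?invr_gt0// lerBlDl vw.
  rewrite -!addrA lerD2r; apply: (sup_conv_le) => z.
  by rewrite lerBlDr lerDl mulr_ge0 ?powR_ge0// ltW.
have Pf : P f x <= C + (N + d / a + 1).
  apply: le_trans (adm_le aP _ fC) _; apply: le_trans (IC t f x t0 ts fC) _.
  rewrite lerD2l; apply: (le_trans (r1P (T t) _ (cst N) (d / a + 1 / 2) _ QC cC
    _ QB cB Qf x xr)); first by exists t.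
    by rewrite addr_ge0.
  by rewrite ref_cst; lra.
have vE : v = (fun y => (1 - a) * w y + (1 - (1 - a)) * f y).
  by apply/funext => y; rewrite fE; field; exact: lt0r_neq0.
have : P v x <= (1 - a) * P w x + (1 - (1 - a)) * P f x.
  rewrite {1}vE; apply: (adm_convex aP) => //; first by rewrite subr_ge0.
  by rewrite gerBl ltW.
have := adm_bound aP wC wN x; rewrite ler_norml => /andP[Pw _].
have := ler_wpM2l (ltW a0) Pf; have := ler_wpM2l (ltW a0) Pw.
have -> : a * (C + (N + d / a + 1)) = a * (C + N + 1) + d.
  by field; exact: lt0r_neq0.
by move: aC; rewrite /C1; lra.
Qed.

Lemma adm_tight1 t P : 0 <= t -> admissible t P -> tight K [set P].
Proof. by move=> t0 aP; apply: tight_sub (@adm_tight t) => _ ->; exists t. Qed.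

Lemma adm_Cb t P u : 0 <= t -> admissible t P -> Cb K u -> Cb K (P u).
Proof.
move=> t0 aP; apply: tight_Cb; first exact: adm_tight1 aP.
- move=> v vL; have vC := Lipb_Cb vL; have /LipbP[L [M [uL uM]]] := vL.
  apply/Lipb_Cb/LipbP; exists (expR (c * t) * L), M.
  by split; [exact: (adm_Lip aP)|exact: (adm_bound aP)].
- by move=> v M; exact: (adm_bound aP).
Qed.

(** Two steps are dominated by one: the duality formula turns this into the
    semigroup property of the reference and the subadditivity of the penalty. *)
Lemma I_superadditive t s u x : 0 <= t -> 0 <= s -> Cb K u ->
  I t (I s u) x <= I (t + s) u x.
Proof.
move=> t0 s0 uC; have IsC : Cb K (I s u) := adm_Cb s0 (adm_I s0) uC.
move: (t0); rewrite le_eqVlt => /predU1P[<-|tp]; first by rewrite add0r (I0 x IsC).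
move: (s0); rewrite le_eqVlt => /predU1P[<-|sp].
  rewrite addr0 (_ : I 0 u = u)//; apply/funext => y; exact: I0.
apply/ler_addgt0Pr => e e0.
have ts0 : 0 < t + s by rewrite addr_gt0.
have [k [D [kD kP]]] := I_strong H uC (ltW ts0) ts0 e0 (x := x).
apply: le_trans kP; have [k0 _] := kD.
have rt := rate_gt0 p c k0 tp; have rs := rate_gt0 p c k0 sp.
have rts := rate_gt0 p c k0 ts0.
have QsC := sup_conv_Cb p0 rs uC; have TQsC := ref_Cb H s0 QsC.
have QtsC := sup_conv_Cb p0 rts uC.
have [M M0 TQsM] := Cb_bounded TQsC.
apply: le_trans (I_weak H IsC t0 tp kD) _.
rewrite mulrDl -addrA lerD2l (ref_semigroup H x t0 s0 QtsC).
rewrite -(refDr H); last exact: (ref_Cb H).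
apply: (ref_le H x t0).
- exact: sup_conv_Cb.
- by apply: CbDr; exact: (ref_Cb H).
move=> y; apply: (@le_trans _ _ (Q (rate p c k t)
    (fun y => s * D + T s (Q (rate p c k s) u) y) y)).
  have [N N0 NM] := Cb_bounded (CbDr (s * D) TQsC).
  apply: (sup_conv_mono _ (ltW rt) NM) => z.
  exact: (I_weak H uC s0 sp kD).
apply: le_trans (sup_convDr (s * D) y (ltW rt) TQsM) _.
rewrite lerD2l; exact: (sup_conv_semigroup H).
Qed.

Lemma adm_comp t s P P' : 0 <= t -> 0 <= s -> admissible t P -> admissible s P' ->
  admissible (t + s) (P \o P').
Proof.
move=> t0 s0 aP aP'; have P'C u : Cb K u -> Cb K (P' u) by exact: adm_Cb aP'.
have IsC u : Cb K u -> Cb K (I s u) by exact: adm_Cb (adm_I s0).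
split=> /=.
- move=> u v l x uC vC l0 l1; have wC := Cb_lin l (1 - l) uC vC.
  apply: le_trans (adm_convex aP x (P'C _ uC) (P'C _ vC) l0 l1).
  apply: (adm_mono aP); [exact: P'C|apply: Cb_lin; exact: P'C|move=> y].
  exact: (adm_convex aP').
- move=> u v x uC vC uv; apply: (adm_mono aP); [exact: P'C|exact: P'C|move=> y].
  exact: (adm_mono aP').
- move=> m x; rewrite (_ : P' (cst m) = cst m) ?(adm_cst aP)//.
  by apply/funext => y; exact: (adm_cst aP').
- move=> u L uC uL; rewrite mulrDr expRD -mulrA; apply: (adm_Lip aP); first exact: P'C.
  exact: (adm_Lip aP').
- move=> u x uC; rewrite (ref_semigroup H)//.
  apply: le_trans (ref_le H x t0 (ref_Cb H s0 uC) (P'C _ uC) _) (adm_ge aP _ (P'C _ uC)).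
  by move=> y; exact: (adm_ge aP').
- move=> u x uC; apply: le_trans (adm_le aP _ (P'C _ uC)) _.
  apply: le_trans (I_superadditive _ t0 s0 uC).
  by apply: I_mono; [|exact: P'C|exact: IsC|move=> y; exact: (adm_le aP')].
Qed.

Lemma adm_inf t (P_ : nat -> (X -> R) -> X -> R) : (forall n, admissible t (P_ n)) ->
  (forall n u x, Cb K u -> P_ n.+1 u x <= P_ n u x) ->
  admissible t (fun u x => inf (range (fun n => P_ n u x))).
Proof.
move=> aP Pdec.
have P_le m n u x : Cb K u -> (m <= n)%N -> P_ n u x <= P_ m u x.
  move=> uC; elim: n => [|n IH]; first by rewrite leqn0 => /eqP ->.
  rewrite leq_eqVlt => /predU1P[->//|]; rewrite ltnS => /IH.
  by apply: le_trans; exact: Pdec.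
have infle u x n : Cb K u -> inf (range (fun n => P_ n u x)) <= P_ n u x.
  move=> uC; apply: ge_inf; last by exists n.
  have [M M0 uM] := Cb_bounded uC; exists (- M) => _ [k _ <-].
  by have := adm_bound (aP k) uC uM x; rewrite ler_norml => /andP[].
have infge u x (b : R) : (forall n, b <= P_ n u x) -> b <= inf (range (fun n => P_ n u x)).
  by move=> bP; apply: lb_le_inf; [exists (P_ 0%N u x), 0%N|move=> _ [n _ <-]].
have infapp u x e : Cb K u -> 0 < e -> exists n, forall m, (n <= m)%N ->
    P_ m u x <= inf (range (fun n => P_ n u x)) + e.
  move=> uC e0.
  have [|_ [n _ <-] ne] := @inf_adherent _ (range (fun n => P_ n u x)) e e0.
    split; first by exists (P_ 0%N u x), 0%N.
    have [M M0 uM] := Cb_bounded uC; exists (- M) => _ [k _ <-].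
    by have := adm_bound (aP k) uC uM x; rewrite ler_norml => /andP[].
  by exists n => m nm; apply: le_trans (P_le _ _ _ _ uC nm) (ltW ne).
split.
- move=> u v l x uC vC l0 l1; apply/ler_addgt0Pr => e e0.
  have [n nP] := infapp u x e uC e0; have [m mP] := infapp v x e vC e0.
  have wC := Cb_lin l (1 - l) uC vC.
  apply: le_trans (infle _ x (maxn n m) wC) _.
  apply: le_trans (adm_convex (aP _) x uC vC l0 l1) _.
  have := ler_wpM2l l0 (nP _ (leq_maxl n m)).
  have l10 : 0 <= 1 - l by rewrite subr_ge0.
  by have := ler_wpM2l l10 (mP _ (leq_maxr n m)); lra.
- move=> u v x uC vC uv; apply: infge => n.
  by apply: le_trans (infle _ _ n uC) _; exact: (adm_mono (aP n)).
- move=> m x; rewrite (_ : [set P_ i (cst m) x | i in setT] = [set m]) ?inf1//.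
  apply/seteqP; split => [_ [n _ <-]|_ ->]; first exact: (adm_cst (aP n)).
  by exists 0%N => //; exact: (adm_cst (aP 0%N)).
- move=> u L uC uL; have [L0 _] := uL; split; first by rewrite mulr_ge0// expR_ge0.
  suff I1 x y : inf (range (fun n => P_ n u x)) <=
      inf (range (fun n => P_ n u y)) + expR (c * t) * L * `|K (x - y)|.
    move=> x y; rewrite ler_norml; have := I1 x y; have := I1 y x.
    rewrite -[y - x]opprB linearN normrN => ? ?; apply/andP; split; lra.
  rewrite -lerBlDr; apply: infge => n; have := infle u x n uC.
  have [_ /(_ x y)] := adm_Lip (aP n) uC uL; rewrite ler_norml => /andP[_]; lra.
- by move=> u x uC; apply: infge => n; exact: (adm_ge (aP n)).
- by move=> u x uC; apply: le_trans (infle _ _ 0%N uC) _; exact: (adm_le (aP 0%N)).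
Qed.

Lemma rate_large k l : 0 < k -> exists2 h0, 0 < h0 &
  forall t, 0 < t -> t <= h0 -> l <= rate p c k t.
Proof.
move=> k0; have p10 : 0 < p - 1 by rewrite subr_gt0.
pose b := k * expR (- (p * c)); have b0 : 0 < b by rewrite mulr_gt0// expR_gt0.
pose l' := Num.max l 1; have l'0 : 0 < l' by rewrite lt_max ltr01 orbT.
have bl : 0 <= b / l' by rewrite divr_ge0// ltW.
exists (Num.min 1 ((b / l') `^ (p - 1)^-1)).
  by rewrite lt_min ltr01 powR_gt0// divr_gt0.
move=> t t0; rewrite le_min => /andP[t1 tb].
apply: (@le_trans _ _ l'); first by rewrite le_max lexx.
apply: (@le_trans _ _ (b * t `^ (1 - p))); last first.
  rewrite /rate ler_pM2r ?powR_gt0// ler_pM2l// ler_expR lerN2.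
  by rewrite ler_piMr// mulr_ge0// ltW.
rewrite -opprB powRN ler_pdivlMr ?powR_gt0// mulrC -ler_pdivlMr//.
rewrite -[leRHS](powRKV p10 bl).
by apply: ge0_ler_powR; rewrite ?nnegrE ?powR_ge0 ?(ltW p10) ?(ltW t0).
Qed.

(** Squeeze between the reference semigroup and the weak duality bound, whose
    price per displacement becomes infinite as the time tends to zero. *)
Lemma adm_near_id u r e : Cb K u -> 0 < e -> exists2 h0, 0 < h0 &
  forall t P, 0 <= t -> t <= h0 -> admissible t P ->
  forall x, `|x| <= r -> `|P u x - u x| <= e.
Proof.
move=> uC e0; have e40 : 0 < e / 4 by rewrite divr_gt0.
have [k [D kD]] := minorant_exists p1 (model_phi H); have [k0 _] := kD.
have D0 := minorant_D_ge0 p1 (model_phi H) kD.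
have [M M0 uM] := Cb_bounded uC.
have [rho rhoP] := ref_tight H 1 M r e40.
have [l l0 lP] := sup_conv_near_id p0 K1 rho uC e40.
have [h1 h10 h1P] := rate_large l k0.
have [h2 h20 h2P] := ref_near_id H r uC e40.
have D10 : 0 < D + 1 by rewrite ltr_wpDl.
pose h0 := Num.min (Num.min 1 (e / 4 / (D + 1))) (Num.min h1 h2).
exists h0; first by rewrite !lt_min ltr01 divr_gt0// h10.
move=> t P t0; rewrite !le_min => /andP[/andP[t1 tD] /andP[th1 th2]] aP x xr.
have := h2P t t0 th2 x xr; rewrite !ler_norml => /andP[Tl Tu].
have := adm_ge aP x uC => TP.
suff Iu : I t u x <= u x + e.
  by have := adm_le aP x uC; move=> PI; apply/andP; split; lra.
move: (t0); rewrite le_eqVlt => /predU1P[<-|tp]; first by rewrite I0// lerDl ltW.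
have lt := h1P t tp th1; have rt : 0 < rate p c k t := lt_le_trans l0 lt.
have QC := sup_conv_Cb p0 rt uC.
have QT : T t (Q (rate p c k t) u) x <= T t u x + e / 4 + e / 4.
  apply: (rhoP (T t)) => //.
  - by exists t.
  - exact: ltW.
  - exact: sup_conv_bound (ltW rt) uM.
  - by move=> y yr; exact: lP.
have tDe : t * D <= e / 4.
  apply: (@le_trans _ _ (e / 4 / (D + 1) * D)); first exact: ler_wpM2r.
  by rewrite mulrAC ler_pdivrMr// ler_pM2l// lerDl.
apply: le_trans (I_weak H uC t0 tp kD) _; move: QT tDe Tu; lra.
Qed.

Lemma adm_iter h s P P' (k : nat) : 0 <= h -> 0 <= s -> admissible h P ->
  admissible s P' -> admissible (k%:R * h + s) (fun u => iter k P (P' u)).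
Proof.
move=> h0 s0 aP aP'; elim: k => [|k IH] /=; first by rewrite mul0r add0r.
rewrite -nat1r mulrDl mul1r -addrA.
apply: (adm_comp (P := P) (P' := fun u => iter k P (P' u))) => //.
by rewrite addr_ge0// mulr_ge0.
Qed.

End Admissible.


(** * The limit semigroup *)

(** A Dini theorem: [K] maps balls to compact sets, and the functions depend on
    [K x] only, with a common modulus. *)
Lemma dini {R : realType} {X : normedModType R} {K : {linear X -> X}}
    (f_ : nat -> X -> R) (f : X -> R) (L r e : R) :
  (forall r : R, 0 <= r -> compact (K @` nball r)) ->
  (forall n, is_Lip_bound K (f_ n) L) -> is_Lip_bound K f L ->
  (forall n x, f_ n.+1 x <= f_ n x) ->
  (forall x e, 0 < e -> exists n, f_ n x <= f x + e) -> 0 < e ->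
  exists N, forall n, (N <= n)%N -> forall x, `|x| <= r -> f_ n x <= f x + e.
Proof.
move=> Kc fnL fL fdec fcv e0; have [L0 fL'] := fL.
have f_le m n x : (m <= n)%N -> f_ n x <= f_ m x.
  elim: n => [|n IH]; first by rewrite leqn0 => /eqP ->.
  rewrite leq_eqVlt => /predU1P[->//|]; rewrite ltnS => /IH.
  by apply: le_trans; exact: fdec.
have L10 : 0 < L + 1 by rewrite ltr_wpDl.
pose d := e / 3 / (L + 1); have d0 : 0 < d by rewrite !divr_gt0.
have Ld : L * d <= e / 3.
  by rewrite /d mulrCA ger_pMr ?divr_gt0// ler_pdivrMr// mul1r lerDl.
pose U n := \bigcup_(y in [set y | f_ n y <= f y + e / 3]) ball (K y) d.
have r0 : 0 <= Num.max r 0 by rewrite le_max lexx orbT.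
have := Kc _ r0; rewrite compact_cover => /(_ nat setT U)[].
- by move=> n _; apply: bigcup_open => y _; exact: ball_open.
- move=> _ [x xr <-]; have [n nx] := fcv x (e / 3) (divr_gt0 e0 (ltr0Sn _ 2)).
  by exists n => //; exists x => //; exact: ballxx.
move=> D _ DU; exists (\max_(i <- finmap.enum_fset D) i)%N => n Nn x xr.
have [|i iD [y fy]] := DU (K x).
  by exists x => //; rewrite /nball /= le_max xr.
rewrite -ball_normE /= -linearB => yx.
have iN : (i <= n)%N.
  by apply: leq_trans Nn; apply: leq_bigmax_seq.
apply: le_trans (f_le _ _ x iN) _.
have [_ /(_ x y)] := fnL i; have := fL' y x.
rewrite -[x - y]opprB linearN normrN => a b.
have : L * `|K (y - x)| <= e / 3.
  by apply: le_trans Ld; rewrite ler_wpM2l// ltW.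
move: a b fy; rewrite /= !ler_norml => /andP[? ?] /andP[? ?] ? ?; lra.
Qed.

Lemma three_quarters_le (R : realType) (e : R) :
  0 < e -> e / 4 + (e / 4 + e / 4) <= e.
Proof. lra. Qed.

Section Semigroup.
Context {R : realType} {X : normedModType R} {K : {linear X -> X}} {p c : R}
  {mu : R -> probability (borel X) R} {psi : R -> X -> X} {phi : R -> \bar R}.
Context (H : model K p c mu psi phi).
Local Notation T := (ref_op mu psi).
Local Notation I := (I_op p c phi mu psi).
Local Notation J := (I_iter p c phi mu psi).
Local Notation S := (S_op p c phi mu psi).
Local Notation adm := (@admissible R X K p c mu psi phi).
Implicit Types (u v w : X -> R) (M L r e t s h d : R) (x y : X) (n m k : nat).

Definition mesh n : R := 2 ^- n.

Lemma mesh_gt0 n : 0 < mesh n.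
Proof. by rewrite /mesh invr_gt0 exprn_gt0. Qed.

Lemma meshS n : mesh n = mesh n.+1 + mesh n.+1.
Proof. by rewrite /mesh exprS; field; exact: expf_neq0. Qed.

Lemma Iiter_fun n t u : J n t u =
  iter (Num.truncn (t / mesh n)) (I (mesh n))
    (I (t - (Num.truncn (t / mesh n))%:R * mesh n) u).
Proof. by []. Qed.

Lemma S_fun t : S t = fun u x => inf (range (fun n => J n t u x)).
Proof. by []. Qed.

Lemma dyadic_refine m n k : (m <= n)%N ->
  k%:R * mesh m = (k * 2 ^ (n - m))%N%:R * mesh n.
Proof.
move=> mn; rewrite natrM -mulrA; congr (_ * _).
by rewrite /mesh natrX -{2}(subnK mn) exprD invfM mulrA mulfV ?mul1r// expf_neq0.
Qed.

Lemma mesh_small e : 0 < e -> exists n, mesh n <= e.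
Proof.
move=> e0; exists (Num.truncn e^-1).
have en : e^-1 < (Num.truncn e^-1).+1%:R by exact: truncnS_gt.
rewrite /mesh -[leRHS]invrK lef_pV2 ?posrE ?invr_gt0 ?exprn_gt0//.
apply: le_trans (ltW en) _; rewrite -natrX ler_nat; exact: ltn_expl.
Qed.

(* Failing unification attempts must not unfold the operators. *)
Local Opaque ref_op I_op I_iter S_op mesh.

Lemma remainder_ge0 n t : 0 <= t ->
  0 <= t - (Num.truncn (t / mesh n))%:R * mesh n.
Proof.
move=> t0; rewrite subr_ge0 -ler_pdivlMr ?mesh_gt0//.
by have /andP[] := truncn_itv (divr_ge0 t0 (ltW (mesh_gt0 n))).
Qed.

Lemma adm_Iiter n t : 0 <= t -> adm t (J n t).
Proof.
move=> t0; have r0 := remainder_ge0 n t0.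
have h0 := ltW (mesh_gt0 n).
have := adm_iter H (Num.truncn (t / mesh n)) h0 r0 (adm_I H h0) (adm_I H r0).
rewrite addrC subrK => aJ; suff -> : J n t = (fun u => iter (Num.truncn (t / mesh n))
  (I (mesh n)) (I (t - (Num.truncn (t / mesh n))%:R * mesh n) u)) by [].
by apply/funext => u; exact: Iiter_fun.
Qed.

(** Doubling the number of steps decreases the result, by superadditivity. *)
Lemma iter_double_le n k u v x : Cb K u -> Cb K v -> (forall x, u x <= v x) ->
  iter k.*2 (I (mesh n.+1)) u x <= iter k (I (mesh n)) v x.
Proof.
move=> uC vC uv; have h0 := ltW (mesh_gt0 n.+1); have h0' := ltW (mesh_gt0 n).
have IC h w : 0 <= h -> Cb K w -> Cb K (I h w).
  by move=> hp; exact: (adm_Cb H hp (adm_I H hp)).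
have itC h w j : 0 <= h -> Cb K w -> Cb K (iter j (I h) w).
  by move=> hp wC; elim: j => //= j IHj; exact: IC.
elim: k x => [|k IH] x; first exact: uv.
rewrite doubleS !iterS.
apply: le_trans (I_superadditive H _ h0 h0 (itC _ _ _ h0 uC)) _.
rewrite -meshS; exact: (I_mono H x h0' (itC _ _ _ h0 uC) (itC _ _ _ h0' vC) IH).
Qed.

Lemma Iiter_dec n t u x : 0 <= t -> Cb K u -> J n.+1 t u x <= J n t u x.
Proof.
move=> t0 uC; have h0 := mesh_gt0 n; have h'0 := mesh_gt0 n.+1.
have hh : mesh n = mesh n.+1 + mesh n.+1 := meshS n.
have IC h w : 0 <= h -> Cb K w -> Cb K (I h w).
  by move=> hp; exact: (adm_Cb H hp (adm_I H hp)).
have r0 := remainder_ge0 n t0.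
have q0 : 0 <= t / mesh n.+1 := divr_ge0 t0 (ltW h'0).
rewrite !Iiter_fun; move: r0; set k := Num.truncn (t / mesh n) => r0.
have /andP[kt tk] := truncn_itv (divr_ge0 t0 (ltW h0)).
rewrite -/k ler_pdivlMr// in kt; rewrite -/k ltr_pdivrMr// in tk.
have [rh|hr] := ltP (t - k%:R * mesh n) (mesh n.+1).
  have -> : Num.truncn (t / mesh n.+1) = k.*2.
    apply/eqP; rewrite (truncn_eq _ q0).
    rewrite ler_pdivlMr// ltr_pdivrMr// -addnn -[(k + k).+1]addn1 !natrD.
    move: (mesh n.+1) hh rh kt => a ->; move: (k%:R : R) => b rh kt.
    by apply/andP; split; lra.
  have -> : t - k.*2%:R * mesh n.+1 = t - k%:R * mesh n.
    by rewrite hh -addnn natrD; ring.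
  by apply: iter_double_le => //; exact: IC.
have -> : Num.truncn (t / mesh n.+1) = k.*2.+1.
  apply/eqP; rewrite (truncn_eq _ q0).
  rewrite ler_pdivlMr// ltr_pdivrMr// -addnn -[_.+2]addn2 -[(k + k).+1]addn1 !natrD.
  rewrite -[k.+1]addn1 natrD in tk.
  move: (mesh n.+1) hh hr tk => a ->; move: (k%:R : R) => b hr tk.
  by apply/andP; split; lra.
rewrite iterSr; set s := t - k.*2.+1%:R * mesh n.+1.
have s0 : 0 <= s.
  rewrite /s -addnn -[(k + k).+1]addn1 !natrD.
  by move: (mesh n.+1) hh hr => a ->; move: (k%:R : R) => b hr; lra.
have sr : mesh n.+1 + s = t - k%:R * mesh n.
  by rewrite /s hh -addnn -[(k + k).+1]addn1 !natrD; ring.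
apply: iter_double_le.
- exact: (IC _ _ (ltW h'0) (IC _ _ s0 uC)).
- exact: (IC _ _ r0 uC).
- by move=> y; rewrite -sr; exact: (I_superadditive H _ (ltW h'0) s0 uC).
Qed.

Lemma Iiter_le m n t u x : 0 <= t -> Cb K u -> (m <= n)%N ->
  J n t u x <= J m t u x.
Proof.
move=> t0 uC; elim: n => [|n IH]; first by rewrite leqn0 => /eqP ->.
rewrite leq_eqVlt => /predU1P[->//|]; rewrite ltnS => /IH.
by apply: le_trans; exact: Iiter_dec.
Qed.

Lemma adm_S t : 0 <= t -> adm t (S t).
Proof.
move=> t0; rewrite S_fun.
exact: (@adm_inf _ _ _ _ _ _ _ _ t (fun n => J n t) (fun n => adm_Iiter n t0)
  (fun n u x uC => Iiter_dec n x t0 uC)).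
Qed.

Lemma S_Cb t u : 0 <= t -> Cb K u -> Cb K (S t u).
Proof. by move=> t0; exact: (adm_Cb H t0 (adm_S t0)). Qed.

Lemma S_lb t u x : 0 <= t -> Cb K u -> has_lbound (range (fun n => J n t u x)).
Proof.
move=> t0 uC; have [M M0 uM] := Cb_bounded uC; exists (- M) => _ [n _ <-].
by have := adm_bound (adm_Iiter n t0) uC uM x; rewrite ler_norml => /andP[].
Qed.

Lemma S_le t u x n : 0 <= t -> Cb K u -> S t u x <= J n t u x.
Proof. by move=> t0 uC; rewrite S_fun; apply: ge_inf; [exact: S_lb|exists n]. Qed.

Lemma S_ge m t u x (a : R) : 0 <= t -> Cb K u ->
  (forall n, (m <= n)%N -> a <= J n t u x) -> a <= S t u x.
Proof.
move=> t0 uC aJ; rewrite S_fun; apply: lb_le_inf; first by exists (J 0%N t u x), 0%N.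
move=> _ [n _ <-]; have [mn|nm] := leqP m n; first exact: aJ.
apply: le_trans (aJ m (leqnn _)) _; exact: (Iiter_le _ t0 uC (ltnW nm)).
Qed.

(** The infimum is uniform on balls: by Dini for Lipschitz functions, and by the
    common tightness of all the operators for the others. *)
Lemma S_approx t u r e : 0 <= t -> Cb K u -> 0 < e -> exists N, forall n,
  (N <= n)%N -> forall x, `|x| <= r -> J n t u x <= S t u x + e.
Proof.
move=> t0 uC e0; have e50 : 0 < e / 5 by rewrite divr_gt0.
have /CbP[M uM] := uC; have [M' M'0 uM'] := Cb_bounded uC.
have [rho rhoP] := tight_dist (adm_tight H t) (Num.max M M') r e50.
have [v [vL vM uv]] := uM rho _ e50; have vC := Lipb_Cb vL.
have /LipbP[L [_ [vL' _]]] := vL.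
have JL n := adm_Lip (adm_Iiter n t0) vC vL'.
have SL := adm_Lip (adm_S t0) vC vL'.
have Jcv x e' : 0 < e' -> exists n, J n t v x <= S t v x + e'.
  move=> e'0; have [|_ [n _ <-] ne] := @inf_adherent _ (range (fun n => J n t v x)) e' e'0.
    by split; [exists (J 0%N t v x), 0%N|exact: S_lb].
  by exists n; rewrite S_fun; exact: ltW.
have [N NP] := dini r (model_compact H) JL SL (fun n x => Iiter_dec n x t0 vC) Jcv e50.
have uN y : `|u y| <= Num.max M M' by rewrite le_max uM' orbT.
have vN y : `|v y| <= Num.max M M' by rewrite le_max vM.
have uvP P : adm t P -> forall x, `|x| <= r -> `|P u x - P v x| <= e / 5 + e / 5.
  move=> aP; apply: (rhoP P u v (e / 5) _ uC vC (ltW e50) uN vN uv).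
  by exists t.
exists N => n Nn x xr; have := NP n Nn x xr.
have := uvP _ (adm_Iiter n t0) x xr; have := uvP _ (adm_S t0) x xr.
move: (J n t u x) (J n t v x) (S t u x) (S t v x) => a1 a2 a3 a4.
by rewrite !ler_norml => /andP[? ?] /andP[? ?]; lra.
Qed.

Lemma Iiter_dyadic n k s u : 0 <= s ->
  Cb K u -> J n (k%:R * mesh n + s) u = J n (k%:R * mesh n) (J n s u).
Proof.
move=> s0 uC; have h0 := mesh_gt0 n.
have JsC : Cb K (J n s u) := adm_Cb H s0 (adm_Iiter n s0) uC.
have -> : J n (k%:R * mesh n) (J n s u) = iter k (I (mesh n)) (J n s u).
  rewrite Iiter_fun mulfK ?gt_eqF// natrK subrr; congr iter.
  by apply/funext => x; exact: (I0 H).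
rewrite !Iiter_fun.
have -> : Num.truncn ((k%:R * mesh n + s) / mesh n) = (k + Num.truncn (s / mesh n))%N.
  have /andP[a b] := truncn_itv (divr_ge0 s0 (ltW h0)).
  have q0 : 0 <= (k%:R * mesh n + s) / mesh n.
    by apply: divr_ge0 (ltW h0); apply: addr_ge0 s0; apply: mulr_ge0 => //; exact: ltW.
  apply/eqP; rewrite (truncn_eq _ q0).
  by rewrite mulrDl mulfK ?gt_eqF// -addnS !natrD lerD2l ltrD2l a b.
rewrite iterD; set a := _ - _; set b := _ - _; suff -> : a = b by [].
by rewrite /a /b natrD; ring.
Qed.

(** At a dyadic time the iterations on every finer grid split exactly. One
    inequality is monotonicity; for the other, a coarse outer iteration is fed
    with a fine inner one, which is uniformly close to the limit on balls. *)
Lemma S_semigroup_dyadic m k s u x : 0 <= s -> Cb K u ->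
  S (k%:R * mesh m + s) u x = S (k%:R * mesh m) (S s u) x.
Proof.
move=> s0 uC; set t := k%:R * mesh m.
have t0 : 0 <= t by rewrite mulr_ge0// ltW// mesh_gt0.
have ts0 : 0 <= t + s by rewrite addr_ge0.
have SsC := S_Cb s0 uC.
have JsC n : Cb K (J n s u) := adm_Cb H s0 (adm_Iiter n s0) uC.
have JJ n : (m <= n)%N -> J n (t + s) u = J n t (J n s u).
  by move=> mn; rewrite /t (dyadic_refine _ mn) Iiter_dyadic.
apply/eqP; rewrite eq_le; apply/andP; split; last first.
  apply: (S_ge (m := m)) => // n mn; rewrite JJ//.
  apply: le_trans (S_le x n t0 SsC) _.
  by apply: (adm_mono (adm_Iiter n t0)) => // y; exact: S_le.
apply: (S_ge (m := m)) => // n mn.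
apply/ler_addgt0Pr => e e0; have e20 : 0 < e / 2 by rewrite divr_gt0.
have [M M0 uM] := Cb_bounded uC.
have [rho rhoP] := adm_tight1 H t0 (adm_Iiter n t0) M `|x| e20.
have [N NP] := S_approx rho s0 uC e20.
have nN : (n <= maxn n N)%N := leq_maxl _ _.
apply: le_trans (S_le x (maxn n N) ts0 uC) _.
rewrite JJ ?(leq_trans mn)//; apply: le_trans (Iiter_le x t0 (JsC _) nN) _.
rewrite [e]splitr addrA.
exact: (rhoP (J n t) _ _ (e / 2) erefl (JsC _) SsC (ltW e20)
  (adm_bound (adm_Iiter _ s0) uC uM) (adm_bound (adm_S s0) uC uM)
  (NP _ (leq_maxr n N)) x (lexx _)).
Qed.

Lemma dyadic_below t e : 0 <= t -> 0 < e -> exists m k,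
  k%:R * mesh m <= t /\ t - k%:R * mesh m <= e.
Proof.
move=> t0 e0; have [m me] := mesh_small e0; have h0 := mesh_gt0 m.
exists m, (Num.truncn (t / mesh m)).
have /andP[a b] := truncn_itv (divr_ge0 t0 (ltW h0)).
rewrite ler_pdivlMr// in a; rewrite ltr_pdivrMr// -addn1 natrD in b.
by split=> //; lra.
Qed.

(** The modulus does not depend on the dyadic time, so that continuity from the
    right at all times follows by approximation from below. *)
Lemma S_right_dyadic B u r e : Cb K u -> 0 < e -> exists2 b, 0 < b &
  forall m k d, k%:R * mesh m <= B -> 0 <= d -> d <= b -> forall x, `|x| <= r ->
  `|S (k%:R * mesh m + d) u x - S (k%:R * mesh m) u x| <= e.
Proof.
move=> uC e0; have e20 : 0 < e / 2 by rewrite divr_gt0.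
have [M M0 uM] := Cb_bounded uC.
have [rho rhoP] := tight_dist (adm_tight H B) M r e20.
have [b b0 bP] := adm_near_id H rho uC e20.
exists b => // m k d kB d0 db x xr.
have t0 : 0 <= k%:R * mesh m by rewrite mulr_ge0// ltW// mesh_gt0.
rewrite (S_semigroup_dyadic _ _ _ d0 uC) [leRHS]splitr.
apply: (rhoP (S (k%:R * mesh m)) _ _ (e / 2) _ (S_Cb d0 uC) uC (ltW e20)
  (adm_bound (adm_S d0) uC uM) uM _ x xr).
- by exists (k%:R * mesh m); split; [exact: t0|exact: kB|exact: adm_S].
- by move=> y yr; exact: (bP d (S d) d0 db (adm_S d0) y yr).
Qed.

Lemma S_right s u r e : 0 <= s -> Cb K u -> 0 < e -> exists2 b, 0 < b &
  forall d, 0 <= d -> d <= b -> forall x, `|x| <= r ->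
  `|S (s + d) u x - S s u x| <= e.
Proof.
move=> s0 uC e0; have e20 : 0 < e / 2 by rewrite divr_gt0.
have [b b0 bP] := S_right_dyadic s r uC e20.
have b20 : 0 < b / 2 by rewrite divr_gt0.
have [m [k [ks sk]]] := dyadic_below s0 b20.
exists (b / 2) => // d d0 db x xr.
move: ks sk (bP m k); set D := k%:R * mesh m => ks sk bD.
have sD : 0 <= s - D by rewrite subr_ge0.
have A : `|S s u x - S D u x| <= e / 2.
  by rewrite -{1}(subrK D s) (addrC _ D); apply: bD => //; lra.
have B : `|S (s + d) u x - S D u x| <= e / 2.
  rewrite (_ : s + d = D + (s - D + d)); last by ring.
  by apply: bD => //; lra.
apply: le_trans (ler_distD (S D u x) _ _) _.
rewrite addrC [X in X + _]distrC; apply: le_trans (lerD A B) _.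
by rewrite -splitr.
Qed.

Lemma S_semigroup t s u x : 0 <= t -> 0 <= s -> Cb K u ->
  S t (S s u) x = S (t + s) u x.
Proof.
move=> t0 s0 uC; have SsC := S_Cb s0 uC.
apply/eqP; rewrite -subr_eq0 -normr_eq0 eq_le normr_ge0 andbT.
apply/ler_addgt0Pr => e e0; rewrite add0r.
have e4 : e / 4 + (e / 4 + e / 4) <= e by exact: three_quarters_le.
have e40 : 0 < e / 4 by rewrite divr_gt0.
have [M M0 uM] := Cb_bounded uC.
have [rho rhoP] := tight_dist (adm_tight H t) M `|x| e40.
have [b1 b10 b1P] := S_right_dyadic t `|x| SsC e40.
have [b2 b20 b2P] := S_right rho s0 uC e40.
have b0 : 0 < Num.min b1 b2 by rewrite lt_min b10.
have [m [k [kt tk]]] := dyadic_below t0 b0.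
have d0 : 0 <= k%:R * mesh m by rewrite mulr_ge0// ltW// mesh_gt0.
move: tk; set d := t - k%:R * mesh m; rewrite le_min => /andP[db1 db2].
have dp : 0 <= d by rewrite subr_ge0.
have tE : t = k%:R * mesh m + d by rewrite /d addrC subrK.
have A : `|S t (S s u) x - S (k%:R * mesh m) (S s u) x| <= e / 4.
  by rewrite {1}tE; exact: b1P.
have B : `|S (t + s) u x - S (k%:R * mesh m) (S s u) x| <= e / 4 + e / 4.
  have ds0 : 0 <= d + s := addr_ge0 dp s0.
  have -> : S (t + s) u x = S (k%:R * mesh m) (S (d + s) u) x.
    by rewrite {1}tE -addrA; exact: S_semigroup_dyadic.
  apply: (rhoP (S (k%:R * mesh m)) _ _ (e / 4) _ (S_Cb ds0 uC) SsC (ltW e40)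
    (adm_bound (adm_S ds0) uC uM) (adm_bound (adm_S s0) uC uM) _ x (lexx _)).
  - by exists (k%:R * mesh m); split; [exact: d0|exact: kt|exact: adm_S].
  - by move=> y yr; rewrite (addrC d s); exact: (b2P d dp db2 y yr).
rewrite distrC in B; apply: le_trans (ler_distD (S (k%:R * mesh m) (S s u) x) _ _) _.
apply: le_trans (lerD A B) _; exact: e4.
Qed.

Lemma S_transition_semigroup : convex_transition_semigroup K c S.
Proof.
split.
- by move=> t u; exact: S_Cb.
- by move=> t u v l t0 uC vC l0 l1 x; exact: (adm_convex (adm_S t0)).
- by move=> t u v t0 uC vC uv x; exact: (adm_mono (adm_S t0)).
- by move=> t m t0; apply/funext => x; exact: (adm_cst (adm_S t0)).
- move=> t u t0 uL; have uC := Lipb_Cb uL; have /LipbP[L [M [uL' uM]]] := uL.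
  have SL L' := adm_Lip (adm_S t0) uC (L := L').
  split.
    apply/LipbP; exists (expR (c * t) * L), M; split; first exact: SL.
    exact: (adm_bound (adm_S t0)).
  rewrite /Lip_norm -ler_pdivrMl ?expR_gt0//; apply: lb_le_inf; first by exists L.
  move=> L' uL''; rewrite ler_pdivrMl ?expR_gt0//; apply: ge_inf; last exact: SL.
  by exists 0 => ? [].
- by move=> s t u s0 t0 uC; apply/funext => x; exact: S_semigroup.
- move=> s u_ u s0 u_C uC /seq_convP[[M uM] uc].
  have [M' M'0 uM'] := Cb_bounded uC.
  apply: seq_conv_unif_intro => //.
    exists M => n t x /andP[t0 ts]; exact: (adm_bound (adm_S t0)).
  move=> r e e0; have e20 : 0 < e / 2 by rewrite divr_gt0.
  have [rho rhoP] := tight_dist (adm_tight H s) (Num.max M M') r e20.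
  apply: filterS (uc rho _ e20) => n un t x /andP[t0 ts] xr.
  rewrite [leRHS]splitr; apply: rhoP => //.
  + by exists t; split=> //; exact: adm_S.
  + exact: ltW.
  + by move=> y; rewrite le_max uM.
  + by move=> y; rewrite le_max uM' orbT.
  + by move=> y yr; rewrite distrC; exact: un.
- move=> u uC; have [M M0 uM] := Cb_bounded uC; apply/right0_convP; split.
    exists M; near=> h; have h0 : 0 <= h by near: h; apply: nbhs_right_ge.
    exact: (adm_bound (adm_S h0)).
  move=> r e e0; have [h0 h00 hP] := adm_near_id H r uC e0.
  apply/near0_rightP; exists h0 => // h hp hh x xr; rewrite distrC.
  by apply: (hP h (S h)) => //; [exact: ltW|apply: adm_S; exact: ltW].
Unshelve. all: by end_near. Qed.

End Semigroup.


(** * The norm of the derivative as a local slope *)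

Section Slope.
Context {R : realType} {X : normedModType R} {K : {linear X -> X}}.
Context (K1 : forall x : X, `|K x| <= `|x|)
  (Kc : forall r : R, 0 <= r -> compact (K @` nball r)).
Context {u : X -> R} {L : R} (uL : is_Lip_bound K u L).
Context (ud : forall x, differentiable (u : X -> R^o) x).
Implicit Types (x y z k v : X) (a e r s d : R).
Local Notation du x := ('d (u : X -> R^o) x : X -> R).
Let w := deriv_norm u.

Lemma diff_approx x e : 0 < e -> exists2 d, 0 < d &
  forall k, `|k| <= d -> `|u (x + k) - u x - du x k| <= e * `|k|.
Proof.
move=> e0; have /eqaddoP/(_ e e0) := diff_locally (ud x).
rewrite nearE => /nbhs_ballP[d /= d0 dP].
exists (d / 2); first by rewrite divr_gt0.
move=> k kd; have := dP k; rewrite -ball_normE /= sub0r normrN => /(_ _).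
rewrite !fctE /= (addrC k x) opprD addrA; apply.
by apply: le_lt_trans kd _; rewrite ltr_pdivrMr// mulr_natr mulr2n ltrDl.
Qed.

Let slope x a e v : 0 < e -> (exists2 d, 0 < d & forall k, `|k| <= d ->
  u (x + k) <= u x + a * `|k|) -> du x v <= (a + e) * `|v|.
Proof.
move=> e0 [d d0 ua]; have [d' d'0 du'] := diff_approx x e0.
have [->|v0] := eqVneq v 0; first by rewrite linear0 normr0 mulr0.
have vp : 0 < `|v| by rewrite normr_gt0.
pose s := Num.min d d' / `|v|.
have m0 : 0 < Num.min d d' by rewrite lt_min d0.
have s0 : 0 < s by rewrite divr_gt0.
have sv : `|s *: v| = Num.min d d'.
  by rewrite normrZ gtr0_norm// /s divfK// gt_eqF.
have A := ua (s *: v); have B := du' (s *: v).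
rewrite sv !ge_min !lexx orbT /= in A B.
have {}A := A isT; have := B isT; rewrite ler_norml => /andP[B1 _].
rewrite (_ : du x (s *: v) = s * du x v) in B1; last by rewrite linearZ.
rewrite -(ler_pM2l s0) mulrCA -{2}(gtr0_norm s0) -normrZ sv.
by move: A B1; lra.
Qed.

Let Lip_slope x : exists2 d, 0 < d & forall k, `|k| <= d ->
  u (x + k) <= u x + L * `|k|.
Proof.
exists 1 => // k _; have := is_Lip_bound_norm K1 uL (x + k) x.
by rewrite addrAC subrr add0r ler_norml => /andP[_]; rewrite lerBlDl.
Qed.

Let diff_le_slope x a v : (exists2 d, 0 < d & forall k, `|k| <= d ->
  u (x + k) <= u x + a * `|k|) -> `|du x v| <= a * `|v|.
Proof.
move=> ua; have A v' : du x v' <= a * `|v'|.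
  apply/ler_addgt0Pr => e e0.
  have d0 : 0 < `|v'| + 1 by rewrite ltr_wpDl.
  apply: le_trans (slope v' (divr_gt0 e0 d0) ua) _.
  rewrite mulrDl lerD2l mulrAC ler_pdivrMr// ler_wpM2l ?ltW//.
  by rewrite ltrDl.
rewrite ler_norml A andbT lerNl; have := A (- v).
by rewrite normrN linearN.
Qed.

Lemma diff_bound x v : `|du x v| <= L * `|v|.
Proof. exact/diff_le_slope/Lip_slope. Qed.

Let opnorm_has_sup x : has_sup [set `|du x v| | v in nball 1].
Proof.
split; first by exists `|du x 0|, 0 => //; rewrite /nball /= normr0.
exists L => _ [v v1 <-]; apply: le_trans (diff_bound x v) _.
by rewrite ler_piMr// uL.1.
Qed.

(** Contrapositive: below the norm of the derivative no slope bounds the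
    increments in all directions, which is how good directions are found. *)
Lemma deriv_norm_le_slope x a : 0 <= a -> (exists2 d, 0 < d & forall k, `|k| <= d ->
  u (x + k) <= u x + a * `|k|) -> w x <= a.
Proof.
move=> a0 ua; apply: ge_sup; first exact: (opnorm_has_sup x).1.
move=> _ [v v1 <-]; apply: le_trans (diff_le_slope v ua) _.
by rewrite ler_piMr.
Qed.

Lemma deriv_norm_le x : w x <= L.
Proof. by apply: deriv_norm_le_slope => //; exact: uL.1. Qed.

Lemma deriv_norm_ge0 x : 0 <= w x.
Proof.
apply: le_trans (normr_ge0 (du x 0)) _.
by apply: ub_le_sup; [exact: (opnorm_has_sup x).2|exists 0 => //; rewrite /nball /= normr0].
Qed.

Lemma diff_le x v : `|du x v| <= w x * `|v|.
Proof.
have [->|v0] := eqVneq v 0; first by rewrite linear0 !normr0 mulr0.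
have vp : 0 < `|v| by rewrite normr_gt0.
rewrite -ler_pdivrMr//.
rewrite -[X in _ / X](gtr0_norm vp) -normf_div mulrC -[_ * _]/(_ *: du x v) -linearZ.
apply: ub_le_sup; first exact: (opnorm_has_sup x).2.
by exists (`|v|^-1 *: v) => //; rewrite /nball /= normrZ normfV normr_id mulVf// gt_eqF.
Qed.

Lemma line_derive y z (t : R) :
  is_derive t 1 (fun s : R => u (y + s *: z)) (du (y + t *: z) z).
Proof.
pose l (s : R) := y + s *: z.
have ll : is_derive t 1 l z.
  have ld : is_diff t l (0 + *:%R ^~ z).
    by rewrite -[l]/(cst y + *:%R ^~ z); exact: is_diffD.
  apply: DeriveDef; first by apply: diff_derivable; case: ld.
  by rewrite deriveE ?diff_val /= ?add0r ?scale1r//; case: ld.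
have ld : differentiable l t by apply/derivable1_diffP.
have -> : (fun s : R => u (y + s *: z)) = (u : X -> R^o) \o l by [].
have dc : differentiable ((u : X -> R^o) \o l) t by apply: differentiable_comp.
apply: DeriveDef; first exact: diff_derivable.
rewrite deriveE// diff_comp//= -/(l t); congr ('d _ _ _).
by rewrite -deriveE//; case: ll.
Qed.

(** Mean value theorem; the norm of the derivative is uniformly continuous on
    balls, as it belongs to [Cb]. *)
Lemma slope_upper r e : Cb K w -> 0 < e -> exists2 s0, 0 < s0 &
  forall y z, `|y| <= r -> `|z| <= s0 -> u (y + z) <= u y + (w y + e) * `|z|.
Proof.
move=> wC e0; have [d d0 wd] := Cb_unif K1 (r + 1) wC e0.
exists (Num.min d 1); first by rewrite lt_min d0/=.
move=> y z yr; rewrite le_min => /andP[zd z1].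
have [||t /andP[t0 t1]] := @MVT_segment _ (fun s : R => u (y + s *: z))
  (fun t => du (y + t *: z) z) 0 1 ler01.
- by move=> t _; exact: line_derive.
- apply: derivable_within_continuous => t _; have := line_derive y z t; by case.
rewrite scale1r scale0r addr0 subr0 mulr1 => uz.
rewrite -lerBlDl uz; apply: le_trans (ler_norm _) _; apply: le_trans (diff_le _ _) _.
rewrite ler_wpM2r//.
have tz : `|t *: z| <= `|z|.
  by rewrite normrZ ger0_norm// ler_piMl.
have := wd (y + t *: z) y; rewrite addrAC subrr add0r ler_norml => A.
have /andP[_] : (- e <= w (y + t *: z) - w y <= e).
  apply: A.
  - by apply: le_trans (ler_normD _ _) _; apply: lerD => //; exact: le_trans z1.
  - by apply: le_trans yr _; rewrite lerDl.
  - exact: le_trans zd.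
by rewrite lerBlDl.
Qed.

(** The ball itself is not compact, but the function depends continuously on [K z],
    which ranges over a compact set. *)
Lemma ball_sup_attained (f : X -> R) (M s B : R) : 0 <= s -> is_Lip_bound K f M ->
  (forall e, 0 < e -> exists2 z, `|z| <= s & B - e <= f z) ->
  exists2 z, `|z| <= s & B <= f z.
Proof.
move=> s0 [M0 fM] fB; apply/not_exists2P => fz.
have {}fz z : `|z| <= s -> f z < B by move=> zs; case: (fz z) => // /negP; rewrite -ltNge.
have M10 : 0 < M + 1 by rewrite ltr_wpDl.
pose g n : R := n.+1%:R^-1.
have g0 n : 0 < g n by rewrite invr_gt0.
pose U n := \bigcup_(z in [set z | f z <= B - g n - g n]) ball (K z) (g n / (M + 1)).
have := Kc s0; rewrite compact_cover => /(_ nat setT U)[].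
- by move=> n _; apply: bigcup_open => z _; exact: ball_open.
- move=> _ [z zs <-]; have Bz : 0 < (B - f z) / 2 by rewrite divr_gt0// subr_gt0 fz.
  have [n nz] := ltr_add_invr (y := 0) (x := (B - f z) / 2) Bz.
  exists n => //; exists z; last by apply: ballxx; rewrite divr_gt0.
  rewrite add0r in nz; have {}nz : g n < (B - f z) / 2 := nz.
  by move: nz; rewrite /=; move: (g n) (f z) => b a; lra.
move=> D _ DU; pose N := (\max_(i <- finmap.enum_fset D) i)%N.
have [z zs Bz] := fB _ (g0 N.+1).
have [|i iD [y /= fy]] := DU (K z); first by exists z.
rewrite -ball_normE /= -linearB => yz.
have iN : (i <= N)%N by apply: leq_bigmax_seq.
have gN : g N.+1 < g i.
  by rewrite /g ltf_pV2 ?posrE// ltr_nat ltnS ltnS.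
have := fM z y; rewrite -[z - y]opprB linearN normrN ler_norml => /andP[_].
have : M * `|K (y - z)| <= g i.
  have := ltW yz; rewrite ler_pdivlMr// mulrDr mulr1 mulrC.
  by have := normr_ge0 (K (y - z)); lra.
lra.
Qed.

(** There is a largest length up to which the displacement can be chosen with the
    announced gain per unit of length. If it were below [s], the gain could be
    continued from the end point, where the norm of the derivative still exceeds
    [w y - e]. *)
Lemma slope_lower r e : Cb K w -> 0 < e -> exists2 s0, 0 < s0 &
  forall y s, `|y| <= r -> 0 <= s -> s <= s0 ->
  exists2 z, `|z| <= s & u y + (w y - e) * s <= u (y + z).
Proof.
move=> wC e0; have e20 : 0 < e / 2 by rewrite divr_gt0.
have [d d0 wd] := Cb_unif K1 (r + 1) wC e20.
exists (Num.min d 1); first by rewrite lt_min d0/=.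
move=> y s yr s0; rewrite le_min => /andP[sd s1].
have [we|we] := leP (w y - e) 0.
  exists 0; first by rewrite normr0.
  by rewrite addr0 gerDl mulr_le0_ge0.
set a := w y - e; rewrite -/a in we.
pose A := [set t | [/\ 0 <= t, t <= s & exists2 z, `|z| <= t & u y + a * t <= u (y + z)]].
have A0 : A 0 by split=> //; exists 0; rewrite ?normr0// mulr0 !addr0.
have As : has_sup A by split; [exists 0|exists s => t []].
have t0 : 0 <= sup A by apply: ub_le_sup => //; exact: As.2.
have ts : sup A <= s by apply: ge_sup; [exists 0|move=> t []].
have uyL : is_Lip_bound K (fun z => u (y + z)) L.
  split=> [|z z']; first exact: uL.1.
  have := uL.2 (y + z) (y + z').
  by rewrite (_ : y + z - (y + z') = z - z') // opprD addrACA subrr add0r.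
have [z zt uz] : exists2 z, `|z| <= sup A & u y + a * sup A <= u (y + z).
  apply: (ball_sup_attained t0 uyL) => e' e'0.
  have [t [tp tls [z zt uz]] te] := sup_adherent (divr_gt0 e'0 we) As.
  have tA : t <= sup A.
    apply: ub_le_sup; first exact: As.2.
    by split=> //; exists z.
  exists z; first exact: le_trans tA.
  apply: le_trans uz; rewrite -addrA lerD2l lerBlDl -lerBlDr -mulrBr.
  by rewrite mulrC -ler_pdivlMr// lerBlDl; move/ltW: te; rewrite lerBlDr addrC.
have [tls|st] := ltP (sup A) s; last first.
  have ->: s = sup A by apply: le_anti; rewrite st.
  by exists z.
have [k [k0 ks uk]] : exists k, [/\ 0 < `|k|, `|k| <= s - sup A &
    u (y + z) + a * `|k| <= u (y + z + k)].
  apply: contrapT => nk; suff : w (y + z) <= a.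
    have := wd (y + z) y; rewrite addrAC subrr add0r ler_norml => B.
    have /andP[] : - (e / 2) <= w (y + z) - w y <= e / 2.
      apply: B.
      - apply: le_trans (ler_normD _ _) _; apply: lerD => //.
        exact: le_trans zt (le_trans ts s1).
      - by apply: le_trans yr _; rewrite lerDl.
      - exact: le_trans zt (le_trans ts sd).
    by rewrite /a; lra.
  apply: deriv_norm_le_slope; first exact: ltW.
  exists (s - sup A); first by rewrite subr_gt0.
  move=> k ks; have [->|k0] := eqVneq k 0; first by rewrite normr0 mulr0 !addr0.
  have [//|/ltW uk] := leP (u (y + z + k)) (u (y + z) + a * `|k|).
  by exfalso; apply: nk; exists k; rewrite normr_gt0.
suff /(ub_le_sup As.2) : A (sup A + `|k|) by rewrite gerDl leNgt k0.
split; [by rewrite addr_ge0| by rewrite -lerBrDl|].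
exists (z + k); first exact: le_trans (ler_normD _ _) (lerD zt _).
by rewrite addrA mulrDr addrA; apply: le_trans uk; rewrite lerD2r.
Qed.

End Slope.


(** * The conjugate of the penalisation *)

Definition conj_val {R : realType} (phi : R -> \bar R) (w : R) : R :=
  fine (conjugate phi w).

Section Conjugate.
Context {R : realType} {p : R} {phi : R -> \bar R}.
Context (p1 : 1 < p) (P : penalisation p phi).
Implicit Types (v w L B e k D : R).
Local Notation cj := (conj_val phi).
Let p0 : 0 < p. Proof. exact: lt_trans ltr01 p1. Qed.

Lemma powR_dominates a k : 0 <= a -> 0 < k -> exists2 V, 0 < V &
  forall v, V <= v -> a * v <= k * v `^ p.
Proof.
move=> a0 k0; have q0 : 0 < p - 1 by rewrite subr_gt0.
have [V V0 VP] := powR_large q0 (divr_ge0 a0 (ltW k0)).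
exists V => // v Vv; have v0 : 0 <= v := le_trans (ltW V0) Vv.
rewrite -(mulr_powRB1 v0 p0) mulrCA mulrC ler_wpM2l// mulrC -ler_pdivrMr//.
exact: VP.
Qed.

(** [phi] grows at least like [v^p] with [p > 1]: high speeds never pay off. *)
Lemma conj_large L : 0 <= L -> exists2 V, 0 < V &
  forall v w, V <= v -> w <= L -> ((v * w)%:E <= phi v)%E.
Proof.
move=> L0; have [k [D kD]] := minorant_exists p1 P.
have D0 := minorant_D_ge0 p1 P kD.
have [V V0 VP] := powR_dominates (addr_ge0 L0 D0) kD.1.
exists (Num.max V 1); first by rewrite lt_max V0.
move=> v w; rewrite ge_max => /andP[Vv v1] wL.
have v0 : 0 <= v := le_trans ler01 v1.
apply: le_trans (kD.2 v v0); rewrite lee_fin lerBrDr.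
apply: le_trans (VP v Vv); rewrite mulrDl mulrC; apply: lerD.
  by rewrite ler_wpM2r.
by rewrite ler_peMr.
Qed.

Lemma conjE w : 0 <= w -> conjugate phi w = (cj w)%:E.
Proof.
move=> w0; rewrite /conj_val fineK//; have [V V0 VP] := conj_large w0.
apply/fin_numPlt/andP; split.
  apply: (@lt_le_trans _ _ 0%E); first exact: ltNy0.
  by apply: ereal_sup_ubound; exists 0; rewrite ?mul0r ?(pen0 P) ?sube0//=.
apply: (@le_lt_trans _ _ (V * w)%:E); last exact: ltry.
apply: ge_ereal_sup => _ [v /= v0 <-].
case fE : (phi v) (pen_ge0 P v0) => [f| |] // f0; last by rewrite leNye.
have [Vv|/ltW vV] := leP V v.
  have := VP v w Vv (lexx _); rewrite fE -EFinB !lee_fin -subr_le0 => fw.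
  by apply: le_trans fw _; rewrite mulr_ge0 ?(ltW V0).
rewrite -EFinB lee_fin lerBlDr; apply: (@le_trans _ _ (V * w)).
  by rewrite ler_wpM2r.
by rewrite lerDl -lee_fin.
Qed.

Lemma conj_ub v w : 0 <= v -> 0 <= w -> ((v * w)%:E <= (cj w)%:E + phi v)%E.
Proof.
move=> v0 w0; rewrite -conjE//.
case fE : (phi v) (pen_ge0 P v0) => [f| |] // f0; last first.
  by rewrite addey ?leey// conjE.
rewrite -leeBlDr// -fE; apply: ereal_sup_ubound; by exists v.
Qed.

Lemma conj_lub w B : 0 <= w ->
  (forall v f, 0 <= v -> phi v = f%:E -> v * w <= B + f) -> cj w <= B.
Proof.
move=> w0 wB; rewrite -lee_fin -conjE//; apply: ge_ereal_sup => _ [v /= v0 <-].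
case fE : (phi v) (pen_ge0 P v0) => [f| |] // f0; last first.
  by rewrite leNye.
by rewrite -EFinB lee_fin lerBlDr; exact: wB.
Qed.

Lemma conj_ge0 w : 0 <= w -> 0 <= cj w.
Proof.
by move=> w0; have := conj_ub (lexx 0) w0; rewrite mul0r (pen0 P) adde0 lee_fin.
Qed.

Lemma conj_Lip L : 0 <= L -> exists2 V, 0 < V & forall w w', 0 <= w -> w <= L ->
  0 <= w' -> cj w <= cj w' + V * `|w - w'|.
Proof.
move=> L0; have [V V0 VP] := conj_large L0; exists V => // w w' w0 wL w'0.
have n0 : 0 <= V * `|w - w'| by rewrite mulr_ge0// ltW.
apply: conj_lub => // v f v0 vf; have [Vv|vV] := leP V v.
  have := VP v w Vv wL; rewrite vf lee_fin => A; apply: le_trans A _.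
  by rewrite lerDr addr_ge0// conj_ge0.
have := conj_ub v0 w'0; rewrite vf -EFinD lee_fin => A.
have : v * (w - w') <= V * `|w - w'|.
  apply: le_trans (ler_norm _) _; rewrite normrM ger0_norm// ler_wpM2r//.
  exact: ltW.
by move: A; rewrite mulrBr; lra.
Qed.

(** Duality for the problem of choosing a speed [v] at the price [phi v] when the
    gain is [v * w]; its value is the conjugate. *)
Lemma conj_dual w e : 0 <= w -> 0 < e -> exists k D, minorant p phi k D /\
  forall v, 0 <= v -> D + v * w - k * v `^ p <= cj w + e.
Proof.
move=> w0 e0; pose C (r f : R) := exists2 v, 0 <= v & v `^ p <= r /\ f = v * w.
have p'0 : 0 < p^-1 by rewrite invr_gt0.
have rv v r : 0 <= v -> v `^ p <= r -> v <= r `^ p^-1.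
  move=> v0 vr; have r0 := le_trans (powR_ge0 _ _) vr.
  rewrite -{1}(powRVK p0 v0); apply: ge0_ler_powR (ltW p'0) _ _ _ _ vr => //.
  by rewrite nnegrE; exact: powR_ge0.
have [||r f||r f|e1 e10|k [D [kD kDP]]] := @fenchel_duality R p phi p1 P C (cj w) w 0
    _ _ _ _ _ _ e e0.
- by exists 0 => //; rewrite powR0 ?gt_eqF// mul0r.
- by move=> r f [v v0 [vr _]]; exact: le_trans (powR_ge0 _ _) vr.
- move=> [v v0 [vr ->]]; rewrite mulrC ler_wpM2l//.
  have [v1|/ltW v1] := leP v 1.
    apply: le_trans v1 _; rewrite lerDl; exact: le_trans (powR_ge0 _ _) vr.
  apply: (@le_trans _ _ (v `^ p)); last by apply: le_trans vr _; rewrite lerDr.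
  by apply: le1r_powR => //; exact: ltW.
- move=> r f r' f' l [v v0 [vr ->]] [v' v'0 [vr' ->]] l0 l1.
  exists (l * v + (1 - l) * v'); first by rewrite addr_ge0// mulr_ge0// subr_ge0.
  have := convex_powR (ltW p1) (Itv01 l0 l1).
  move=> /(_ v v'); rewrite !inE /= !in_itv /= !andbT => /(_ v0 v'0).
  move=> h; rewrite !convRE /= /unstable.onem in h.
  split; last by ring.
  apply: le_trans h _; apply: lerD; apply: ler_wpM2l => //.
  by rewrite subr_ge0.
- move=> [v v0 [vr ->]]; apply: le_trans (conj_ub (v := r `^ p^-1) _ w0).
    by rewrite lee_fin ler_wpM2r// rv.
  exact: powR_ge0.
- pose d := (e1 / (w + 1)) `^ p.
  have w10 : 0 < w + 1 by rewrite ltr_wpDl.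
  have d0 : 0 < e1 / (w + 1) by rewrite divr_gt0.
  exists d; first exact: powR_gt0.
  move=> r f [v v0 [vr ->]] rd.
  have vd : v <= e1 / (w + 1).
    have := rv v _ v0 (le_trans vr rd); rewrite powRVK//; exact: ltW.
  have := conj_ge0 w0; have : v * w <= e1.
    move: vd; rewrite ler_pdivlMr// mulrDr mulr1; lra.
  lra.
exists k, D; split=> // v v0.
have := kDP (v `^ p) (v * w); apply; by exists v.
Qed.

End Conjugate.


(** * The slope of one step *)

Definition ball_sup {R : realType} {X : normedModType R} (s : R) (u : X -> R)
    (x : X) : R :=
  sup [set u (x + z) | z in nball s].

Section BallSup.
Context {R : realType} {X : normedModType R} {K : {linear X -> X}}.
Context {u : X -> R} {L M s : R} (s0 : 0 <= s) (uL : is_Lip_bound K u L)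
  (uM : forall x, `|u x| <= M).
Implicit Types (x y z : X).

Lemma ball_sup_le x B : (forall z, `|z| <= s -> u (x + z) <= B) ->
  ball_sup s u x <= B.
Proof.
move=> uB; apply: ge_sup; first by exists (u (x + 0)), 0 => //; exact: nball0.
by move=> _ [z zs <-]; exact: uB.
Qed.

Lemma ball_sup_ub x z : `|z| <= s -> u (x + z) <= ball_sup s u x.
Proof.
move=> zs; apply: ub_le_sup; last by exists z.
by exists M => _ [y _ <-]; exact: le_trans (ler_norm _) (uM _).
Qed.

Lemma ball_sup_ge x : u x <= ball_sup s u x.
Proof. by have := @ball_sup_ub x 0; rewrite normr0 addr0; exact. Qed.

Lemma ball_sup_Lipb : Lipb K (ball_sup s u).
Proof.
apply/LipbP; exists L, M; split; last first.
  move=> x; rewrite ler_norml; apply/andP; split.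
    apply: le_trans (ball_sup_ge x).
    by have := uM x; rewrite ler_norml => /andP[].
  by apply: ball_sup_le => z _; exact: le_trans (ler_norm _) (uM _).
split=> [|x y]; first exact: uL.1.
suff A a b : ball_sup s u a <= ball_sup s u b + L * `|K (a - b)|.
  rewrite ler_norml; have := A x y; have := A y x.
  rewrite -[y - x]opprB linearN normrN => ? ?; apply/andP; split; lra.
apply: ball_sup_le => z zs; rewrite -lerBlDr; apply: le_trans (ball_sup_ub b zs).
have := uL.2 (a + z) (b + z).
rewrite (_ : a + z - (b + z) = a - b); last first.
  by rewrite opprD addrACA subrr addr0.
by rewrite ler_norml => /andP[_]; lra.
Qed.

End BallSup.

Section StepSlope.
Context {R : realType} {X : normedModType R} {K : {linear X -> X}} {p c : R}
  {mu : R -> probability (borel X) R} {psi : R -> X -> X} {phi : R -> \bar R}.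
Context (H : model K p c mu psi phi).
Context {u : X -> R} {L M : R} (uL : is_Lip_bound K u L)
  (uM : forall x, `|u x| <= M)
  (ud : forall x, differentiable (u : X -> R^o) x) (wC : Cb K (deriv_norm u)).
Local Notation T := (ref_op mu psi).
Local Notation Q := (sup_conv p).
Local Notation I := (I_op p c phi mu psi).
Local Notation cj := (conj_val phi).
Implicit Types (l r e t s h k D a b V : R) (x y z : X).
Let w := deriv_norm u.
Let p1 : 1 < p. Proof. exact: model_p_gt1 H. Qed.
Let p0 : 0 < p. Proof. exact: lt_trans ltr01 p1. Qed.
Let c0 : 0 <= c. Proof. exact: model_c_ge0 H. Qed.
Let K1 := model_contr H.
Let P := model_phi H.
Let uC : Cb K u. Proof. by apply: Lipb_Cb; apply/LipbP; exists L, M. Qed.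
Let L0 : 0 <= L. Proof. exact: uL.1. Qed.
Let w0 x : 0 <= w x. Proof. exact: (deriv_norm_ge0 K1 uL ud). Qed.
Let wL x : w x <= L. Proof. exact: (deriv_norm_le K1 uL ud). Qed.

Lemma uniform_right (F : nat -> R -> Prop) :
  (forall j, exists2 h0, 0 < h0 & forall h, 0 < h -> h <= h0 -> F j h) ->
  forall n, exists2 h0, 0 < h0 &
    forall j h, (j <= n)%N -> 0 < h -> h <= h0 -> F j h.
Proof.
move=> FP; elim=> [|n [h1 h10 IH]].
  have [h0 h00 h0P] := FP 0%N; exists h0 => // j h; rewrite leqn0 => /eqP ->.
  exact: h0P.
have [h0 h00 h0P] := FP n.+1; exists (Num.min h0 h1); first by rewrite lt_min h00.
move=> j h jn hp; rewrite le_min => /andP[hh0 hh1].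
by move: jn; rewrite leq_eqVlt => /predU1P[->|jn]; [exact: h0P|exact: IH].
Qed.

(** From here on displacements [z] within time [h] are measured by the discounted
    speed that [phi] prices. *)
Lemma rate_speed k h z : 0 < h ->
  rate p c k h * `|z| `^ p = h * (k * (expR (- (c * h)) * `|z| / h) `^ p).
Proof.
move=> h0; rewrite rateE// -!mulrA; congr (_ * (_ * _)).
have e0 : 0 <= expR (- (c * h)) / h by rewrite divr_ge0 ?expR_ge0// ltW.
by rewrite [`|z| / h]mulrC mulrA [in RHS](powRM _ e0).
Qed.

Let speed h z := expR (- (c * h)) * `|z| / h.

Let speed_ge0 h z : 0 < h -> 0 <= speed h z.
Proof. by move=> h0; rewrite divr_ge0 ?mulr_ge0 ?expR_ge0// ltW. Qed.

Let speedK h z : 0 < h -> `|z| = h * (expR (c * h) * speed h z).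
Proof.
move=> h0; rewrite /speed expRN; field.
by rewrite (gt_eqF h0) (gt_eqF (expR_gt0 _)).
Qed.

Let expR_le2 : exists2 h0, 0 < h0 & forall h, h <= h0 -> expR (c * h) <= 2.
Proof.
have [h0 h00 hP] := expR_small c0 (@ltr01 R); by exists h0 => // h /hP.
Qed.

Let u_Lip y z : u (y + z) <= u y + L * `|z|.
Proof.
have := is_Lip_bound_norm K1 uL (y + z) y.
by rewrite addrAC subrr add0r ler_norml => /andP[_]; rewrite lerBlDl.
Qed.

(** Displacements of speed above [V] are not worth their price. *)
Let fast k V h y z : 0 < h -> expR (c * h) <= 2 ->
  (forall v, V <= v -> 2 * L * v <= k * v `^ p) -> V <= speed h z ->
  u (y + z) - rate p c k h * `|z| `^ p <= u y.
Proof.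
move=> h0 e2 kV Vz; rewrite rate_speed// -/(speed h z) lerBlDr.
apply: le_trans (u_Lip y z) _; rewrite lerD2l (speedK z h0) mulrCA ler_pM2l//.
apply: le_trans (kV _ Vz); rewrite mulrA ler_wpM2r ?speed_ge0// mulrC.
by rewrite ler_wpM2r.
Qed.

Let increment_Cb h k : 0 < h -> 0 < k ->
  Cb K (fun y => h^-1 * Q (rate p c k h) u y + (- h^-1) * u y).
Proof. by move=> h0 k0; apply: Cb_lin => //; apply: (sup_conv_Cb p0) => //; exact: rate_gt0. Qed.

Let increment_ge0 h k y : 0 < h -> 0 < k ->
  0 <= h^-1 * Q (rate p c k h) u y + (- h^-1) * u y.
Proof.
move=> h0 k0; rewrite mulNr -mulrBr mulr_ge0 ?invr_ge0 ?(ltW h0)// subr_ge0.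
by apply: (sup_conv_ge p0 _ _ uM); rewrite ltW// rate_gt0.
Qed.

Let increment_le h k y B : 0 < h -> (forall z,
  u (y + z) - rate p c k h * `|z| `^ p <= u y + h * B) ->
  h^-1 * Q (rate p c k h) u y + (- h^-1) * u y <= B.
Proof.
move=> h0 uB; rewrite mulNr -mulrBr ler_pdivrMl// lerBlDl.
exact: sup_conv_le.
Qed.

Let ref_increment h k x : 0 < h -> 0 < k -> T h (Q (rate p c k h) u) x =
  T h u x + h * T h (fun y => h^-1 * Q (rate p c k h) u y + (- h^-1) * u y) x.
Proof.
move=> h0 k0; rewrite (ref_lin H)//; last first.
  by apply: (sup_conv_Cb p0) => //; exact: rate_gt0.
by field; rewrite gt_eqF.
Qed.

Let increment_bound h k V y : 0 < h -> 0 < k -> 0 <= V -> expR (c * h) <= 2 ->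
  (forall v, V <= v -> 2 * L * v <= k * v `^ p) ->
  h^-1 * Q (rate p c k h) u y + (- h^-1) * u y <= 2 * L * V.
Proof.
move=> h0 k0 V0 e2 kV; have B0 : 0 <= h * (2 * L * V).
  by rewrite !mulr_ge0// ltW.
apply: increment_le => // z; have [Vz|/ltW zV] := leP V (speed h z).
  by apply: le_trans (fast y h0 e2 kV Vz) _; rewrite lerDl.
rewrite lerBlDr; apply: le_trans (u_Lip y z) _; rewrite -addrA lerD2l.
apply: ler_wpDr; first by rewrite mulr_ge0 ?powR_ge0// ltW// rate_gt0.
rewrite {1}(speedK z h0) (_ : h * (2 * L * V) = L * (h * (2 * V))); last by ring.
rewrite ler_wpM2l// ler_pM2l//.
by rewrite ler_pM ?expR_ge0 ?speed_ge0.
Qed.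

Lemma I_upper_bound : exists2 B, 0 <= B & exists2 h0, 0 < h0 &
  forall h, 0 < h -> h <= h0 -> forall x, I h u x <= T h u x + h * B.
Proof.
have [k [D kD]] := minorant_exists p1 P; have k0 := kD.1.
have [V V0 kV] := powR_dominates p1 (mulr_ge0 (ler0n _ 2) L0) k0.
have [h0 h00 hP] := expR_le2.
exists (D + 2 * L * V).
  by rewrite addr_ge0 ?(minorant_D_ge0 p1 P kD)// !mulr_ge0// ltW.
exists h0 => // h hp hh x; apply: le_trans (I_weak H uC (ltW hp) hp kD) _.
rewrite (ref_increment x hp k0) mulrDr addrCA lerD2l lerD2l ler_pM2l//.
rewrite -[leRHS](@ref_cst R X mu psi h (2 * L * V) x).
apply: (ref_le H x (ltW hp) (increment_Cb hp k0) (Cb_cst K _)) => y.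
exact: (increment_bound y hp k0 (ltW V0) (hP h hh) kV).
Qed.

(** By weak duality with the minorant that is optimal for [w1], the increment of
    the sup-convolution over a time [h] is, at the points where the slope is at
    most [w1], bounded by [h] times the conjugate at [w1]. Tightness and
    continuity of the reference semigroup localise the bound at [x]. *)
Lemma I_upper_slope (w1 e r : R) : 0 <= w1 -> 0 < e -> exists2 h0, 0 < h0 &
  forall h, 0 < h -> h <= h0 -> forall x, `|x| <= r -> w x + 2 * e <= w1 ->
  I h u x <= T h u x + h * (cj w1 + 3 * e).
Proof.
move=> w10 e0; have [k [D [kD kDP]]] := conj_dual p1 P w10 e0; have k0 := kD.1.
have [V V0 kV] := powR_dominates p1 (mulr_ge0 (ler0n _ 2) L0) k0.
set E := cj w1 + e - D.
have E0 : 0 <= E.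
  by have := kDP 0 (lexx _); rewrite mul0r powR0 ?gt_eqF// mulr0 /E; lra.
pose m (a : R) := Num.max 0 (a + 2 * e - w1).
have m0 a : 0 <= m a by rewrite /m le_max lexx.
(* a bound in [Cb] that is sharp where [w y + 2 * e <= w1] and holds at all other
   points of the ball as well *)
pose f y := E + V * m (w y).
have fC : Cb K f.
  apply: (@Cb_comp _ _ _ (fun a => E + V * m a) w V (ltW V0)) => // a b.
  rewrite opprD addrACA subrr add0r -mulrBr normrM (gtr0_norm V0) ler_pM2l//.
  rewrite /m; have [|] := leP (a + 2 * e - w1) 0; have [|] := leP (b + 2 * e - w1) 0;
    rewrite ler_norml; have := ler_norm (a - b); have := ler_norm (b - a);
    rewrite (distrC b a); move: `|a - b| => d *; apply/andP; split; lra.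
have [Mf Mf0 fM] := Cb_bounded fC.
have [rho rhoP] := ref_tight H 1 (Num.max (2 * L * V) Mf) r e0.
have [s0 s00 sP] := slope_upper K1 uL ud rho wC e0.
have [h1 h10 h1P] := ref_near_id H r fC e0.
have Le0 : 0 < L + e by rewrite ltr_wpDl.
have [h2 h20 h2P] := expR_small c0 (divr_gt0 e0 Le0).
have [h3 h30 h3P] := expR_le2.
have h40 : 0 < s0 / (2 * V) by rewrite divr_gt0// mulr_gt0.
exists (Num.min (Num.min 1 h1) (Num.min h2 (Num.min h3 (s0 / (2 * V))))).
  by rewrite !lt_min ltr01 h10 h20 h30 h40.
move=> h hp; rewrite !le_min => /andP[/andP[hh0 hh1]] /and3P[hh2 hh3 hh4] x xr xw.
have e2 := h3P h hh3.
pose G y := h^-1 * Q (rate p c k h) u y + (- h^-1) * u y.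
have GC : Cb K G := increment_Cb hp k0.
have Gf y : `|y| <= rho -> G y <= f y.
  move=> yr; apply: increment_le => // z; have [Vz|/ltW zV] := leP V (speed h z).
    apply: le_trans (fast y hp e2 kV Vz) _; rewrite lerDl mulr_ge0 ?(ltW hp)//.
    by rewrite addr_ge0// mulr_ge0// ltW.
  have v0 := speed_ge0 z hp; have zE := speedK z hp.
  have zs : `|z| <= s0.
    apply: (@le_trans _ _ (h * (2 * V))).
      by rewrite zE ler_pM2l// ler_pM// expR_ge0.
    by rewrite -ler_pdivlMr// mulr_gt0.
  have we : (w y + e) * expR (c * h) <= w y + 2 * e.
    have we0 : 0 <= w y + e by rewrite addr_ge0// ltW.
    apply: le_trans (ler_wpM2l we0 (h2P h hh2)) _.
    rewrite mulrDr mulr1 mulr_natl mulr2n addrA lerD2l mulrCA ger_pMr//.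
    by rewrite ler_pdivrMr// mul1r lerD2r.
  have wm : w y + 2 * e <= w1 + m (w y).
    by rewrite -lerBlDl /m le_max lexx orbT.
  rewrite rate_speed// -/(speed h z) lerBlDr -addrA -mulrDr.
  apply: le_trans (sP y z yr zs) _; rewrite lerD2l.
  rewrite {1}zE mulrCA ler_pM2l// mulrA.
  apply: le_trans (ler_wpM2r v0 (le_trans we wm)) _.
  have := kDP _ v0; have := ler_wpM2r (m0 (w y)) zV; rewrite /f /E; lra.
have GM y : `|G y| <= Num.max (2 * L * V) Mf.
  rewrite ger0_norm; last exact: increment_ge0.
  by rewrite le_max increment_bound// ltW.
have fM' y : `|f y| <= Num.max (2 * L * V) Mf by rewrite le_max fM orbT.
have TG : T h G x <= f x + 2 * e.
  have A : T h G x <= T h f x + 0 + e.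
    apply: rhoP => //; first by exists h; split=> //; exact: ltW.
    by move=> y yr; rewrite addr0; exact: Gf.
  have := h1P h (ltW hp) hh1 x xr; rewrite ler_norml => /andP[_].
  by move: A; move: (T h G x) (T h f x) => a b; lra.
have fx : f x = E.
  rewrite /f /m (_ : Num.max _ _ = 0) ?mulr0 ?addr0//.
  by apply/max_idPl; rewrite subr_le0.
apply: le_trans (I_weak H uC (ltW hp) hp kD) _.
rewrite (ref_increment x hp k0) -/G addrCA lerD2l -mulrDr ler_pM2l//.
by move: TG; rewrite fx /E; move: (T h G x) => a; lra.
Qed.

(** Finitely many reference slopes [w1], spaced by [e1], serve all points. *)
Lemma I_upper r e : 0 < e -> exists2 h0, 0 < h0 &
  forall h, 0 < h -> h <= h0 -> forall x, `|x| <= r ->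
  I h u x <= T h u x + h * (cj (w x) + e).
Proof.
move=> e0; have L30 : 0 <= L + 3 by rewrite addr_ge0.
have [V V0 VP] := conj_Lip p1 P L30.
have V10 : 0 < 3 * V + 3 by rewrite addr_gt0// mulr_gt0.
pose e1 := Num.min 1 (e / (3 * V + 3)).
have e10 : 0 < e1 by rewrite lt_min ltr01 divr_gt0.
have e11 : e1 <= 1 by rewrite ge_min lexx.
have e1e : e1 * (3 * V + 3) <= e by rewrite -ler_pdivlMr// ge_min lexx orbT.
have w1P j : 0 <= e1 * (j + 3)%:R by rewrite mulr_ge0// ltW.
have [h0 h00 hP] := uniform_right (fun j => I_upper_slope r (w1P j) e10)
  (Num.truncn (L / e1)).
exists h0 => // h hp hh x xr; pose j := Num.truncn (w x / e1).
have q0 : 0 <= w x / e1 := divr_ge0 (w0 x) (ltW e10).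
have jL : (j <= Num.truncn (L / e1))%N.
  by apply: le_truncn; rewrite ler_pM2r ?invr_gt0.
have /andP[] := truncn_itv q0; rewrite -/j.
rewrite ler_pdivlMr// ltr_pdivrMr// -addn1 natrD => j1 j2.
have := hP j h jL hp hh x xr; rewrite natrD => /(_ _)/le_trans; apply.
  by move: j2; lra.
rewrite lerD2l ler_pM2l//.
have W : cj (e1 * (j%:R + 3)) <= cj (w x) + V * `|e1 * (j%:R + 3) - w x|.
  apply: VP => //.
  - by have := w1P j; rewrite natrD.
  - by have := wL x; move: j1 e11; lra.
have : V * `|e1 * (j%:R + 3) - w x| <= V * (3 * e1).
  rewrite ler_pM2l// ler_norml; apply/andP; split; move: j1 j2; lra.
move: W e1e; lra.
Qed.

(** Strong duality replaces the construction of a measure that moves mass at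
    speed [v]: the price of such a displacement in the sup-convolution, less the
    constant of the minorant, is at most [h * phi v]. *)
Lemma I_lower_speed h v f x : 0 < h -> 0 <= v -> phi v = f%:E ->
  T h (ball_sup (h * (expR (c * h) * v)) u) x <= I h u x + h * f.
Proof.
move=> h0 v0 vf; set s := h * _.
have s0 : 0 <= s by rewrite !mulr_ge0 ?expR_ge0// ltW.
have MC := Lipb_Cb (ball_sup_Lipb s0 uL uM).
apply/ler_addgt0Pr => e e0; have [k [D [kD IS]]] := I_strong H uC (ltW h0) h0 e0 (x := x).
have k0 := kD.1; have l0 := rate_gt0 p c k0 h0.
have QC := sup_conv_Cb p0 l0 uC.
have A : T h (ball_sup s u) x <= h * (k * v `^ p) + T h (Q (rate p c k h) u) x.
  rewrite -(refDr H)//; apply: (ref_le H) (ltW h0) MC _ _; first exact: CbDr.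
  move=> y; apply: ball_sup_le => // z zs; rewrite -lerBlDl.
  apply: le_trans (sup_conv_ub y z (ltW l0) uM (p := p)).
  rewrite lerD2l lerN2 rate_speed// ler_pM2l// ler_pM2l// -/(speed h z).
  apply: (ge0_ler_powR (ltW p0)); rewrite ?nnegrE ?speed_ge0//.
  rewrite -(@ler_pM2l _ (expR (c * h))) ?expR_gt0// -(ler_pM2l h0) -speedK//.
have B : k * v `^ p - D <= f.
  by have := kD.2 v v0; rewrite vf lee_fin.
apply: le_trans A _; have := ler_wpM2l (ltW h0) B; rewrite mulrBr.
by move: IS; move: (T h _ x) (I h u x) => a b; lra.
Qed.

(** Displacements at a fixed speed [v] gain [v * w x] per unit of time, and the
    supremum over [v] of the gain minus the price is the conjugate; bounded speeds
    are enough, which makes the error uniform in [v]. *)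
Lemma I_lower r e : 0 < e -> exists2 h0, 0 < h0 &
  forall h, 0 < h -> h <= h0 -> forall x, `|x| <= r ->
  T h u x + h * (cj (w x) - e) <= I h u x.
Proof.
move=> e0; have [V V0 VP] := conj_large p1 P L0.
have V20 : 0 < 3 * V + 1 by rewrite addr_gt0// mulr_gt0.
pose e1 := e / (3 * V + 1); have e10 : 0 < e1 by rewrite divr_gt0.
have e1e : e1 * (3 * V + 1) = e by rewrite /e1 divfK// gt_eqF.
pose B := Num.max (2 * L * V) (V * (L + 2 * e1)).
have [rho rhoP] := ref_tight H 1 B r e10.
have [s0 s00 sP] := slope_lower K1 (model_compact H) uL ud rho wC e10.
have [h1 h10 h1P] := ref_near_id H r wC e10.
have [h3 h30 h3P] := expR_le2.
have h40 : 0 < s0 / (2 * V) by rewrite divr_gt0// mulr_gt0.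
exists (Num.min (Num.min 1 h1) (Num.min h3 (s0 / (2 * V)))).
  by rewrite !lt_min ltr01 h10 h30 h40.
move=> h hp; rewrite !le_min => /andP[/andP[hh0 hh1]] /andP[hh3 hh4] x xr.
have e2 := h3P h hh3.
have eg1 : 1 <= expR (c * h) by rewrite -expR0 ler_expR mulr_ge0// ltW.
suff A : cj (w x) <= h^-1 * (I h u x - T h u x) + e.
  rewrite -lerBrDl -ler_pdivlMl//; move: A; lra.
have IT : 0 <= h^-1 * (I h u x - T h u x).
  by rewrite mulr_ge0 ?invr_ge0 ?(ltW hp)// subr_ge0; exact: (I_ge_ref H uC (ltW hp)).
apply: (conj_lub p1 P (w0 x)) => v f v0 vf.
have [Vv|/ltW vV] := leP V v.
  have := VP v (w x) Vv (wL x); rewrite vf lee_fin => A; apply: le_trans A _.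
  by rewrite lerDr addr_ge0// ltW.
set s := h * (expR (c * h) * v).
have s0' : 0 <= s by rewrite !mulr_ge0 ?expR_ge0// ltW.
have ss : s <= s0.
  apply: (@le_trans _ _ (h * (2 * V))).
    by rewrite ler_pM2l// ler_pM// expR_ge0.
  by rewrite -ler_pdivlMr// mulr_gt0.
have MC := Lipb_Cb (ball_sup_Lipb s0' uL uM).
pose G y := h^-1 * ball_sup s u y + (- h^-1) * u y.
have GC : Cb K G by exact: Cb_lin.
have G0 y : 0 <= G y.
  rewrite /G mulNr -mulrBr mulr_ge0 ?invr_ge0 ?(ltW hp)// subr_ge0.
  exact: (ball_sup_ge s0' uM).
have GM y : `|G y| <= B.
  rewrite ger0_norm// /B le_max; apply/orP; left.
  rewrite /G mulNr -mulrBr ler_pdivrMl// lerBlDl; apply: ball_sup_le => // z zs.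
  apply: le_trans (u_Lip y z) _; rewrite lerD2l.
  apply: (@le_trans _ _ (L * s)); first exact: ler_wpM2l.
  rewrite (_ : h * (2 * L * V) = L * (h * (2 * V))); last by ring.
  by rewrite ler_wpM2l// /s ler_pM2l// ler_pM// expR_ge0.
pose g y := v * w y + (- (2 * e1)) * v.
have gC : Cb K g by apply: (Cb_lin _ _ wC); exact: Cb_cst.
have gM y : `|g y| <= B.
  rewrite le_max; apply/orP; right; rewrite /g mulrC -mulrDl normrM mulrC.
  apply: ler_pM => //; first by rewrite ger0_norm.
  by have := w0 y; have := wL y; rewrite ler_norml => ? ?; apply/andP; split; lra.
have gG y : `|y| <= rho -> g y <= G y + 0.
  move=> yr; rewrite addr0; have [z zs zP] := sP y s yr s0' ss.
  have A : (w y - e1) * s <= ball_sup s u y - u y.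
    rewrite lerBrDl; apply: le_trans zP _; exact: ball_sup_ub uM _ _ _.
  rewrite /G mulNr -mulrBr ler_pdivlMl//; apply: le_trans A.
  have -> : g y = v * (w y - 2 * e1) by rewrite /g; ring.
  rewrite /s [leRHS]mulrCA ler_pM2l// [leRHS]mulrA [leRHS]mulrC ler_wpM2l//.
  have [we|we] := leP 0 (w y - e1).
    by apply: (@le_trans _ _ (w y - e1)); [lra|rewrite ler_peMr].
  apply: (@le_trans _ _ ((w y - e1) * 2)); first by have := w0 y; lra.
  by rewrite ler_wnM2l// ltW.
have TG : v * w x - 3 * e1 * v - e1 <= T h G x.
  have A : T h g x <= T h G x + 0 + e1.
    by apply: rhoP => //; exists h; split=> //; exact: ltW.
  have := h1P h (ltW hp) hh1 x xr; rewrite ler_norml => /andP[wx _].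
  have := ler_wpM2l v0 wx; move: A.
  rewrite (ref_lin H _ _ _ _ wC (Cb_cst K v)) ref_cst.
  by rewrite -/w; move: (T h G x) (T h w x) (w x) => a b d; lra.
have := I_lower_speed x hp v0 vf; rewrite -/s.
have -> : T h (ball_sup s u) x = T h u x + h * T h G x.
  by rewrite /G (ref_lin H)//; field; rewrite gt_eqF.
rewrite -lerBlDr => A.
have {}A : T h G x - f <= h^-1 * (I h u x - T h u x).
  by rewrite ler_pdivlMl// mulrBr; move: A; lra.
have := ler_wpM2l (ltW e10) vV.
by move: A TG e1e; move: (h^-1 * _) (T h G x) => a b; lra.
Qed.

End StepSlope.


(** * The generator *)

Lemma generator_unique {R : realType} {X : normedModType R} (K : {linear X -> X})
    (S : R -> (X -> R) -> X -> R) (u g g' : X -> R) :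
  is_generator_at K S u g -> is_generator_at K S u g' -> g = g'.
Proof.
move=> [_ /right0_convP[_ gP]] [_ /right0_convP[_ g'P]]; apply/funext => x.
apply/eqP; rewrite -subr_eq0 -normr_eq0 eq_le normr_ge0 andbT.
apply/ler_addgt0Pr => e e0; rewrite add0r; have e20 : 0 < e / 2 by rewrite divr_gt0.
have /near0_rightP[h1 h10 h1P] := gP `|x| _ e20.
have /near0_rightP[h2 h20 h2P] := g'P `|x| _ e20.
have m0 : 0 < Num.min h1 h2 by rewrite lt_min h10.
have := h1P _ m0; rewrite ge_min lexx => /(_ isT x (lexx _)) A.
have := h2P _ m0; rewrite ge_min lexx orbT => /(_ isT x (lexx _)) B.
rewrite distrC in B; apply: le_trans (ler_distD _ _ _) _.
by rewrite [leRHS]splitr; exact: lerD A B.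
Qed.

Lemma genE {R : realType} {X : normedModType R} (K : {linear X -> X})
    (S : R -> (X -> R) -> X -> R) (u g : X -> R) :
  is_generator_at K S u g -> gen K S u = g.
Proof. by move=> ug; exact: (generator_unique (getPex (ex_intro _ g ug)) ug). Qed.

Section Generator.
Context {R : realType} {X : normedModType R} {K : {linear X -> X}} {p c : R}
  {mu : R -> probability (borel X) R} {psi : R -> X -> X} {phi : R -> \bar R}.
Context (H : model K p c mu psi phi).
Local Notation T := (ref_op mu psi).
Local Notation I := (I_op p c phi mu psi).
Local Notation J := (I_iter p c phi mu psi).
Local Notation S := (S_op p c phi mu psi).
Local Notation adm := (@admissible R X K p c mu psi phi).
Local Notation cj := (conj_val phi).
Context {u g0 : X -> R} {L M : R} (uL : is_Lip_bound K u L)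
  (uM : forall x, `|u x| <= M)
  (ud : forall x, differentiable (u : X -> R^o) x) (wC : Cb K (deriv_norm u))
  (ug : is_generator_at K T u g0).
Implicit Types (r e t s h d : R) (x y : X) (n k : nat).
Let w := deriv_norm u.
Let p1 : 1 < p. Proof. exact: model_p_gt1 H. Qed.
Let K1 := model_contr H.
Let P := model_phi H.
Let uC : Cb K u. Proof. by apply: Lipb_Cb; apply/LipbP; exists L, M. Qed.
Let L0 : 0 <= L. Proof. exact: uL.1. Qed.
Let w0 x : 0 <= w x. Proof. exact: (deriv_norm_ge0 K1 uL ud). Qed.
Let wL x : w x <= L. Proof. exact: (deriv_norm_le K1 uL ud). Qed.
Let g x := g0 x + cj (w x).

(** The conjugate is Lipschitz on the range of slopes of [u]. *)
Lemma Cb_conj : Cb K (fun x => cj (deriv_norm u x)).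
Proof.
have [V V0 VP] := conj_Lip p1 P L0; pose m (a : R) := Num.max 0 (Num.min a L).
have mL a : 0 <= m a <= L by rewrite /m le_max lexx ge_max L0 ge_min lexx orbT.
have mlip a b : `|m a - m b| <= `|a - b|.
  rewrite /m /Num.max /Num.min; have := ler_norm (a - b); have := ler_norm (b - a).
  rewrite (distrC b a) ler_norml; move: `|a - b| => d.
  by case: (ltP a L) => ?; case: (ltP b L) => ?; case: ltP => ?; case: ltP => ? ? ?;
    apply/andP; split; move: L0; lra.
rewrite (_ : (fun x => _) = (cj \o m) \o w); last first.
  apply/funext => x /=; congr (cj _).
  by rewrite /m (min_idPl (wL x)) (max_idPr (w0 x)).
apply: (Cb_comp (ltW V0)) wC => a b; have /andP[a0 aL] := mL a.
have /andP[b0 bL] := mL b; have A := VP _ _ a0 aL b0; have B := VP _ _ b0 bL a0.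
apply: (@le_trans _ _ (V * `|m a - m b|)); last by rewrite ler_pM2l.
rewrite (distrC (m b)) in B; move: A B; rewrite /= ler_norml.
by move: (cj (m a)) (cj (m b)) => ? ? ? ?; apply/andP; split; lra.
Qed.

Let gC : Cb K g. Proof. by apply: CbD Cb_conj; case: ug. Qed.

Let I_slope r e : 0 < e -> exists2 h0, 0 < h0 & forall h, 0 < h -> h <= h0 ->
  forall x, `|x| <= r -> `|(I h u x - u x) / h - g x| <= e.
Proof.
move=> e0; have e20 : 0 < e / 2 by rewrite divr_gt0.
have [_ /right0_convP[_ /(_ r _ e20)/near0_rightP[h1 h10 h1P]]] := ug.
have [h2 h20 h2P] := I_upper H uL uM ud wC r e20.
have [h3 h30 h3P] := I_lower H uL uM ud wC r e20.
exists (Num.min h1 (Num.min h2 h3)); first by rewrite !lt_min h10 h20.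
move=> h h0; rewrite !le_min => /and3P[hh1 hh2 hh3] x xr.
have := h1P h h0 hh1 x xr; have := h2P h h0 hh2 x xr; have := h3P h h0 hh3 x xr.
rewrite /g -/w; move: (I h u x) (T h u x) (cj (w x)) => a b j A B.
have -> : (a - u x) / h = (b - u x) / h + (a - b) / h by field; rewrite gt_eqF.
have {}A : j - e / 2 <= (a - b) / h by rewrite ler_pdivlMr// mulrC; lra.
have {}B : (a - b) / h <= j + e / 2 by rewrite ler_pdivrMr// mulrC; lra.
move: ((a - b) / h) A B ((b - u x) / h) => q A B q'.
by rewrite !ler_norml => /andP[C D]; apply/andP; split; lra.
Qed.

Let slope_bound : exists2 B, 0 <= B & exists2 h0, 0 < h0 &
  forall h Q, 0 < h -> h <= h0 -> adm h Q -> forall x, `|(Q u x - u x) / h| <= B.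
Proof.
have [_ /right0_convP[[B1 /near0_rightP[h1 h10 h1P]] _]] := ug.
have [B2 B20 [h2 h20 h2P]] := I_upper_bound H uL uM.
have m0 : 0 < Num.min h1 h2 by rewrite lt_min h10.
have B10 : 0 <= B1.
  by apply: le_trans (normr_ge0 _) (h1P h1 h10 (lexx _) 0).
exists (B1 + B2); first exact: addr_ge0.
exists (Num.min h1 h2) => // h Q h0; rewrite le_min => /andP[hh1 hh2] aQ x.
have := h1P h h0 hh1 x; have := adm_ge aQ x uC.
have := le_trans (adm_le aQ x uC) (h2P h h0 hh2 x).
move: (Q u x) (T h u x) => a b A B.
have -> : (a - u x) / h = (b - u x) / h + (a - b) / h by field; rewrite gt_eqF.
have {}B : 0 <= (a - b) / h by rewrite divr_ge0 ?(ltW h0)// subr_ge0.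
have {}A : (a - b) / h <= B2 by rewrite ler_pdivrMr// mulrC; lra.
move: ((a - b) / h) A B ((b - u x) / h) => q A B q'.
by rewrite !ler_norml => /andP[C D]; apply/andP; split; lra.
Qed.

(** Put [f = (I d u - u) / d]. Convexity bounds the increment of [Q] from [u] to
    [u + d * f] from below by [d] times its increment from [u - f] to [u]. The
    latter does not shrink with [d], and is under control as soon as [Q] is close
    to the identity. *)
Let adm_increment r e : 0 < e -> exists2 h0, 0 < h0 & forall t d Q, 0 <= t ->
  t <= h0 -> 0 < d -> d <= h0 -> adm t Q -> forall x, `|x| <= r ->
  Q u x + d * (g x - e) <= Q (I d u) x.
Proof.
move=> e0; have e40 : 0 < e / 4 by rewrite divr_gt0.
have [B B0 [h1 h10 h1P]] := slope_bound.
have [Mg Mg0 gM] := Cb_bounded gC.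
have [rho rhoP] := adm_tight H 1 (M + Num.max B Mg) r e40.
have [h2 h20 h2P] := I_slope rho e40.
have [h3 h30 h3P] := adm_near_id H r uC e40.
have ugC : Cb K (fun y => u y - g y) := CbB uC gC.
have [h4 h40 h4P] := adm_near_id H r ugC e40.
exists (Num.min (Num.min 1 h1) (Num.min h2 (Num.min h3 h4))).
  by rewrite !lt_min ltr01 h10 h20 h30.
move=> t d Q t0; rewrite !le_min => /andP[/andP[t1 _]] /and3P[_ th3 th4].
move=> d0 /andP[/andP[_ dh1]] /and3P[dh2 _ _] aQ x xr.
have IC : Cb K (I d u) := adm_Cb H (ltW d0) (adm_I H (ltW d0)) uC.
pose v y := (1 + d^-1) * u y + (- d^-1) * I d u y.
have vE y : v y = u y - (I d u y - u y) / d by rewrite /v; ring.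
have vC : Cb K v by exact: Cb_lin.
have vM y : `|v y| <= M + Num.max B Mg.
  rewrite vE; apply: le_trans (ler_normB _ _) _; apply: lerD (uM y) _.
  by rewrite le_max (h1P d (I d) d0 dh1 (adm_I H (ltW d0))).
have ugM y : `|u y - g y| <= M + Num.max B Mg.
  by apply: le_trans (ler_normB _ _) _; apply: lerD (uM y) _; rewrite le_max gM orbT.
have vug y : `|y| <= rho -> v y <= u y - g y + e / 4.
  move=> yr; rewrite vE; have := h2P d d0 dh2 y yr.
  move: (I d u y) (g y) => a b; rewrite ler_norml => /andP[A _].
  by move: ((a - u y) / d) A => q A; lra.
have A : Q v x <= Q (fun y => u y - g y) x + e / 4 + e / 4.
  apply: (rhoP Q v _ (e / 4) _ vC ugC (ltW e40) vM ugM vug x xr).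
  by exists t; split=> //.
have B' := h3P t Q t0 th3 aQ x xr.
have C := h4P t Q t0 th4 aQ x xr.
have d10 : 0 < 1 + d by rewrite addr_gt0.
have l0 : 0 <= (1 + d)^-1 by rewrite invr_ge0 ltW.
have l1 : (1 + d)^-1 <= 1 by rewrite invf_le1// lerDl ltW.
have := adm_convex aQ x IC vC l0 l1.
have -> : (fun y => (1 + d)^-1 * I d u y + (1 - (1 + d)^-1) * v y) = u.
  apply/funext => y; rewrite /v; move: (I d u y) (u y) => a b.
  by field; rewrite !gt_eqF.
move: A B' C; move: (Q u x) (Q v x) (Q (I d u) x).
move: (Q (fun y => u y - g y) x) (g x) (u x) => b' gx ux a b q A; rewrite !ler_norml => /andP[B1 _] /andP[_ C1] D.
have {}D : (1 + d) * a <= q + d * b.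
  apply: le_trans (ler_wpM2l (ltW d10) D) _.
  rewrite mulrDr !mulrA mulfV ?gt_eqF// mul1r lerD2l mulrBr mulr1 mulfV ?gt_eqF//.
  by rewrite addrAC subrr add0r.
have : d * (gx - e) <= d * (a - b) by rewrite ler_pM2l//; lra.
by move: D; rewrite mulrDl mul1r !mulrBr; lra.
Qed.

Let Iiter_short n s : 0 <= s -> s < mesh n -> J n s u = I s u.
Proof.
move=> s0 sn; rewrite Iiter_fun (_ : Num.truncn _ = 0%N); last first.
  apply/eqP; rewrite truncn_eq ?divr_ge0 ?(ltW (mesh_gt0 n))//.
  by rewrite /= ltr_pdivrMr ?mesh_gt0// mul1r.
by rewrite /= mul0r subr0.
Qed.

Let I0u : I 0 u = u.
Proof. by apply/funext => x; exact: (I0 H). Qed.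

Let Iiter_mesh n : J n (mesh n) u = I (mesh n) u.
Proof.
have -> : mesh n = 1%:R * mesh n + 0 :> R by rewrite mul1r addr0.
rewrite (Iiter_dyadic H)// Iiter_short ?mesh_gt0// I0u Iiter_fun.
rewrite mulfK ?gt_eqF ?mesh_gt0// natrK subrr I0u /=.
by rewrite mul1r addr0.
Qed.

(** The iteration is a telescope of increments, each bounded from below by
    [adm_increment] with a constant that does not depend on the grid. *)
Let Iiter_lower r e : 0 < e -> exists2 h0, 0 < h0 & forall n h, 0 <= h ->
  h <= h0 -> forall x, `|x| <= r -> u x + h * (g x - e) <= J n h u x.
Proof.
move=> e0; have [h0 h00 hP] := adm_increment r e0; exists h0 => // n h hp hh x xr.
have m0 := mesh_gt0 (R := R) n.
have dyadic k : k%:R * mesh n <= h0 ->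
    u x + k%:R * mesh n * (g x - e) <= J n (k%:R * mesh n) u x.
  elim: k => [_|k IH].
    by rewrite !mul0r addr0 Iiter_short// I0u.
  rewrite -addn1 natrD [_ * mesh n]mulrDl mul1r => kh.
  have k0 : 0 <= k%:R * mesh n :> R by rewrite mulr_ge0// ltW.
  have kh' : k%:R * mesh n <= h0 by apply: le_trans kh; rewrite lerDl ltW.
  have mh : mesh n <= h0 by apply: le_trans kh; rewrite lerDr.
  rewrite (Iiter_dyadic H _ _ (ltW m0) uC) Iiter_mesh mulrDl addrA.
  apply: le_trans (hP _ _ _ k0 kh' m0 mh (adm_Iiter H n k0) x xr).
  by rewrite lerD2r; exact: IH.
set k := Num.truncn (h / mesh n); set s := h - k%:R * mesh n.
have s0 : 0 <= s by exact: remainder_ge0.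
have hE : h = k%:R * mesh n + s by rewrite /s addrC subrK.
have k0 : 0 <= k%:R * mesh n :> R by rewrite mulr_ge0// ltW.
have kh : k%:R * mesh n <= h0 by apply: le_trans hh; rewrite [leRHS]hE lerDl.
have sh : s <= h0 by apply: le_trans hh; rewrite [leRHS]hE lerDr.
have sm : s < mesh n.
  have /andP[_] := truncn_itv (divr_ge0 hp (ltW m0)).
  by rewrite -/k ltr_pdivrMr// -addn1 natrD mulrDl mul1r /s ltrBlDl.
rewrite {2}hE (Iiter_dyadic H _ _ s0 uC) Iiter_short// {1}hE.
have [->|sp] := eqVneq s 0; first by rewrite addr0 I0u; exact: dyadic.
have {}sp : 0 < s by rewrite lt_def sp.
rewrite mulrDl addrA; apply: le_trans (hP _ _ _ k0 kh sp sh (adm_Iiter H n k0) x xr).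
by rewrite lerD2r; exact: dyadic.
Qed.

(** The upper bound is that of one step, as [S] lies below [I]; the lower bound
    for the iterations passes to the infimum because it is uniform in [n]. *)
Lemma S_generator :
  is_generator_at K S u (fun x => g0 x + cj (deriv_norm u x)).
Proof.
split; first exact: gC.
apply/right0_convP; split.
  have [B B0 [h0 h00 hP]] := slope_bound; exists B; apply/near0_rightP.
  exists h0 => // h hp hh x; exact: (hP h (S h) hp hh (adm_S H (ltW hp))).
move=> r e e0; apply/near0_rightP.
have [h1 h10 h1P] := I_slope r e0; have [h2 h20 h2P] := Iiter_lower r e0.
exists (Num.min h1 h2); first by rewrite lt_min h10.
move=> h h0; rewrite le_min => /andP[hh1 hh2] x xr.
have A : u x + h * (g x - e) <= S h u x.
  apply: (S_ge H (ltW h0) uC (m := 0%N)) => n _.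
  exact: (h2P n h (ltW h0) hh2 x xr).
have B := adm_le (adm_S H (ltW h0)) x uC.
have := h1P h h0 hh1 x xr; rewrite -/w -/(g x).
move: (S h u x) (I h u x) (g x) A B => a b gx A B; rewrite !ler_norml => /andP[_ C].
have {}A : gx - e <= (a - u x) / h by rewrite ler_pdivlMr// mulrC lerBrDl.
have {}B : (a - u x) / h <= (b - u x) / h by rewrite ler_pM2r ?invr_gt0// lerD2r.
by move: ((a - u x) / h) ((b - u x) / h) A B C => q q' A B C; apply/andP; split; lra.
Qed.

End Generator.

Lemma generator_formula (R : realType) (X : normedModType R) (K : {linear X -> X}) (p c : R)
  (mu : R -> probability (borel X) R) (psi : R -> X -> X) (phi : R -> \bar R)
  (H : model K p c mu psi phi) (u : X -> R) :
  let S := S_op p c phi mu psi in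
  let T := ref_op mu psi in
  gen_dom K T u -> Cb1 K u ->
    gen_dom K S u /\
    forall x : X,
      (gen K S u x)%:E =
      ((gen K T u x)%:E + conjugate phi (deriv_norm u x))%E.
Proof.
move=> S T [uC [g0 ug]] [/LipbP[L [M [uL uM]]] ud wC].
have Sg := S_generator H uL uM ud wC ug.
split; first by split=> //; exists (fun x => g0 x + conj_val phi (deriv_norm u x)).
move=> x; rewrite (genE Sg) (genE ug) EFinD.
rewrite (conjE (model_p_gt1 H) (model_phi H))//.
exact: (deriv_norm_ge0 (model_contr H) uL ud).
Qed.

Theorem theorem3p14 (R : realType) (X : completeNormedModType R)
    (K : {linear X -> X}) (p c : R)
    (mu : R -> probability (borel X) R) (psi : R -> X -> X)
    (phi : R -> \bar R)
    (X_separable : separable X)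
    (K_compact : forall r : R, 0 <= r -> compact (K @` nball r))
    (K_dense : dense (range K))
    (K_contr : forall x : X, `|K x| <= `|x|)
    (p_gt1 : 1 < p)
    (mu_Pp : forall t, 0 <= t -> Pp p (mu t))
    (psi_continuous : forall t, 0 <= t -> continuous (psi t))
    (chapman_kolmogorov : forall (s t : R) (u : X -> R) (x : X),
       0 <= s -> 0 <= t -> Cb K u ->
       \int[mu (t + s)]_y u (psi (t + s) x + (y : X)) =
       \int[mu t]_yt (\int[mu s]_ys u (psi s (psi t x + (yt : X)) + (ys : X))))
    (c_ge0 : 0 <= c)
    (psi_lip : forall (t : R) (x1 x2 : X), 0 <= t ->
       `|psi t x1 - psi t x2| <= expR (c * t) * `|x1 - x2|)
    (K_psi : forall (t : R) (x : X), 0 <= t -> K (psi t x) = psi t (K x))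
    (psi0 : forall x : X, psi 0 x = x)
    (psi_cvg : forall r : R, 0 <= r ->
       ereal_sup [set (`|psi h (K x) - K x|)%:E | x in nball r]
         @[h --> 0^'+] --> (0 : \bar R))
    (mu_cvg : (\int[mu h]_y ((`|y : X| `^ p)%R%:E))%E
         @[h --> 0^'+] --> (0 : \bar R))
    (phi_penalisation : penalisation p phi) :
  let S := S_op p c phi mu psi in
  let T := ref_op mu psi in
  convex_transition_semigroup K c S /\
  forall u : X -> R, gen_dom K T u -> Cb1 K u ->
    gen_dom K S u /\
    forall x : X,
      (gen K S u x)%:E =
      ((gen K T u x)%:E + conjugate phi (deriv_norm u x))%E.
Proof.
have H : model K p c mu psi phi by split.
split; first exact: S_transition_semigroup H.
exact: generator_formula H.
Qed.
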